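(* Let $n>3$, let $S=\{v_1,\dots,v_m\}\subset\mathbb Z^n$ be generic and let $N$, $F^{0,1}$, $F^{0,2}$, the eigenvalues $\mu^{(i)}_\nu(\xi)$, the spaces $F^{0,1}_\mu$, $F^{0,2}_{\mu,\mu'}$, the constant $\kappa$ and the set $\mathcal C$ be as in the context. For all $\xi\in\mathcal C$ the operator $\mathrm{ad}(N)$ is invertible on each $F^{0,2}_{\mu^{(i)}_\nu,\mu^{(j)}_{\nu'}}$ such that $\mu^{(i)}_\nu+\mu^{(j)}_{\nu'}\not\equiv0$ (as a function of $\xi$). For all $f\in F^{0,2}_{\mu^{(i)}_\nu,\mu^{(j)}_{\nu'}}$ one has $$|\mathrm{ad}(N)^{-1}f|_{D(s,r)}\le C\,\frac{\max(1,|\nu+\nu'|)^{\kappa^2\tau_0+1}}{\delta+r^\alpha}\,|f|_{D(s,r)},$$ with $C$ a universal constant (independent of $\nu,\nu',i,j,f$), where $\delta=1$ if the integer $\mu^{(i)}_\nu(0)+\mu^{(j)}_{\nu'}(0)$ is nonzero and $\delta=0$ otherwise.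
   Context: ''Generic'' means that $(v_1,\dots,v_m)$ lies outside the zero set of a suitable nonzero polynomial with integer coefficients. $S^c=\mathbb Z^n\setminus S$, $\pi(\nu)=\sum_i\nu_iv_i$ for $\nu\in\mathbb Z^m$; parameters $\xi\in A_\alpha=\{\frac12r^\alpha\le\xi_i\le r^\alpha\}$, $0<\alpha<2$, $r$ small. Variables $x\in\mathbb T^m$, $y\in\mathbb R^m$, $w=(z,\bar z)$, $z=(z_k)_{k\in S^c}$; write $z^+_k=z_k$, $z_k^-=\bar z_k$. Poisson bracket: $\{F,G\}=\partial_yF\cdot\partial_xG-\partial_yG\cdot\partial_xF+i\sum_k(\partial_{\bar z_k}F\,\partial_{z_k}G-\partial_{z_k}F\,\partial_{\bar z_k}G)$; $\mathrm{ad}(N)X=\{N,X\}$. $N=(\omega(\xi),y)+\sum_{k\in S^c}\Omega_k|z_k|^2+Q$, with $\omega_i=|v_i|^2-2\xi_i+4\sum_j\xi_j$, $\Omega_k=|k|^2+4\sum_j\xi_j$ and $$Q=4\sum^{*}\sqrt{\xi_i\xi_j}\,e^{i(x_i-x_j)}z_h\bar z_k+2\sum^{**}\sqrt{\xi_i\xi_j}\bigl(e^{-i(x_i+x_j)}z_hz_k+e^{i(x_i+x_j)}\bar z_h\bar z_k\bigr),$$ where $\sum^*$ is over $i\neq j$ and $h,k\in S^c$ with $h+v_i=k+v_j$, $|h|^2+|v_i|^2=|k|^2+|v_j|^2$, and $\sum^{**}$ over $i<j$ and ordered pairs $h,k\in S^c$ with $h+k=v_i+v_j$, $|h|^2+|k|^2=|v_i|^2+|v_j|^2$.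 $F^{0,1}$ has basis $e^{i\nu\cdot x}z_k$ and $e^{-i\nu\cdot x}\bar z_k$ with $\pi(\nu)+k=0$, $\sum\nu_i$ odd. $F^{0,2}$ has basis the distinct elements $e^{i\nu\cdot x}z^\sigma_kz^\tau_h$ with $\pi(\nu)+\sigma k+\tau h=0$, $\sum_i\nu_i$ even. $\mathrm{ad}(N)$ preserves both. Join two distinct basis elements of $F^{0,1}$ when the corresponding matrix entry of $\mathrm{ad}(N)$ is nonzero; for generic $S$ the connected components (''combinatorial blocks'') are finite, so $\mathrm{ad}(N)$ is block diagonal with finite blocks. For each component choose a root: blocks come in conjugate pairs, one containing $e^{i\nu\cdot x}z_{k_0}$ and the other $e^{-i\nu\cdot x}\bar z_{k_0}$, where $k_0=-\pi(\nu)$ is the chosen root of the corresponding set of sites; the first block is assigned the frequency $\nu$ and the second the frequency $-\nu$. The eigenvalues of $-i\,\mathrm{ad}(N)$ on the block of frequency $\nu$ are denoted $\mu^{(1)}_\nu(\xi),\mu_\nu^{(2)}(\xi),\dots$; they are algebraic functions of $\xi$, analytic outside a semialgebraic hypersurface, and two eigenvalues (possibly of different blocks) are considered equal if they coincide identically in $\xi$. $F^{0,1}_\mu$ is the sum over all blocks of the generalized eigenspaces for the eigenvalue $\mu$ (Fitting decomposition); its dimension is bounded by a constant $\kappa$ independent of $\mu$. $F^{0,2}_{\mu,\mu'}=F^{0,1}_\mu\cdot F^{0,1}_{\mu'}$ (span of products of functions). Given $\gamma,\tau_0>0$, $\mathcal C$ is the set of $\xi\in A_\alpha$ (outside the semialgebraic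 hypersurface off which the eigenvalues $\mu^{(i)}_\nu(\xi)$ are analytic) such that $$|\mu^{(i)}_\nu(\xi)+\mu^{(j)}_{\nu'}(\xi)|\ge\frac{\gamma(\delta+r^\alpha)}{1+|\nu+\nu'|^{\tau_0}}$$ for all pairs with $\mu^{(i)}_\nu+\mu^{(j)}_{\nu'}\not\equiv0$, with $\delta$ as in the claim. $|f|_{D(s,r)}$ is the supremum of $|f|$ on $D(s,r)=\{|\mathrm{Im}\,x|<s,\ |y|\le r^2,\ |w|_{a,p}\le r\}$, where $|w|_{a,p}$ is the norm given by the weights $\sum_k|z_k^\pm|^2e^{2a|k|}|k|^{2p}$, $a>0$, $p>n/2$. *)

(* Defs.v *)
From Stdlib Require Import Relations.
From mathcomp Require Import all_boot all_order all_algebra.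
From mathcomp.finmap Require Import finmap multiset.
From mathcomp Require Import all_classical all_reals all_analysis.
From mathcomp Require Import complex.
From mathcomp Require Import -(notations) mpoly.

Set Implicit Arguments.
Unset Strict Implicit.
Unset Printing Implicit Defensive.

Import Order.TTheory GRing.Theory Num.Theory.
Import numFieldNormedType.Exports.

Local Open Scope classical_set_scope.
Local Open Scope ring_scope.

(* A Hamiltonian is represented by its family of coefficients in the variables
   e^{ix}, y, z, zbar. A monomial is a pair of an x-frequency nu and a finite
   multiset of the variables y_i (inl i) and z_k^sigma (inr (k, sigma)), where
   z_k^true = z_k and z_k^false = zbar_k.  The set S is the set of rows of
   v : 'M[int]_(m, n). *)
Definition var (m n : nat) : Type := ('I_m + 'rV[int]_n * bool)%type.

Definition monom (m n : nat) : Type := ('rV[int]_m * {mset var m n}%mset)%type.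

Definition hseries (R : realType) (m n : nat) : Type := monom m n -> R[i].

Definition Sc (m n : nat) (v : 'M[int]_(m, n)) : set 'rV[int]_n :=
  [set k | forall i, k <> row i v].

Definition momentum (m n : nat) (v : 'M[int]_(m, n)) (nu : 'rV[int]_m) :
  'rV[int]_n := \sum_i nu 0 i *: row i v.

Definition normsq (n : nat) (k : 'rV[int]_n) : int := \sum_i k 0 i ^+ 2.

Section Series.
Context (R : realType) (m n : nat).
Implicit Types (F G X Y : hseries R m n) (M : monom m n).

Definition monom_mul M M' : monom m n := (M.1 + M'.1, (M.2 `+` M'.2)%mset).

Definition vy (i : 'I_m) : monom m n := (0, [mset inl i]%mset).
Definition vz (sg : bool) (k : 'rV[int]_n) : monom m n := (0, [mset inr (k, sg)]%mset).
Definition ex (nu : 'rV[int]_m) : monom m n := (nu, mset0).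

Definition mono M : hseries R m n := fun M' => (M' == M)%:R.

(* As for the sum over the sites in [poisson], the sum ranges over a finite
   support as soon as one of the factors has finite support. *)
Definition hmul F G : hseries R m n := fun M =>
  \sum_(q \in [set q : monom m n * monom m n | monom_mul q.1 q.2 = M])
     F q.1 * G q.2.

Definition dx (i : 'I_m) F : hseries R m n := fun M => 'i%C * (M.1 0 i)%:~R * F M.

Definition dvar (w : var m n) F : hseries R m n := fun M =>
  (M.2 w).+1%:R * F (M.1, (w +` M.2)%mset).

Definition dy (i : 'I_m) F := dvar (inl i) F.
Definition dz (sg : bool) (k : 'rV[int]_n) F := dvar (inr (k, sg)) F.

Definition poisson (v : 'M[int]_(m, n)) F G : hseries R m n := fun M =>
  \sum_(i < m) (hmul (dy i F) (dx i G) M - hmul (dy i G) (dx i F) M)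
  + 'i%C * \sum_(k \in Sc v)
      (hmul (dz false k F) (dz true k G) M - hmul (dz true k F) (dz false k G) M).

Definition lin_span (A : set (hseries R m n)) : set (hseries R m n) :=
  [set X | exists (d : nat) (c : 'I_d -> R[i]) (Y : 'I_d -> hseries R m n),
     (forall i, A (Y i)) /\ forall M, X M = \sum_i c i * Y i M].

Definition dim_le (d : nat) (V : set (hseries R m n)) : Prop :=
  forall Y : 'I_d.+1 -> hseries R m n, (forall i, V (Y i)) ->
    exists c : 'I_d.+1 -> R[i],
      (exists i, c i != 0) /\ forall M, \sum_i c i * Y i M = 0.

End Series.

Section NormalForm.
Context (R : realType) (m n : nat) (v : 'M[int]_(m, n)).
Implicit Types (xi : 'I_m -> R).

Definition omega xi (i : 'I_m) : R :=
  (normsq (row i v))%:~R - 2 * xi i + 4 * \sum_j xi j.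

Definition Omega xi (k : 'rV[int]_n) : R := (normsq k)%:~R + 4 * \sum_j xi j.

Definition unitv (i : 'I_m) : 'rV[int]_m := delta_mx 0 i.

(* tuples (i, j, h, k) *)
Definition index4 : Type := (('I_m * 'I_m) * 'rV[int]_n * 'rV[int]_n)%type.

Definition star : set index4 := [set t : index4 | let: (i, j, h, k) := t in
  [/\ i != j, Sc v h, Sc v k, h + row i v = k + row j v
    & normsq h + normsq (row i v) = normsq k + normsq (row j v)]].

Definition starstar : set index4 := [set t : index4 | let: (i, j, h, k) := t in
  [/\ (i < j)%N, Sc v h, Sc v k, h + k = row i v + row j v
    & normsq h + normsq k = normsq (row i v) + normsq (row j v)]].

Definition zz (sg : bool) (h : 'rV[int]_n) (tau : bool) (k : 'rV[int]_n)
    (nu : 'rV[int]_m) : monom m n :=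
  monom_mul (ex n nu) (monom_mul (vz m sg h) (vz m tau k)).

Definition hamQ xi : hseries R m n := fun M =>
  4 * (\sum_(t \in star) let: (i, j, h, k) := t in
     (Num.sqrt (xi i * xi j))%:C%C
     * mono R (zz true h false k (unitv i - unitv j)) M)
  + 2 * (\sum_(t \in starstar) let: (i, j, h, k) := t in
     (Num.sqrt (xi i * xi j))%:C%C
     * (mono R (zz true h true k (- (unitv i + unitv j))) M
        + mono R (zz false h false k (unitv i + unitv j)) M)).

Definition hamN xi : hseries R m n := fun M =>
  \sum_(i < m) (omega xi i)%:C%C * mono R (vy n i) M
  + \sum_(k \in Sc v) (Omega xi k)%:C%C * mono R (zz true k false k 0) M
  + hamQ xi M.

Definition adN xi (X : hseries R m n) : hseries R m n := poisson v (hamN xi) X.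

(* The basis of F^{0,1} is indexed by pairs (nu, sg): by zero momentum the site
   is k = - pi(nu), and (nu, true) stands for e^{i nu.x} z_k, (nu, false) for
   e^{- i nu.x} zbar_k. *)
Definition vertex : Type := ('rV[int]_m * bool)%type.

Implicit Types (u : vertex).

Definition site u : 'rV[int]_n := - momentum v u.1.

Definition xfreq u : 'rV[int]_m := if u.2 then u.1 else - u.1.

Definition basis01 : set vertex :=
  [set u | Sc v (site u) /\ odd `|(\sum_i u.1 0 i : int)|%N].

Definition elt u : monom m n := monom_mul (ex n (xfreq u)) (vz m u.2 (site u)).

Definition conjv u : vertex := (u.1, ~~ u.2).

Definition positive : set ('I_m -> R) := [set xi | forall i, 0 < xi i].

(* The matrix entries depend on xi; an edge is an entry that does not vanish
   identically. *)
Definition edge u u' : Prop :=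
  [/\ basis01 u, basis01 u', u <> u'
    & exists2 xi, positive xi & adN xi (mono R (elt u)) (elt u') != 0].

Definition block u : set vertex := [set u' | clos_refl_sym_trans vertex edge u u'].

(* [fset_set] enumerates a finite set; the blocks are finite for generic v *)
Definition block_size u : nat := #|` fset_set (block u)|.

Definition ad_block_mx xi u : 'M[R[i]]_(block_size u) :=
  let B : seq vertex := fset_set (block u) in
  \matrix_(b, c) (- 'i%C * adN xi (mono R (elt (nth u B c))) (elt (nth u B b))).

(* The root site depends only on the set of sites of the block, and conjugate
   blocks have conjugate roots. *)
Definition root_choice (root : vertex -> vertex) : Prop :=
  forall u, basis01 u ->
  [/\ block u (root u),
      forall u', block u u' -> root u' = root u,
      root (conjv u) = conjv (root u)
    & forall u', basis01 u' -> site @` block u = site @` block u' ->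
        site (root u) = site (root u')].

Definition frequency (root : vertex -> vertex) u : 'rV[int]_m := xfreq (root u).

Inductive semialgebraic : set ('I_m -> R) -> Prop :=
| sa_pos (P : mpoly m R) : semialgebraic [set xi | 0 < meval xi P]
| sa_compl (A : set ('I_m -> R)) : semialgebraic A -> semialgebraic (~` A)
| sa_inter (A B : set ('I_m -> R)) :
    semialgebraic A -> semialgebraic B -> semialgebraic (A `&` B).

Definition semialgebraic_hypersurface (H : set ('I_m -> R)) : Prop :=
  semialgebraic H /\
  exists2 P : mpoly m R, P <> 0 & forall xi, H xi -> meval xi P = 0.

Definition analytic_at (f : ('I_m -> R) -> R) (xi0 : 'I_m -> R) : Prop :=
  exists (c : {ffun 'I_m -> nat} -> R) (rho : R), 0 < rho /\
  forall xi, (forall i, `|xi i - xi0 i| < rho) ->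
    (\esum_(al in [set: {ffun 'I_m -> nat}])
       (`|c al * \prod_i (xi i - xi0 i) ^+ al i|)%:E < +oo)%E
    /\ (fun d : nat => \sum_(al : {ffun 'I_m -> 'I_d})
          c [ffun i => nat_of_ord (al i)] * \prod_i (xi i - xi0 i) ^+ al i)
         @ \oo --> f xi.

(* [mu u i] is the i-th eigenvalue (with multiplicity) of - i ad(N) on the block
   of u. The branches are defined on the closed orthant, which gives a meaning to
   mu(0); N(0) = (omega(0), y) + sum_k |k|^2 |z_k|^2. *)
Definition eigenvalue_branches (H : set ('I_m -> R))
    (mu : vertex -> nat -> ('I_m -> R) -> R[i]) : Prop :=
  forall u, basis01 u ->
  [/\ forall u', block u u' -> mu u' = mu u,
      forall xi, (forall i, 0 <= xi i) ->
        char_poly (ad_block_mx xi u) = \prod_(i < block_size u) ('X - (mu u i xi)%:P)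
    & forall (i : nat) xi, (i < block_size u)%N -> positive xi -> ~ H xi ->
        analytic_at (fun x => complex.Re (mu u i x)) xi
        /\ analytic_at (fun x => complex.Im (mu u i x)) xi].

Definition identically_eq (H : set ('I_m -> R)) (f g : ('I_m -> R) -> R[i]) : Prop :=
  forall xi, positive xi -> ~ H xi -> f xi = g xi.

Definition block_supported u (X : hseries R m n) : Prop :=
  forall M, X M != 0 -> exists2 u', block u u' & M = elt u'.

Definition gen_eigenspace xi u (lam : R[i]) : set (hseries R m n) :=
  [set X | block_supported u X /\
     exists d : nat, iter d (fun Y M => - 'i%C * adN xi Y M - lam * Y M) X = (fun=> 0)].

Definition F01 (H : set ('I_m -> R)) (mu : vertex -> nat -> ('I_m -> R) -> R[i])
    xi (lam : ('I_m -> R) -> R[i]) : set (hseries R m n) :=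
  lin_span [set X | exists (u : vertex) (i : nat),
     [/\ basis01 u, (i < block_size u)%N, identically_eq H (mu u i) lam
       & gen_eigenspace xi u (lam xi) X]].

Definition F02 (H : set ('I_m -> R)) (mu : vertex -> nat -> ('I_m -> R) -> R[i])
    xi (lam lam' : ('I_m -> R) -> R[i]) : set (hseries R m n) :=
  lin_span [set hmul X Y | X in F01 H mu xi lam & Y in F01 H mu xi lam'].

Definition norm1 (nu : 'rV[int]_m) : R := (\sum_i `|nu 0 i|)%:~R.

Definition delta_gap (lam lam' : ('I_m -> R) -> R[i]) : R :=
  if lam (fun=> 0) + lam' (fun=> 0) == 0 then 0 else 1.

Definition A_ (al r : R) : set ('I_m -> R) :=
  [set xi | forall i, 2^-1 * r `^ al <= xi i <= r `^ al].

Definition C_ (al r gam tau0 : R) (root : vertex -> vertex) (H : set ('I_m -> R))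
    (mu : vertex -> nat -> ('I_m -> R) -> R[i]) : set ('I_m -> R) :=
  [set xi | [/\ A_ al r xi, ~ H xi
    & forall (u u' : vertex) (i j : nat), basis01 u -> basis01 u' ->
        (i < block_size u)%N -> (j < block_size u')%N ->
        ~ identically_eq H (fun x => mu u i x + mu u' j x) (fun=> 0) ->
        gam * (delta_gap (mu u i) (mu u' j) + r `^ al)
          / (1 + norm1 (frequency root u + frequency root u') `^ tau0)
        <= Normc.normc (mu u i xi + mu u' j xi)]].

End NormalForm.

Section SupNorm.
Context (R : realType) (m n : nat) (v : 'M[int]_(m, n)).

Definition cexp (z : R[i]) : R[i] :=
  (expR (complex.Re z))%:C%C * (cos (complex.Im z) +i* sin (complex.Im z))%C.

(* complexified phase space: x and y are complex vectors, and the coordinates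
   w k sg = z_k^sg are independent complex variables *)
Record phase_point : Type := PhasePoint {
  px : 'I_m -> R[i];
  py : 'I_m -> R[i];
  pw : 'rV[int]_n -> bool -> R[i] }.

Definition var_value (P : phase_point) (w : var m n) : R[i] :=
  match w with inl i => py P i | inr (k, sg) => pw P k sg end.

Definition monom_value (P : phase_point) (M : monom m n) : R[i] :=
  cexp ('i%C * \sum_i (M.1 0 i)%:~R * px P i) * \prod_(w <- M.2) var_value P w.

Definition value (X : hseries R m n) (P : phase_point) : R[i] :=
  \sum_(M \in [set: monom m n]) X M * monom_value P M.

(* e^{2a|k|} |k|^{2p}, with the usual convention that |k| is replaced by 1 at
   k = 0, without which |w|_{a,p} would only be a seminorm *)
Definition weight (a p : R) (k : 'rV[int]_n) : R :=
  let absk := Num.sqrt ((normsq k)%:~R : R) in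
  expR (2 * a * absk) * (if k == 0 then 1 else absk) `^ (2 * p).

Definition wnorm_sq (a p : R) (w : 'rV[int]_n -> bool -> R[i]) : \bar R :=
  \esum_(k in Sc v)
    (weight a p k * \sum_(sg : bool) Normc.normc (w k sg) ^+ 2)%:E.

Definition D_ (a p s r : R) : set phase_point :=
  [set P | [/\ forall i, `|complex.Im (px P i)| < s,
               forall i, Normc.normc (py P i) <= r ^+ 2
             & (wnorm_sq a p (pw P) <= (r ^+ 2)%:E)%E]].

Definition supnorm (a p s r : R) (X : hseries R m n) : \bar R :=
  ereal_sup [set (Normc.normc (value X P))%:E | P in D_ a p s r].

End SupNorm.

(* Main.v *)
(* A block of positive size is finite, and finite blocks have uniformly bounded size.  Indeed the
   edges of the second kind involve only the finitely many lattice points of some spheres, while a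
   walk along edges of the first kind stays in a bounded region, by induction on the directions it
   uses; and in a finite block the site and the sign determine the frequency, because edges are
   invariant under the shifts of momentum zero and even mass.

   Every monomial of Q conserves momentum, mass and the energy sum nu_i |v_i|^2 + sum +-|k|^2, so
   along an edge the diagonal entry of - i ad(N) changes by O(r^alpha), as do the off-diagonal
   entries, and by Gershgorin's theorem every eigenvalue of a block is within O(r^alpha) of all its
   diagonal entries.  Hence on F02_{mu,mu'} one has - i ad(N) = lam + n, with lam = mu + mu' and n of
   size O(r^alpha) in the l^1 norm of the coefficients weighted by bounds of the monomials on
   D(s, r).  Since ad(N) is a derivation and F01_mu has dimension at most kappa, n^(kappa^2) = 0, and
   (lam + n)^-1 = sum_{j < kappa^2} (-n)^j / lam^(j+1) satisfies the claimed estimate by the lower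
   bound on |lam|.  The weighted l^1 norm and the supremum norm are comparable on F02_{mu,mu'}: its
   elements involve at most (kappa B)^2 monomials, with B a bound for the size of the blocks, and a
   coefficient is bounded by the supremum norm by averaging over rotations of the angles and phases. *)
Require Import Defs.
From HB Require Import structures.
From Stdlib Require Import Relations.
From mathcomp Require Import all_boot all_order all_algebra.
From mathcomp.finmap Require Import finmap multiset.
From mathcomp Require Import zify ring.
From mathcomp Require Import all_classical all_reals all_analysis.
From mathcomp Require Import complex.
From mathcomp Require Import -(notations) mpoly.

Set Implicit Arguments.
Unset Strict Implicit.
Unset Printing Implicit Defensive.

Import Order.TTheory GRing.Theory Num.Theory.

Local Open Scope classical_set_scope.
Local Open Scope ring_scope.

(** * Walks on a lattice *)

Section Lattice.
Context (n : nat).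
Implicit Types x y z : 'rV[int]_n.

(** The diagonal of - i ad(N) contains the term - 2 xi.nu, which is unbounded in nu, so its entries
    are not uniformly close to the integer spectrum at xi = 0. Only differences of diagonal entries
    inside a block are O(r^alpha); Gershgorin's theorem turns them into a distance to the true
    eigenvalue, at the price of the block size. Hence the need for a bound of that size that does
    not depend on nu. The smallness of n keeps a single factor delta + r^alpha in the denominator:
    up to constants, each further power of n / lam brings r^alpha |nu + nu'|^tau0 / (delta +
    r^alpha), and r^alpha / (delta + r^alpha) <= 1. With at most kappa^2 terms there remains the
    power kappa^2 tau0 of |nu + nu'|. The weights of the l^1 norm depend on the point P of D(s, r)
    at which the inverse is evaluated, through the imaginary parts of its angles. Coefficients are
    recovered at points whose angles have the same imaginary parts, so nothing of the width s is
    lost. *)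

Definition dot x y : int := \sum_i x 0 i * y 0 i.
Definition nrm x : nat := (\sum_i absz (x 0%R i))%N.

Lemma dotDl x y z : dot (x + y) z = dot x z + dot y z.
Proof. by rewrite /dot -big_split; apply: eq_bigr => i _; rewrite !mxE mulrDl. Qed.

Lemma dotNl x z : dot (- x) z = - dot x z.
Proof. by rewrite /dot -sumrN; apply: eq_bigr => i _; rewrite !mxE mulNr. Qed.

Lemma dot_eq0 x : dot x x = 0 -> x = 0.
Proof.
move=> /eqP; rewrite /dot psumr_eq0; last by move=> i _; rewrite -expr2 sqr_ge0.
move=> /allP h; apply/rowP => i; rewrite mxE.
by have := h i (mem_index_enum _); rewrite -expr2 sqrf_eq0 => /eqP.
Qed.

Lemma nrmN x : nrm (- x) = nrm x.
Proof. by apply: eq_bigr => i _; rewrite mxE abszN. Qed.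

Lemma nrm0 : nrm 0 = 0%N.
Proof. by rewrite /nrm big1 // => i _; rewrite mxE. Qed.

Lemma nrmD x y : (nrm (x + y) <= nrm x + nrm y)%N.
Proof. rewrite /nrm -big_split; apply: leq_sum => i _; rewrite mxE /=; lia. Qed.

Lemma nrmBC x y : nrm (x - y) = nrm (y - x).
Proof. by rewrite -nrmN opprB. Qed.

Lemma nrm_tri x y z : (nrm (x - z) <= nrm (x - y) + nrm (y - z))%N.
Proof. by rewrite -[x - z](subrKA y); exact: nrmD. Qed.

Lemma absz_le_nrm x i : (absz (x 0%R i) <= nrm x)%N.
Proof. by rewrite /nrm (bigD1 i) //= leq_addr. Qed.

Lemma absz_sum (I : Type) (r : seq I) (F : I -> int) :
  (absz (\sum_(i <- r) F i)%R <= \sum_(i <- r) absz (F i))%N.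
Proof.
elim: r => [|a r IH]; rewrite ?big_nil ?big_cons //.
apply: leq_trans (leq_add (leqnn (absz (F a))) IH).
by move: (F a) (\sum_(j <- r) F j) => u w; lia.
Qed.

Lemma dot_le x y : (absz (dot x y) <= nrm x * nrm y)%N.
Proof.
rewrite /dot; apply: leq_trans (absz_sum _ _) _.
rewrite {1}/nrm big_distrl /=; apply: leq_sum => i _.
by rewrite abszM leq_mul // absz_le_nrm.
Qed.

Lemma finite_nrm_bounded (A : set 'rV[int]_n) :
  finite_set A -> exists B : nat, forall z, A z -> (nrm z <= B)%N.
Proof.
move=> /finite_seqP[s ->]; exists (\sum_(z <- s) nrm z)%N => z zs.
have zs' : z \in s by exact: zs.
by rewrite (big_rem z zs') /= leq_addr.
Qed.

Lemma finite_inj_finType (T : Type) (F : finType) (A : set T) (f : T -> F) :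
  {in A &, injective f} -> finite_set A.
Proof. by move=> fI; rewrite -(eq_finite_set (inj_card_eq fI)); exact: finite_finset. Qed.

(** The shift by [K] maps [-K, K] into the naturals below 2K + 1, where neither [absz] nor [inord]
    loses information. *)
Lemma inord_shift_inj (K : nat) (a b : int) : (absz a <= K)%N -> (absz b <= K)%N ->
  inord (absz (a + K%:Z)) = inord (absz (b + K%:Z)) :> 'I_(K + K).+1 -> a = b.
Proof. by move=> ha hb /(congr1 val); rewrite /= !inordK; lia. Qed.

Lemma finite_nrm_ball (B : nat) : finite_set [set z | (nrm z <= B)%N].
Proof.
apply: (@finite_inj_finType _ _ _
  (fun z : 'rV_n => [ffun i => inord (absz (z 0 i + B%:Z))] : {ffun 'I_n -> 'I_(B + B).+1})).
move=> x y; rewrite !inE => hx hy /ffunP h; apply/rowP => i.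
have := h i; rewrite !ffunE; apply: inord_shift_inj; apply: leq_trans (absz_le_nrm _ _) _ => //.
Qed.

End Lattice.

Section Walks.
Context (n : nat) (I : finType) (e : I -> 'rV[int]_n) (c : I -> int).
Implicit Types (x y z : 'rV[int]_n) (A : {set I}).

(** The direction [e p] may be used only from the points of one hyperplane orthogonal to it; for
    rectangle edges this is the conservation of energy. *)
Definition walk_step A x y := exists2 p, p \in A & y = x + e p /\ 2 * dot x (e p) = c p.

Definition walk A := clos_refl_sym_trans _ (walk_step A).

Definition int_span A z := exists a : I -> int, z = \sum_(p in A) a p *: e p.

Lemma int_spanB A x y : int_span A x -> int_span A y -> int_span A (x - y).
Proof.
move=> [a ->] [b ->]; exists (fun p => a p - b p).
by rewrite -sumrB; apply: eq_bigr => p _; rewrite scalerBl.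
Qed.

(** z is a combination of the [e p], so [dot z z] is a combination of the vanishing products of z
    with them. *)
Lemma int_span_orth A z : int_span A z -> (forall p, p \in A -> dot z (e p) = 0) -> z = 0.
Proof.
move=> [a za] h; apply: dot_eq0; rewrite {2}za.
have -> : dot z (\sum_(p in A) a p *: e p) = \sum_(p in A) a p * dot z (e p).
  rewrite /dot; under eq_bigr => i _ do rewrite summxE mulr_sumr.
  rewrite exchange_big; apply: eq_bigr => p _; rewrite mulr_sumr.
  by apply: eq_bigr => i _; rewrite mxE mulrCA.
by rewrite big1 // => p pA; rewrite h // mulr0.
Qed.

Lemma walk_span A x y : walk A x y -> int_span A (x - y).
Proof.
have s0 : int_span A 0.
  by exists (fun=> 0); rewrite big1 // => p _; rewrite scale0r.
elim=> {x y} [x _ [p pA [-> _]]|x|x y _ IH|x y z _ h1 _ h2].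
- exists (fun q => if q == p then -1 else 0).
  rewrite (bigD1 p) //= eqxx big1 ?addr0; last by move=> q /andP[_ /negPf->]; rewrite scale0r.
  by rewrite scaleN1r opprD addNKr.
- by rewrite subrr.
- by rewrite -opprB -sub0r; exact: int_spanB.
- have -> : x - z = (x - y) - (0 - (y - z)) by rewrite sub0r opprK subrKA.
  by apply: int_spanB => //; exact: int_spanB.
Qed.

(** By [int_span_orth] applied to differences, a vector of the span is determined by its products
    with the directions, and there are finitely many tuples of bounded integers. *)
Lemma int_span_bounded A (K : nat) : exists B : nat, forall z, int_span A z ->
  (forall p, p \in A -> (absz (dot z (e p)) <= K)%N) -> (nrm z <= B)%N.
Proof.
pose Z := [set z | int_span A z /\ forall p, p \in A -> (absz (dot z (e p)) <= K)%N].
have /finite_nrm_bounded[B hB] : finite_set Z; last first.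
  by exists B => z z1 z2; apply: hB.
apply: (@finite_inj_finType _ _ _ (fun z : 'rV_n =>
   [ffun p => inord (absz (dot z (e p) + K%:Z))] : {ffun I -> 'I_(K + K).+1})).
move=> x y; rewrite !inE => -[x1 x2] [y1 y2] /ffunP h; apply/eqP; rewrite -subr_eq0; apply/eqP.
apply: (@int_span_orth A); first exact: int_spanB.
move=> p pA; rewrite dotDl dotNl; apply/eqP; rewrite subr_eq0; apply/eqP.
have := h p; rewrite !ffunE; apply: inord_shift_inj; [exact: x2|exact: y2].
Qed.

(* A walk using all the directions of A stays near a point where each of the
   equations 2 x.e_p = c_p, p in A, nearly holds; otherwise it uses fewer directions. *)
Lemma walk_bounded_card (k : nat) : exists B : nat, forall A, (#|A| <= k)%N ->
  forall x y, walk A x y -> (nrm (x - y)%R <= B)%N.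
Proof.
elim: k => [|k [B hB]].
  exists 0%N => A; rewrite leqn0 cards_eq0 => /eqP-> x y.
  elim=> {x y} [x y [p]|x|x y _|x y z _ h1 _ h2]; rewrite ?inE ?subrr ?nrm0 //.
    by rewrite nrmBC.
  by apply: leq_trans (nrm_tri _ _ _) (leq_add h1 h2).
pose E := (\sum_p nrm (e p))%N.
have eE p : (nrm (e p) <= E)%N by rewrite /E (bigD1 p) //= leq_addr.
pose K := (4 * ((B + E) * E))%N.
pose BA A := sval (cid (int_span_bounded A K)).
exists (B + \sum_(A : {set I}) BA A)%N => A Ak x y xy.
(* The hyperplane of p has a lattice point close to x: [B] bounds walks with fewer directions and
   [E] the length of one step. *)
pose near x p := exists2 w, (nrm (x - w)%R <= B + E)%N & 2 * dot w (e p) = c p.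
(* If some direction is not near x', a walk from x' never uses it: as long as only near directions
   occur, the walk stays within [B] of x', so the next step starts or ends on its hyperplane within
   [B + E] of x' and its direction is near too. The induction hypothesis then applies to fewer
   directions. *)
have key x' : (forall y', walk A x' y' -> (nrm (x' - y')%R <= B)%N)
    \/ (forall p, p \in A -> near x' p).
  pose A' := [set p in A | `[< near x' p >]].
  have [A'A|A'A] := eqVneq A' A.
    by right => p; rewrite -A'A inE => /andP[_ /asboolP].
  left => y' x'y'.
  have A'k : (#|A'| <= k)%N.
    rewrite -ltnS; apply: leq_trans Ak; apply: proper_card.
    by rewrite finset.properEneq A'A; apply/fintype.subsetP => p; rewrite inE => /andP[].
  apply: (hB A') => //.
  have := clos_rst_rstn1 _ _ _ _ x'y'.
  elim=> {y' x'y'} [|w w' ww' _ IH]; first exact: rst_refl.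
  have [p pA pww'] : exists2 p, p \in A & (w' = w + e p /\ 2 * dot w (e p) = c p)
      \/ (w = w' + e p /\ 2 * dot w' (e p) = c p).
    by case: ww' => -[p pA h]; exists p => //; [left|right].
  have pA' : p \in A'.
    rewrite inE pA; apply/asboolP.
    have dw := hB A' A'k _ _ IH.
    case: pww' => -[ew cw]; [exists w => //|exists w' => //].
      by apply: leq_trans dw _; rewrite leq_addr.
    have -> : w' = w - e p by rewrite ew addrK.
    rewrite opprB addrA addrAC; apply: leq_trans (nrmD _ _) (leq_add dw (eE p)).
  apply: rst_trans IH _; case: pww' => h; first by apply: rst_step; exists p.
  by apply: rst_sym; apply: rst_step; exists p.
case: (key x) => [/(_ _ xy) h|nx]; first exact: leq_trans h (leq_addr _ _).
case: (key y) => [/(_ _ (rst_sym _ _ _ _ xy))|ny].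
  by rewrite nrmBC => h; exact: leq_trans h (leq_addr _ _).
(* For each p the nearby points w and w' have the same product with [e p], so the product of x - y
   with [e p] is at most 2 (B + E) E in absolute value. *)
have : (nrm (x - y)%R <= BA A)%N.
  apply: (svalP (cid (int_span_bounded A K))); first exact: walk_span.
  move=> p pA; have [w xw cw] := nx p pA; have [w' yw' cw'] := ny p pA.
  have : (absz (dot (x - w)%R (e p)) <= (B + E) * E)%N.
    by apply: leq_trans (dot_le _ _) _; exact: leq_mul.
  have : (absz (dot (y - w')%R (e p)) <= (B + E) * E)%N.
    by apply: leq_trans (dot_le _ _) _; exact: leq_mul.
  by rewrite !dotDl !dotNl /K; move: cw cw' => /=; lia.
move=> h; apply: leq_trans h _.
by rewrite (bigD1 A) //= addnA addnAC leq_addl.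
Qed.

Lemma walk_bounded : exists B : nat, forall x y, walk [set: I] x y -> (nrm (x - y)%R <= B)%N.
Proof. by have [B hB] := walk_bounded_card #|I|; exists B; apply: hB; rewrite max_card. Qed.

End Walks.

(** * The graph of sites *)

Section Sites.
Context (m n : nat) (v : 'M[int]_(m, n)).
Implicit Types (x y k h : 'rV[int]_n).

(** In [rect_adj] the points h, v_i and k, v_j are the two diagonals of a rectangle; in [sphere_adj]
    the points h and k are antipodal on the sphere with diameter v_i v_j. These relations contain
    the edges coming from the two sums of Q. *)
Definition rect_adj k h := exists i j : 'I_m,
  h + row i v = k + row j v /\ normsq h + normsq (row i v) = normsq k + normsq (row j v).

Definition sphere_adj k h := exists i j : 'I_m,
  h + k = row i v + row j v /\ normsq h + normsq k = normsq (row i v) + normsq (row j v).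

Definition site_adj k h := rect_adj k h \/ sphere_adj k h.

Lemma normsq_ge0 k : 0 <= normsq k.
Proof. by apply: sumr_ge0 => i _; rewrite sqr_ge0. Qed.

Lemma normsqD k h : normsq (k + h) = normsq k + 2 * dot k h + normsq h.
Proof.
rewrite /normsq /dot mulr_sumr -!big_split; apply: eq_bigr => i _; rewrite !mxE /=; ring.
Qed.

Lemma nrm_le_normsq k : (nrm k <= absz (normsq k))%N.
Proof.
rewrite -lez_nat gez0_abs ?normsq_ge0 // /nrm /normsq.
rewrite -natz natr_sum; apply: ler_sum => i _; rewrite natz; nia.
Qed.

Lemma normsq_ge1 k : k != 0 -> 1 <= normsq k.
Proof.
move=> k0; have := normsq_ge0 k; rewrite le_eqVlt => /orP[/eqP e|]; last by lia.
case/negP: k0; apply/eqP/dot_eq0; rewrite e.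
by apply: eq_bigr => i _; rewrite expr2.
Qed.

Definition sphere_radius : nat := \sum_i absz (normsq (row i v)).

Lemma normsq_row_le i : normsq (row i v) <= sphere_radius%:Z.
Proof.
have := normsq_ge0 (row i v); rewrite /sphere_radius (bigD1 i) //=; lia.
Qed.

Lemma sphere_adj_sym k h : sphere_adj k h -> sphere_adj h k.
Proof. by move=> [i [j [h1 h2]]]; exists i, j; split; rewrite addrC. Qed.

Lemma sphere_adj_le k h : sphere_adj k h -> (nrm k <= sphere_radius + sphere_radius)%N.
Proof.
move=> [i [j [_ h2]]]; apply: leq_trans (nrm_le_normsq k) _.
have := normsq_row_le i; have := normsq_row_le j; have := normsq_ge0 h.
have := normsq_ge0 k; lia.
Qed.

(** This also serves later to compare the weights of the norm |w|_{a,p} at adjacent sites. *)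
Lemma site_adj_normsq k h : site_adj k h -> normsq k <= normsq h + (sphere_radius + sphere_radius)%:Z.
Proof.
have nh := normsq_ge0 h.
by move=> [|] [i [j [_ h2]]]; have := normsq_row_le i; have := normsq_row_le j;
   have := normsq_ge0 (row i v); have := normsq_ge0 (row j v); lia.
Qed.

(* Sphere edges touch only finitely many sites, so a component either is a bounded walk along
   rectangle edges or consists of such walks that all pass near the spheres. *)
Lemma site_component_bounded : exists B : nat,
  forall x y, clos_refl_sym_trans _ site_adj x y -> (nrm (x - y) <= B)%N.
Proof.
pose e (p : 'I_m * 'I_m) := row p.2 v - row p.1 v.
pose c p := normsq (row p.2 v) - normsq (row p.1 v) - normsq (e p).
have [B hB] := walk_bounded e c.
pose W := walk e c [set: 'I_m * 'I_m].
have rectW k h : rect_adj k h -> W k h.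
  move=> [i [j [h1 h2]]]; apply: rst_step; exists (i, j); rewrite ?inE //.
  have hk : h = k + e (i, j) by rewrite /e /= addrA -h1 addrK.
  split=> //; move: h2; rewrite {1}hk normsqD /c /=; lia.
pose T k := (nrm k <= sphere_radius + sphere_radius)%N.
(* The second alternative forgets how the two sites near the spheres are joined: two points of [T]
   are at bounded distance anyway. *)
pose Q x y := W x y \/ (exists2 t, T t & W x t) /\ (exists2 t, T t & W y t).
have Wsym x y : W x y -> W y x by exact: rst_sym.
have Wtr x y z : W x y -> W y z -> W x z by exact: rst_trans.
have clQ x y : clos_refl_sym_trans _ site_adj x y -> Q x y.
  elim=> {x y} [x y [/rectW|xy]|x|x y _ [/Wsym|[h1 h2]]|x y z _ Qxy _ Qyz].
  - by left.
  - right; split; [exists x|exists y]; try exact: rst_refl.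
      exact: sphere_adj_le xy.
    exact: sphere_adj_le (sphere_adj_sym xy).
  - by left; exact: rst_refl.
  - by left.
  - by right.
  - case: Qxy => [Wxy|[x1 y1]]; case: Qyz => [Wyz|[y2 z2]].
    + by left; exact: Wtr Wxy Wyz.
    + right; split=> //; by case: y2 => t Tt Wyt; exists t => //; exact: Wtr Wxy Wyt.
    + right; split=> //; by case: y1 => t Tt Wyt; exists t => //; exact: Wtr (Wsym _ _ Wyz) Wyt.
    + by right.
exists (B + 2 * (sphere_radius + sphere_radius) + B)%N => x y /clQ[/hB|].
  by move=> h; apply: leq_trans h _; lia.
move=> [[t Tt /hB xt] [t' Tt' /Wsym/hB ty]].
apply: leq_trans (nrm_tri x t' y) (leq_add _ ty).
apply: leq_trans (nrm_tri x t t') (leq_add xt _).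
by apply: leq_trans (nrmD _ _) _; rewrite nrmN mul2n -addnn leq_add.
Qed.

End Sites.

(** * Finitely supported series *)

Lemma fsbig_list (V : nmodType) (T : choiceType) (P : set T) (F : T -> V) (s : seq T) :
  uniq s -> (forall x, P x -> F x != 0 -> x \in s) ->
  \sum_(x \in P) F x = \sum_(x <- s | x \in P) F x.
Proof.
move=> us h; rewrite [RHS]bigfs ?set_mem_set //= => x.
by rewrite inE => Px xs; apply/eqP; apply: contraNT xs; exact: h.
Qed.

Lemma sum_uniq_superset (V : nmodType) (T : choiceType) (F : T -> V) (s s' : seq T) :
  uniq s -> uniq s' -> (forall x, F x != 0 -> (x \in s) = (x \in s')) ->
  \sum_(x <- s) F x = \sum_(x <- s') F x.
Proof.
move=> us us' h; rewrite [LHS](bigID (fun x => F x != 0)) [RHS](bigID (fun x => F x != 0)) /=.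
rewrite [X in _ + X]big1 ?[X in _ = _ + X]big1 ?addr0; try by move=> i /negbNE/eqP.
rewrite -[LHS]big_filter -[RHS]big_filter; apply: perm_big; apply: uniq_perm; rewrite ?filter_uniq //.
by move=> x; rewrite !mem_filter; case: eqP => //= /eqP/h.
Qed.

Lemma sum_mset_superset (V : nmodType) (T : choiceType) (A : {mset T}%mset) (F : T -> V) (s : seq T) :
  uniq s -> {subset A <= s} -> \sum_(x <- A) F x = \sum_(x <- s) F x *+ A x.
Proof.
move=> us As; rewrite big_mset.
rewrite (eq_bigr (fun i => F i *+ A i)); last by [].
apply: sum_uniq_superset => // x; rewrite multiset.msuppE; case: (boolP (x \in A)).
  by move=> /As->.
by rewrite -mset_eq0 => /eqP->; rewrite mulr0n eqxx.
Qed.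

Lemma perm_msetD (T : choiceType) (A B : {mset T}%mset) : perm_eq (A `+` B)%mset (A ++ B).
Proof.
apply/eq_seq_msetP/msetP => x.
by rewrite !mset_seqE count_cat !count_mem_mset msetE2.
Qed.

Lemma sum_msetD (V : nmodType) (T : choiceType) (A B : {mset T}%mset) (F : T -> V) :
  \sum_(x <- (A `+` B)%mset) F x = \sum_(x <- A) F x + \sum_(x <- B) F x.
Proof. by rewrite (perm_big _ (perm_msetD A B)) big_cat. Qed.

Lemma if_mulr (K : pzSemiRingType) (b : bool) (c d : K) :
  (if b then c * d else 0) = c * (d * (if b then 1 else 0)).
Proof. by case: b; rewrite ?mulr1 ?mulr0. Qed.

(* Sealed, since unification would otherwise compare two series by unfolding the equality test on
   monomials. *)
HB.lock Definition lc (R : realType) (m n : nat) (r : seq (R[i] * monom m n)) : hseries R m n :=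
  fun M => \sum_(p <- r | M == p.2) p.1.

Section ListSeries.
Context (R : realType) (m n : nat).
Implicit Types (X Y : hseries R m n) (M A B : monom m n) (r s : seq (R[i] * monom m n)).

Lemma monom_mulC A B : monom_mul A B = monom_mul B A.
Proof. by rewrite /monom_mul addrC msetDC. Qed.

Lemma monom_mulA A B M : monom_mul A (monom_mul B M) = monom_mul (monom_mul A B) M.
Proof. by rewrite /monom_mul /= addrA msetDA. Qed.

Lemma lcE r M : lc r M = \sum_(p <- r | M == p.2) p.1.
Proof. by rewrite lc.unlock. Qed.

Lemma lc_nil M : lc ([::] : seq (R[i] * monom m n)) M = 0.
Proof. by rewrite lcE big_nil. Qed.

Lemma lc_cons p r M : lc (p :: r) M = (if M == p.2 then p.1 else 0) + lc r M.
Proof. by rewrite !lcE big_cons; case: ifP => // _; rewrite add0r. Qed.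

Lemma lc_supp r M : lc r M != 0 -> M \in [seq p.2 | p <- r].
Proof.
apply: contraR => h; rewrite lcE big_seq_cond big1 // => p /andP[pr /eqP Mp].
by rewrite Mp map_f in h.
Qed.

Definition values X (s : seq (monom m n)) : seq (R[i] * monom m n) := [seq (X M, M) | M <- s].

Lemma lc_values X (s : seq (monom m n)) : uniq s -> (forall M, X M != 0 -> M \in s) ->
  X = lc (values X s).
Proof.
move=> us h; apply/funext => M; rewrite lcE big_map /=.
have [Ms|Ms] := boolP (M \in s).
  rewrite big_mkcond (bigD1_seq M) //= eqxx big1 ?addr0 // => A AM.
  by rewrite eq_sym (negPf AM).
rewrite big_seq_cond big1; first by apply/eqP; apply: contraNT Ms; exact: h.
by move=> A /andP[As /eqP MA]; rewrite MA As in Ms.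
Qed.

Lemma sum_lcM r (s : seq (monom m n)) (G : monom m n -> R[i]) :
  uniq s -> {subset [seq p.2 | p <- r] <= s} ->
  \sum_(a <- s) lc r a * G a = \sum_(p <- r) p.1 * G p.2.
Proof.
move=> us h; under eq_bigr do rewrite lcE mulr_suml.
rewrite (exchange_big_dep predT) //= !big_seq; apply: eq_bigr => p pr.
rewrite big_mkcond (bigD1_seq p.2) ?h ?map_f //= eqxx big1 ?addr0 // => a.
by move=> /negPf->.
Qed.

Definition lc_mul r s := [seq (p.1 * q.1, monom_mul p.2 q.2) | p <- r, q <- s].

Lemma lc_mulE r s M : lc (lc_mul r s) M =
  \sum_(p <- r) \sum_(q <- s | M == monom_mul p.2 q.2) p.1 * q.1.
Proof.
rewrite lcE /lc_mul big_mkcond big_allpairs_dep /=.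
by apply: eq_bigr => p _; rewrite -big_mkcond.
Qed.

Lemma hmul_lc r s : hmul (lc r) (lc s) = lc (lc_mul r s).
Proof.
apply/funext => M; rewrite /hmul.
(* The lists may repeat monomials, whereas the sum defining [hmul] meets each pair once; [sum_lcM]
   passes from the duplicate-free lists back to the given ones. *)
pose a := undup [seq p.2 | p <- r]; pose b := undup [seq p.2 | p <- s].
have ua : uniq a by exact: undup_uniq.
have ub : uniq b by exact: undup_uniq.
pose ind M' : R[i] := if M == M' then 1 else 0.
rewrite (@fsbig_list _ _ _ _ [seq (x, y) | x <- a, y <- b]).
- rewrite big_mkcond big_allpairs /=.
  rewrite (eq_bigr (fun x => lc r x * \sum_(y <- b) lc s y * ind (monom_mul x y))); last first.
    move=> x _; rewrite mulr_sumr; apply: eq_bigr => y _.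
    have -> : ((x, y) \in [set q : monom m n * monom m n | monom_mul q.1 q.2 = M])
        = (M == monom_mul x y).
      by apply/asboolP/eqP => /= ->.
    exact: if_mulr.
  rewrite (@sum_lcM r a); [|done|by move=> x; rewrite mem_undup].
  rewrite lc_mulE; apply: eq_bigr => p _.
  rewrite (@sum_lcM s b); [|done|by move=> x; rewrite mem_undup].
  by rewrite mulr_sumr [RHS]big_mkcond; apply: eq_bigr => q _; rewrite /ind -if_mulr.
- by rewrite allpairs_uniq // => -[x y] [x' y'] _ _ [-> ->].
- move=> [x y] _ /=; rewrite mulf_eq0 negb_or => /andP[/lc_supp hx /lc_supp hy].
  by apply: allpairs_f; rewrite mem_undup.
Qed.

(** If w does not occur in a monomial, removing it changes nothing, but the multiplicity 0 cancels
    the term. *)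
Definition dvar_lc (w : var m n) r : seq (R[i] * monom m n) :=
  [seq (p.1 * (p.2.2 w)%:R, (p.2.1, (p.2.2 `\ w)%mset)) | p : R[i] * monom m n <- r].

Lemma dvar_lcE w r : dvar w (lc r) = lc (dvar_lc w r).
Proof.
apply/funext => M; rewrite /dvar !lcE big_map mulr_sumr big_mkcond [RHS]big_mkcond.
apply: eq_bigr => -[c [nu W]] _ /=.
have [Ww|wW] := eqVneq (W w) 0%N.
  rewrite Ww mulr0 if_same; case: eqP => // -[_ e].
  by move: Ww; rewrite -e mset1DE eqxx.
have -> : ((M.1, (w +` M.2)%mset) == (nu, W)) = (M == (nu, (W `\ w)%mset)).
  case: M => M1 M2 /=; rewrite !xpair_eqE; congr (_ && _); apply/eqP/eqP => [<-|->].
    by rewrite msetD1K.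
  by rewrite msetB1K // -mset_neq0.
case: eqP => [->|//] /=; rewrite mulrC; congr (_ * _%:R).
by rewrite msetB1E eqxx subn1 prednK // lt0n.
Qed.

Definition dx_lc (i : 'I_m) r : seq (R[i] * monom m n) :=
  [seq (p.1 * ('i%C * (p.2.1 0 i)%:~R), p.2) | p : R[i] * monom m n <- r].

Lemma dx_lcE i r : dx i (lc r) = lc (dx_lc i r).
Proof.
apply/funext => M; rewrite /dx !lcE big_map mulr_sumr.
by apply: eq_bigr => p /eqP->; rewrite mulrC.
Qed.

End ListSeries.

(** * The monomials of Q *)

Lemma mset_pair (T : choiceType) (a b c : T) (W : {mset T}%mset) :
  (a +` W)%mset = ([mset b] `+` [mset c])%mset ->
  (a = b /\ W = [mset c]%mset) \/ (a = c /\ W = [mset b]%mset).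
Proof.
move=> e; have : a \in (a +` W)%mset by rewrite in_mset1D eqxx.
rewrite e in_msetD !in_mset1 => /orP[/eqP ab|/eqP ac]; [left|right]; split=> //.
  by move: e; rewrite ab => /(congr1 (fun Z => (Z `\` [mset b])%mset)); rewrite /= !msetDKB.
move: e; rewrite ac (msetDC [mset b]%mset) => /(congr1 (fun Z => (Z `\` [mset c])%mset)).
by rewrite /= !msetDKB.
Qed.

Lemma mulr_eq0r (K : pzSemiRingType) (c a : K) : a = 0 -> c * a = 0.
Proof. by move=> ->; rewrite mulr0. Qed.

Lemma mulr_add_eq0 (K : pzSemiRingType) (c a b : K) : a = 0 -> b = 0 -> c * (a + b) = 0.
Proof. by move=> -> ->; rewrite addr0 mulr0. Qed.

Lemma in_mset_pair (T : choiceType) (a b x : T) :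
  (x \in ([mset a] `+` [mset b])%mset) = (x == a) || (x == b).
Proof. by rewrite in_msetD !in_mset1. Qed.

Section NormalFormList.
Context (R : realType) (m n : nat) (v : 'M[int]_(m, n)).
Implicit Types (xi : 'I_m -> R) (M : monom m n) (k h : 'rV[int]_n) (nu : 'rV[int]_m) (sg : bool).

Definition sgz (b : bool) : int := if b then 1 else -1.

Definition mass nu : int := \sum_i nu 0 i.

Definition energy nu : int := \sum_i nu 0 i * normsq (row i v).

Lemma massD nu nu' : mass (nu + nu') = mass nu + mass nu'.
Proof. by rewrite /mass -big_split; apply: eq_bigr => i _; rewrite mxE. Qed.

Lemma massN nu : mass (- nu) = - mass nu.
Proof. by rewrite /mass -sumrN; apply: eq_bigr => i _; rewrite mxE. Qed.

Lemma energyD nu nu' : energy (nu + nu') = energy nu + energy nu'.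
Proof. by rewrite /energy -big_split; apply: eq_bigr => i _; rewrite mxE mulrDl. Qed.

Lemma energyN nu : energy (- nu) = - energy nu.
Proof. by rewrite /energy -sumrN; apply: eq_bigr => i _; rewrite mxE mulNr. Qed.

Lemma momentumD nu nu' : momentum v (nu + nu') = momentum v nu + momentum v nu'.
Proof. by rewrite /momentum -big_split; apply: eq_bigr => i _; rewrite mxE scalerDl. Qed.

Lemma momentumN nu : momentum v (- nu) = - momentum v nu.
Proof. by rewrite /momentum -sumrN; apply: eq_bigr => i _; rewrite mxE scaleNr. Qed.

Lemma mass_unitv (i : 'I_m) : mass (unitv i) = 1.
Proof.
rewrite /mass (bigD1 i) //= mxE !eqxx big1 ?addr0 // => j ji.
by rewrite mxE (negPf ji) andbF.
Qed.

Lemma energy_unitv (i : 'I_m) : energy (unitv i) = normsq (row i v).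
Proof.
rewrite /energy (bigD1 i) //= mxE !eqxx mul1r big1 ?addr0 // => j ji.
by rewrite mxE (negPf ji) andbF mul0r.
Qed.

Lemma momentum_unitv (i : 'I_m) : momentum v (unitv i) = row i v.
Proof.
rewrite /momentum (bigD1 i) //= mxE !eqxx scale1r big1 ?addr0 // => j ji.
by rewrite mxE (negPf ji) andbF scale0r.
Qed.

Definition freqs : seq 'rV[int]_m :=
  [seq unitv i - unitv j | i <- enum 'I_m, j <- enum 'I_m] ++
  [seq - (unitv i + unitv j) | i <- enum 'I_m, j <- enum 'I_m] ++
  [seq unitv i + unitv j | i <- enum 'I_m, j <- enum 'I_m].

Lemma nrm_unitv (i : 'I_m) : nrm (unitv i) = 1%N.
Proof.
rewrite /nrm (bigD1 i) //= mxE !eqxx big1 ?addn0 // => j ji.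
by rewrite mxE (negPf ji) andbF.
Qed.

Lemma nrm_freqs nu : nu \in freqs -> (nrm nu <= 2)%N.
Proof.
rewrite !mem_cat => /orP[|/orP[|]] /allpairsP[[i j] [_ _ ->]] /=;
  rewrite ?nrmN; apply: leq_trans (nrmD _ _) _; by rewrite ?nrmN !nrm_unitv.
Qed.

(* The monomials of Q that contain z_k^{~~ sg} move the site (k, sg) to (h, tau) and the frequency
   by nu; they conserve momentum, mass and energy. *)
Record qstep nu (w w' : 'rV[int]_n * bool) : Prop := QStep {
  qstep_Sc : Sc v w'.1;
  qstep_freq : nu \in freqs;
  qstep_momentum : momentum v nu + sgz w'.2 *: w'.1 = sgz w.2 *: w.1;
  qstep_mass : mass nu + sgz w'.2 = sgz w.2;
  qstep_energy : energy nu + sgz w'.2 * normsq w'.1 = sgz w.2 * normsq w.1;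
  qstep_site : site_adj v w.1 w'.1 }.

Definition is_Qmonom M := exists (i j : 'I_m) (h k : 'rV[int]_n),
  (star v (i, j, h, k) /\ M = zz true h false k (unitv i - unitv j)) \/
  (starstar v (i, j, h, k) /\
     (M = zz true h true k (- (unitv i + unitv j)) \/ M = zz false h false k (unitv i + unitv j))).

Lemma zzE sg h tau k nu : zz sg h tau k nu =
  (nu, ([mset inr (h, sg)] `+` [mset inr (k, tau)])%mset) :> monom m n.
Proof. by rewrite /zz /monom_mul /ex /vz /= !addr0 mset0D. Qed.

(** Bracketing with Q replaces z_k^sg by the factor that accompanies its conjugate in a monomial of
    Q. There are three kinds of monomials, each with two positions for that conjugate, hence six
    cases. *)
Lemma Qmonom_step nu (k : 'rV[int]_n) sg (W : {mset var m n}%mset) :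
  is_Qmonom (nu, (inr (k, ~~ sg) +` W)%mset) ->
  exists2 w', W = [mset inr w']%mset & qstep nu (k, sg) w'.
Proof.
have fr1 i j : unitv i - unitv j \in freqs.
  by rewrite !mem_cat (allpairs_f (fun i j => unitv i - unitv j)) // mem_enum.
have fr2 i j : - (unitv i + unitv j) \in freqs.
  by rewrite !mem_cat (allpairs_f (fun i j => - (unitv i + unitv j))) ?orbT // mem_enum.
have fr3 i j : unitv i + unitv j \in freqs.
  by rewrite !mem_cat (allpairs_f (fun i j => unitv i + unitv j)) ?orbT // mem_enum.
have simp := (massD, massN, energyD, energyN, momentumD, momentumN,
  mass_unitv, energy_unitv, momentum_unitv).
move=> [i [j [h0 [k0 [[[ij Sh Sk mom en] e]|[[ij Sh Sk mom en] [] e]]]]]];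
  move: e; rewrite zzE; case: sg => /= -[-> /mset_pair[] [[//] -> ->]].
- exists (h0, true) => //; split; rewrite ?simp /sgz ?scale1r //=; last 2 first.
  + by move: en; lia.
  + by left; exists i, j.
  by apply/rowP => l; have := congr1 (fun x : 'rV_n => x 0 l) mom; rewrite /= !mxE;
    move: (h0 0 l) (k0 0 l) (v i l) (v j l) => a b c d; lia.
- exists (k0, false) => //; split; rewrite ?simp /sgz ?scaleN1r //=; last 2 first.
  + by move: en; lia.
  + by left; exists j, i.
  by apply/rowP => l; have := congr1 (fun x : 'rV_n => x 0 l) mom; rewrite /= !mxE;
    move: (h0 0 l) (k0 0 l) (v i l) (v j l) => a b c d; lia.
- exists (k0, true) => //; split; rewrite ?simp /sgz ?scale1r ?scaleN1r //=; last 2 first.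
  + by move: en; lia.
  + by right; exists i, j; rewrite addrC (addrC (normsq k0)).
  by apply/rowP => l; have := congr1 (fun x : 'rV_n => x 0 l) mom; rewrite /= !mxE;
    move: (h0 0 l) (k0 0 l) (v i l) (v j l) => a b c d; lia.
- exists (h0, true) => //; split; rewrite ?simp /sgz ?scale1r ?scaleN1r //=; last 2 first.
  + by move: en; lia.
  + by right; exists i, j.
  by apply/rowP => l; have := congr1 (fun x : 'rV_n => x 0 l) mom; rewrite /= !mxE;
    move: (h0 0 l) (k0 0 l) (v i l) (v j l) => a b c d; lia.
- exists (k0, false) => //; split; rewrite ?simp /sgz ?scale1r ?scaleN1r //=; last 2 first.
  + by move: en; lia.
  + by right; exists i, j; rewrite addrC (addrC (normsq k0)).
  by apply/rowP => l; have := congr1 (fun x : 'rV_n => x 0 l) mom; rewrite /= !mxE;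
    move: (h0 0 l) (k0 0 l) (v i l) (v j l) => a b c d; lia.
- exists (h0, false) => //; split; rewrite ?simp /sgz ?scale1r ?scaleN1r //=; last 2 first.
  + by move: en; lia.
  + by right; exists i, j.
  by apply/rowP => l; have := congr1 (fun x : 'rV_n => x 0 l) mom; rewrite /= !mxE;
    move: (h0 0 l) (k0 0 l) (v i l) (v j l) => a b c d; lia.
Qed.

Lemma hamQ_supp xi M : hamQ v xi M != 0 -> is_Qmonom M.
Proof.
apply: contra_neqP => nQ; rewrite /hamQ.
have weighted_norm A : M <> A -> mono R A M = 0 by rewrite /mono => /eqP/negPf->.
rewrite !fsbig1 ?mulr0 ?addr0 //.
- move=> [[[i j] h] k] st; apply: mulr_add_eq0; apply: weighted_norm => e; apply: nQ;
    exists i, j, h, k; right; split; [exact: st|by left|exact: st|by right].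
- move=> [[[i j] h] k] st; apply: mulr_eq0r; apply: weighted_norm => e; apply: nQ.
  by exists i, j, h, k; left.
Qed.

Local Notation nc := Normc.normc.

Lemma normc_ge0 (z : R[i]) : 0 <= nc z.
Proof. by case: z => a b; exact: sqrtr_ge0. Qed.

Lemma normc_le_sum (T : Type) (s : seq T) (P : pred T) (F : T -> R[i]) :
  nc (\sum_(t <- s | P t) F t) <= \sum_(t <- s | P t) nc (F t).
Proof.
elim/big_ind2: _ => [|x a y b xa yb|//]; first by rewrite Normc.normc0.
by apply: le_trans (le_normcD _ _) _; exact: lerD.
Qed.

Lemma normc_real (x : R) : nc x%:C%C = `|x|.
Proof. by rewrite /Normc.normc /= expr0n addr0 sqrtr_sqr. Qed.

Lemma normc_nat (k : nat) : nc (k%:R : R[i]) = k%:R.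
Proof. by rewrite -[k%:R](rmorph_nat (real_complex R)) normc_real normr_nat. Qed.

Lemma normc_i : nc ('i%C : R[i]) = 1.
Proof. by rewrite /Normc.normc /= expr0n expr1n add0r sqrtr1. Qed.

Lemma normc_fsbig_le (T : choiceType) (P : set T) (F : T -> R[i]) (s : seq T) (b : R) :
  0 <= b -> (forall t, P t -> F t != 0 -> t \in s) -> (forall t, P t -> nc (F t) <= b) ->
  nc (\sum_(t \in P) F t) <= (size s)%:R * b.
Proof.
move=> b0 hs hb; rewrite (@fsbig_list _ _ _ _ (undup s)) ?undup_uniq //; last first.
  by move=> x Px Fx; rewrite mem_undup; exact: hs.
apply: le_trans (normc_le_sum _ _ _) _.
apply: (@le_trans _ _ (\sum_(t <- undup s) b)).
  rewrite big_mkcond; apply: ler_sum => t _.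
  by case: ifPn => //; rewrite inE; exact: hb.
rewrite big_const_seq count_predT iter_addr addr0 -[X in X <= _]mulr_natl ler_wpM2r //.
by rewrite ler_nat size_undup.
Qed.

(** A tuple (i, j, h, k) contributing to a given monomial has h and k among its two sites, so there
    are at most 4 m^2 of them in each sum. The prefactors are 4 in the first sum and 2 (1 + 1) in
    the second, and (4 + 4) 4 m^2 = 32 m^2. *)
Definition hamQ_bound : R := (32 * (m * m))%:R.

Lemma mono_neq0 A M : mono R A M != 0 -> M = A.
Proof. by rewrite /mono; case: (M =P A) => // _; rewrite eqxx. Qed.

Lemma normc_mono_le1 A M : nc (mono R A M) <= 1.
Proof. by rewrite /mono normc_nat; case: (M == A). Qed.

Lemma normcM_le (z w : R[i]) (a b : R) : nc z <= a -> nc w <= b -> nc (z * w) <= a * b.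
Proof. by move=> za wb; rewrite Normc.normcM ler_pM // normc_ge0. Qed.

Lemma normcD_le (z w : R[i]) (a b : R) : nc z <= a -> nc w <= b -> nc (z + w) <= a + b.
Proof. by move=> za wb; apply: le_trans (le_normcD _ _) _; rewrite lerD. Qed.

Lemma mulr_neq0r (K : pzSemiRingType) (c a : K) : c * a != 0 -> a != 0.
Proof. by apply: contra_neq => ->; rewrite mulr0. Qed.

Lemma addr_neq0 (K : nmodType) (a b : K) : a + b != 0 -> a != 0 \/ b != 0.
Proof. by have [->|a0] := eqVneq a 0; [rewrite add0r; right|left]. Qed.

Lemma hamQ_le xi rho M : (forall i, 0 <= xi i <= rho) -> 0 <= rho ->
  nc (hamQ v xi M) <= hamQ_bound * rho.
Proof.
move=> hxi rho0.
have [->|QM] := eqVneq (hamQ v xi M) 0.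
  by rewrite Normc.normc0 mulr_ge0 // ler0n.
have [k1 [k2 [s1 [s2 M2]]]] : exists k1 k2 s1 s2,
    M.2 = ([mset inr (k1, s1)] `+` [mset inr (k2, s2)])%mset.
  have [i [j [h [k [[_ ->]|[_ [|] ->]]]]]] := hamQ_supp QM; rewrite zzE /=;
    by exists h, k; do 2 eexists.
pose S := [:: k1; k2].
pose T := [seq (x, k) | x <- [seq (ij, h) | ij <- enum {: 'I_m * 'I_m}, h <- S], k <- S].
have inT i j h k sg tau nu : M = zz sg h tau k nu -> (i, j, h, k) \in T.
  move=> e; have inS x b : inr (x, b) \in M.2 -> x \in S.
    rewrite M2 in_mset_pair => /orP[] /eqP[-> _]; first exact: mem_head.
    by rewrite /S !inE eqxx orbT.
  have hS : h \in S.
    by apply: (inS _ sg); rewrite e zzE in_mset_pair; apply/orP; left; apply/eqP.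
  have kS : k \in S.
    by apply: (inS _ tau); rewrite e zzE in_mset_pair; apply/orP; right; apply/eqP.
  by apply: allpairs_f => //; apply: allpairs_f => //; rewrite mem_enum.
have sT : size T = (4 * (m * m))%N.
  by rewrite !size_allpairs -cardE card_prod !card_ord /=; lia.
have sq i j : nc (Num.sqrt (xi i * xi j))%:C%C <= rho.
  have [/andP[i0 ir] /andP[j0 jr]] := (hxi i, hxi j).
  rewrite normc_real ger0_norm ?sqrtr_ge0 // -[leRHS]ger0_norm // -sqrtr_sqr.
  by rewrite ler_sqrt ?sqr_ge0 // expr2 ler_pM.
have -> : hamQ_bound * rho = 4 * ((size T)%:R * (rho * 1)) + 2 * ((size T)%:R * (rho * (1 + 1))).
  by rewrite sT /hamQ_bound !natrM; ring.
rewrite /hamQ; apply: normcD_le; apply: normcM_le; rewrite ?normc_nat //.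
- apply: normc_fsbig_le; first by rewrite mulr1.
  + move=> [[[i j] h] k] _ /mulr_neq0r /mono_neq0; exact: inT.
  + move=> [[[i j] h] k] _; apply: normcM_le; [exact: sq|exact: normc_mono_le1].
- apply: normc_fsbig_le; first by rewrite mulr_ge0.
  + move=> [[[i j] h] k] _ /mulr_neq0r hne.
    by case: (addr_neq0 hne) => /mono_neq0; exact: inT.
  + move=> [[[i j] h] k] _; apply: normcM_le; first exact: sq.
    by apply: normcD_le; exact: normc_mono_le1.
Qed.

(** The momentum relation of a [qstep] determines the new site from the frequency and the new sign:
    3 m^2 frequencies and two signs. *)
Definition cand (w : 'rV[int]_n * bool) : seq (monom m n) :=
  [seq (nu, [mset inr (sgz tau *: (sgz w.2 *: w.1 - momentum v nu), tau)]%mset)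
     | nu <- freqs, tau <- [:: true; false]].

Lemma qstep_cand nu w w' : qstep nu w w' -> (nu, [mset inr w']%mset) \in cand w.
Proof.
case: w' => h tau [_ fr mom _ _ _].
have -> : h = sgz tau *: (sgz w.2 *: w.1 - momentum v nu).
  by rewrite -mom addrC addKr /=; case: tau {mom}; rewrite /sgz ?scale1r // !scaleN1r opprK.
by apply/allpairsP; exists (nu, tau); split=> //=; case: tau {mom}.
Qed.

Lemma size_cand w : size (cand w) = (6 * (m * m))%N.
Proof. by rewrite size_allpairs !size_cat !size_allpairs size_enum_ord /=; lia. Qed.

(** The Hamiltonian vector field of Q in the direction z_k^sg, up to the factor i and the sign of
    the bracket; it is the derivative in the conjugate variable. *)
Definition Qfield xi (w : 'rV[int]_n * bool) : hseries R m n := dz (~~ w.2) w.1 (hamQ v xi).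

Lemma Qfield_step xi w M : Qfield xi w M != 0 -> exists2 w', M.2 = [mset inr w']%mset & qstep M.1 w w'.
Proof.
case: w => k sg /mulr_neq0r /hamQ_supp; exact: Qmonom_step.
Qed.

Lemma Qfield_le xi rho w M : (forall i, 0 <= xi i <= rho) -> 0 <= rho ->
  nc (Qfield xi w M) <= 2 * (hamQ_bound * rho).
Proof.
move=> hxi rho0; have [->|ne] := eqVneq (Qfield xi w M) 0.
  by rewrite Normc.normc0 mulr_ge0 // mulr_ge0 // ler0n.
have [w' M2 _] := Qfield_step ne.
rewrite /Qfield /dz /dvar; apply: normcM_le; last exact: hamQ_le.
(* The derivative of a quadratic monomial carries a factor 2 when the monomial is a square, and 1
   otherwise. *)
by rewrite normc_nat ler_nat M2 msetnE; case: eqP.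
Qed.

End NormalFormList.

(** Zero coefficients are filtered out so that every entry of the list comes from a [qstep]. *)
HB.lock Definition Qlist (R : realType) (m n : nat) (v : 'M[int]_(m, n)) (xi : 'I_m -> R)
    (w : 'rV[int]_n * bool) : seq (R[i] * monom m n) :=
  [seq p <- values (Qfield v xi w) (undup (cand v w)) | p.1 != 0].

Section QList.
Context (R : realType) (m n : nat) (v : 'M[int]_(m, n)).
Implicit Types (xi : 'I_m -> R) (M : monom m n) (w : 'rV[int]_n * bool).

Lemma Qlist_step xi w p : p \in Qlist v xi w ->
  [/\ p.1 = Qfield v xi w p.2, p.1 != 0 & exists2 w', p.2.2 = [mset inr w']%mset & qstep v p.2.1 w w'].
Proof.
rewrite Qlist.unlock mem_filter => /andP[p0 /mapP[M _ e]]; move: p0; rewrite e => p0.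
by split; [|exact: p0|exact: Qfield_step p0].
Qed.

Lemma Qfield_lc xi w : Qfield v xi w = lc (Qlist v xi w).
Proof.
rewrite {1}(@lc_values _ _ _ (Qfield v xi w) (undup (cand v w))) ?undup_uniq //; last first.
  move=> [nu W] /Qfield_step[w' /= -> /qstep_cand]; by rewrite mem_undup.
apply/funext => M; rewrite !lcE Qlist.unlock big_filter_cond [RHS]big_mkcond [LHS]big_mkcond.
by apply: eq_bigr => p _; have [->|_] := eqVneq p.1 0; rewrite ?if_same.
Qed.

Lemma size_Qlist xi w : (size (Qlist v xi w) <= 6 * (m * m))%N.
Proof.
rewrite -(size_cand v w) Qlist.unlock size_filter; apply: leq_trans (count_size _ _) _.
by rewrite size_map size_undup.
Qed.

End QList.

(** * The operator ad(N) on monomials *)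

Section Adjoint.
Context (R : realType) (m n : nat) (v : 'M[int]_(m, n)) (xi : 'I_m -> R).
Implicit Types (M : monom m n) (nu : 'rV[int]_m) (w : 'rV[int]_n * bool) (r : seq (R[i] * monom m n)).

Definition zmonom M := forall x, x \in M.2 -> exists2 w, x = inr w & Sc v w.1.

Lemma mset1E (T : choiceType) (a b : T) : [mset a]%mset b = (b == a).
Proof. by rewrite msetnE; case: eqP. Qed.

Lemma hamQ_inl (i : 'I_m) nu W : hamQ v xi (nu, (inl i +` W)%mset) = 0.
Proof.
apply: contra_notP (fun h => h) => /eqP/hamQ_supp [j [j' [h [k H]]]].
have [a [b e]] : exists a b, (inl i +` W)%mset = ([mset inr a] `+` [mset inr b])%mset.
  by case: H => [[_]|[_ []]]; rewrite zzE => -[_ ->]; do 2 eexists.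
by case: (mset_pair e) => -[].
Qed.

Lemma dy_hamN i : dy i (hamN v xi) = lc [:: ((omega v xi i)%:C%C, (0, mset0%mset))].
Proof.
apply/funext => -[nu W]; rewrite lc_cons lc_nil addr0 /dy /dvar /hamN hamQ_inl addr0 fsbig1; last first.
  move=> k _; rewrite /mono zzE; case: eqP => [[_ e]|_]; last by rewrite mulr0.
  by case: (mset_pair e) => -[].
rewrite addr0 (bigD1 i) //= big1 ?addr0; last first.
  move=> j ji; rewrite /mono /vy xpair_eqE; case: (_ =P [mset inl j]%mset) => [e|_]; last first.
    by rewrite andbF mulr0.
  have := mset1D1 (inl i) W; rewrite e in_mset1=> /eqP[ij]; by rewrite ij eqxx in ji.
rewrite /mono /vy !xpair_eqE /=.
have -> : ((inl i +` W)%mset == [mset inl i]%mset) = (W == mset0%mset).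
  apply/eqP/eqP => [e|->]; last by rewrite msetD0.
  by rewrite -(msetD1K (inl i) W) e -[X in (X `\ _)%mset]msetD0 msetD1K.
case: (nu =P 0) => _ /=; last by rewrite !mulr0.
case: (W =P mset0%mset) => [->|_] /=; last by rewrite !mulr0.
by rewrite mset0E mul1r mulr1.
Qed.

End Adjoint.

HB.lock Definition zfield (R : realType) (m n : nat) (v : 'M[int]_(m, n)) (xi : 'I_m -> R)
    (w : 'rV[int]_n * bool) : seq (R[i] * monom m n) :=
  ((Omega xi w.1)%:C%C, (0, [mset inr w]%mset)) :: Qlist v xi w.

HB.lock Definition zdir (R : realType) (m n : nat) (v : 'M[int]_(m, n)) (xi : 'I_m -> R)
    (x : var m n) : seq (R[i] * monom m n) :=
  if x is inr w then [seq ((sgz w.2)%:~R * t.1, t.2) | t <- zfield v xi w] else [::].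

(** The Leibniz rule on a monomial in e^{ix}, z, zbar: N acts on the frequency by (omega, nu), then
    on each variable in turn, a multiset being enumerated with multiplicities. The sign of the
    bracket is in [zdir]. *)
HB.lock Definition adN_list (R : realType) (m n : nat) (v : 'M[int]_(m, n)) (xi : 'I_m -> R)
    (M : monom m n) : seq (R[i] * monom m n) :=
  ('i%C * \sum_i (omega v xi i)%:C%C * (M.1 0 i)%:~R, M) ::
  flatten [seq [seq ('i%C * t.1, monom_mul t.2 (M.1, (M.2 `\ x)%mset)) | t <- zdir v xi x] | x <- M.2].

Lemma sgz_mulrn (K : comPzRingType) (c a b : K) (k l : nat) :
  c * k%:R * a - c * l%:R * b = c * (1%:~R * a *+ k + (-1)%:~R * b *+ l).
Proof. by rewrite mulr1z mulrN1z mul1r mulN1r mulrDr mulNrn mulrN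
  -(mulr_natl a k) -(mulr_natl b l) !mulrA. Qed.

Lemma sum_bools (V : nmodType) (f : bool -> V) :
  \sum_(b <- [:: true; false]) f b = f true + f false.
Proof. by rewrite !big_cons big_nil /= addr0. Qed.

Section AdjointList.
Context (R : realType) (m n : nat) (v : 'M[int]_(m, n)) (xi : 'I_m -> R).
Implicit Types (M : monom m n) (nu : 'rV[int]_m) (w : 'rV[int]_n * bool) (r : seq (R[i] * monom m n)).

Lemma dz_hamN w : Sc v w.1 -> dz (~~ w.2) w.1 (hamN v xi) = lc (zfield v xi w).
Proof.
case: w => k sg /= Sk; apply/funext => -[nu W].
rewrite zfield.unlock lc_cons -Qfield_lc /Qfield /= /dz /dvar /hamN /= !mulrDr; congr (_ + _).
rewrite [X in _ * X]big1 ?mulr0 ?add0r; last first.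
  move=> j _; rewrite /mono /vy xpair_eqE; case: (_ =P [mset inl j]%mset) => [e|_]; last first.
    by rewrite andbF mulr0.
  by have := mset1D1 (inr (k, ~~ sg)) W; rewrite e in_mset1.
have key k' : (inr (k, ~~ sg) +` W)%mset = ([mset inr (k', true)] `+` [mset inr (k', false)])%mset
    <-> k' = k /\ W = [mset inr (k, sg)]%mset.
  split=> [/mset_pair[] [[-> /(canRL negbK) /= ->] ->] //|[-> ->]].
  by case: sg; [exact: msetDC|exact: erefl].
have [e|e] := eqVneq (nu, W) (0, [mset inr (k, sg)]%mset); last first.
  rewrite fsbig1 ?mulr0 // => k' _; rewrite /mono zzE; case: eqP => [[e1 /key[e2 e3]]|_].
    by rewrite e1 e3 eqxx in e.
  by rewrite mulr0.
case: e => -> eW; rewrite (@fsbig_list _ _ _ _ [:: k]) //; last first.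
  move=> k' _ /mulr_neq0r /mono_neq0; rewrite zzE => E.
  by have [-> _] := (key k').1 (congr1 snd E); rewrite mem_head.
rewrite big_cons big_nil mem_set // addr0 /mono zzE ((key k).2 (conj erefl eW)) eqxx mulr1.
have -> : W (inr (k, ~~ sg)) = 0%N.
  by rewrite eW mset1E; case: eqP => // -[]; case: (sg).
by rewrite mul1r.
Qed.

Lemma hmul0l (Z : hseries R m n) M : hmul (fun=> 0) Z M = 0.
Proof. by rewrite /hmul fsbig1 // => q _; rewrite mul0r. Qed.

Lemma lc0 r M : (forall p, p \in r -> p.1 = 0) -> lc r M = 0.
Proof. by move=> h; rewrite lcE big_seq_cond big1 // => p /andP[/h]. Qed.

Lemma sum_lc_mul r s M : lc (lc_mul r s) M =
  \sum_(q <- s) q.1 * \sum_(p <- r | M == monom_mul p.2 q.2) p.1.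
Proof.
rewrite lc_mulE (exchange_big_dep predT) //=; apply: eq_bigr => q _.
by rewrite mulr_sumr; apply: eq_bigr => p _; rewrite mulrC.
Qed.

Lemma adN_lc r M : (forall p, p \in r -> zmonom v p.2) ->
  adN v xi (lc r) M = \sum_(p <- r) p.1 * lc (adN_list v xi p.2) M.
Proof.
move=> zr; rewrite /adN /poisson.
(* No variable y occurs in the argument, so of the first sum of the bracket only the terms omega_i
   d/dx_i remain. *)
have dy0 i : dy i (lc r) = fun=> 0.
  apply/funext => A; rewrite /dy dvar_lcE lc0 // => q /mapP[p pr ->] /=.
  suff -> : p.2.2 (inl i) = 0%N by rewrite mulr0.
  by apply/eqP; rewrite mset_eq0; apply/negP => /(zr _ pr)[].
pose psi (p : R[i] * monom m n) (x : var m n) : R[i] :=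
  \sum_(t <- zdir v xi x | M == monom_mul t.2 (p.2.1, (p.2.2 `\ x)%mset)) t.1.
rewrite (eq_bigr (fun i => \sum_(p <- r | M == p.2)
    p.1 * ('i%C * ((omega v xi i)%:C%C * (p.2.1 0 i)%:~R)))); last first.
  move=> i _; rewrite dy0 hmul0l subr0 dy_hamN dx_lcE hmul_lc sum_lc_mul big_map /=.
  rewrite [RHS]big_mkcond; apply: eq_bigr => p _.
  rewrite [X in _ * X]big_mkcond big_cons big_nil /= addr0.
  have -> : monom_mul (0, mset0%mset) p.2 = p.2.
    by case: (p.2) => a b; rewrite /monom_mul /= add0r mset0D.
  case: ifP => _; last by rewrite mulr0.
  by rewrite -mulrA; congr (_ * _); rewrite mulrAC -mulrA.
have hk k : Sc v k -> hmul (dz false k (hamN v xi)) (dz true k (lc r)) M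
   - hmul (dz true k (hamN v xi)) (dz false k (lc r)) M =
   \sum_(p <- r) p.1 * (psi p (inr (k, true)) *+ p.2.2 (inr (k, true))
                       + psi p (inr (k, false)) *+ p.2.2 (inr (k, false))).
  move=> Sk.
  have hE b : hmul (dz (~~ b) k (hamN v xi)) (dz b k (lc r)) M =
      \sum_(p <- r) p.1 * (p.2.2 (inr (k, b)))%:R * \sum_(t <- zfield v xi (k, b)
        | M == monom_mul t.2 (p.2.1, (p.2.2 `\ inr (k, b))%mset)) t.1.
    by rewrite (@dz_hamN (k, b)) // /dz dvar_lcE hmul_lc sum_lc_mul big_map.
  have psiE (p : R[i] * monom m n) b : psi p (inr (k, b)) = (sgz b)%:~R *
      \sum_(t <- zfield v xi (k, b) | M == monom_mul t.2 (p.2.1, (p.2.2 `\ inr (k, b))%mset)) t.1.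
    by rewrite /psi zdir.unlock big_map mulr_sumr.
  apply: etrans (congr2 (fun a b => a - b) (hE true) (hE false)) _.
  rewrite -sumrB; apply: eq_bigr => p _.
  rewrite (psiE p true) (psiE p false) /sgz.
  exact: sgz_mulrn.
pose g k : R[i] := \sum_(p <- r) p.1 * (psi p (inr (k, true)) *+ p.2.2 (inr (k, true))
                                 + psi p (inr (k, false)) *+ p.2.2 (inr (k, false))).
rewrite (eq_fsbigr g) => [|k]; last by rewrite inE => /hk.
pose ms (x : var m n) : 'rV[int]_n := if x is inr w then w.1 else 0.
pose K : seq 'rV[int]_n :=
  undup (flatten [seq [seq ms x | x : var m n <- p.2.2] | p : R[i] * monom m n <- r]).
have inK (p : R[i] * monom m n) w : p \in r -> inr w \in p.2.2 -> w.1 \in K.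
  move=> pr wp; rewrite mem_undup; apply/flattenP.
  exists [seq ms x | x : var m n <- p.2.2]; last by apply/mapP; exists (inr w).
  by apply/mapP; exists p.
have g0 k : g k != 0 -> k \in K.
  apply: contraR => kK; rewrite /g big_seq big1 // => p pr.
  have Z b : p.2.2 (inr (k, b)) = 0%N.
    by apply/eqP; rewrite mset_eq0; apply: contra kK; exact: (inK p (k, b)).
  rewrite (Z true) (Z false); move: (psi p (inr (k, true))) (psi p (inr (k, false))) => c e.
  by rewrite !mulr0n addr0 mulr0.
rewrite (@fsbig_list _ _ _ _ K) ?undup_uniq //; last by move=> k _; exact: g0.
(* The sum over sites of the bracket becomes, for each monomial, the sum over its own variables
   counted with multiplicity. *)
have -> : \sum_(k <- K | k \in Sc v) g k = \sum_(p <- r) p.1 * \sum_(x <- p.2.2) psi p x.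
  transitivity (\sum_(k <- K) g k).
    rewrite big_seq_cond [RHS]big_seq; apply: eq_bigl => k.
    case: (boolP (k \in K)) => //=; rewrite mem_undup => /flattenP[s /mapP[p pr ->]].
    by move=> /mapP[x /(zr _ pr) [w -> Sw] ->]; rewrite mem_set.
  rewrite exchange_big big_seq [RHS]big_seq; apply: eq_bigr => p pr.
  rewrite -mulr_sumr; congr (_ * _).
  rewrite (@sum_mset_superset _ _ _ _ [seq inr (k, b) | k <- K, b <- [:: true; false]]).
  - rewrite big_allpairs_dep /=; apply: eq_bigr => k _.
    exact/esym/(sum_bools (fun b => psi p (inr (k, b)) *+ p.2.2 (inr (k, b)))).
  - by apply: allpairs_uniq => [||[k b] [k' b'] _ _ [-> ->]]; rewrite ?undup_uniq.
  - move=> x xp; have [[k b] e _] := zr _ pr _ xp; rewrite e; apply: allpairs_f.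
      by rewrite e in xp; exact: (inK p (k, b)).
    by case: b {e}.
rewrite (exchange_big_dep predT) //= mulr_sumr -big_split; apply: eq_bigr => p _ /=.
rewrite mulrCA adN_list.unlock lc_cons lcE -/(psi p) mulrDr; congr (_ + _).
  case: (M == p.2); last by rewrite big_pred0_eq mulr0.
  by rewrite -!mulr_sumr.
rewrite mulr_sumr; congr (_ * _).
rewrite big_flatten big_map; apply: eq_bigr => x _.
by rewrite big_map /psi mulr_sumr.
Qed.

End AdjointList.

(** * The operator - i ad(N) as a derivation *)

HB.lock Definition Qdir (R : realType) (m n : nat) (v : 'M[int]_(m, n)) (xi : 'I_m -> R)
    (x : var m n) : seq (R[i] * monom m n) :=
  if x is inr w then [seq ((sgz w.2)%:~R * t.1, t.2) | t <- Qlist v xi w] else [::].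

Definition remove_var (m n : nat) (M : monom m n) (x : var m n) : monom m n := (M.1, (M.2 `\ x)%mset).

(** The eigenvalue at M of the part of - i ad(N) due to (omega, y) + sum Omega_k |z_k|^2; everything
    coming from Q is in [off_list]. *)
HB.lock Definition diag (R : realType) (m n : nat) (v : 'M[int]_(m, n)) (xi : 'I_m -> R)
    (M : monom m n) : R :=
  \sum_i omega v xi i * (M.1 0 i)%:~R +
  \sum_(x <- M.2) (if x is inr w then (sgz w.2)%:~R * Omega xi w.1 else 0).

HB.lock Definition off_list (R : realType) (m n : nat) (v : 'M[int]_(m, n)) (xi : 'I_m -> R)
    (M : monom m n) : seq (R[i] * monom m n) :=
  flatten [seq [seq (t.1, monom_mul t.2 (remove_var M x)) | t <- Qdir v xi x] | x <- M.2].

Definition op_list (R : realType) (m n : nat) (v : 'M[int]_(m, n)) (xi : 'I_m -> R)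
    (M : monom m n) : seq (R[i] * monom m n) :=
  ((diag v xi M)%:C%C, M) :: off_list v xi M.

Lemma opp_i_mulA (R : realType) (a b : R[i]) : - 'i%C * (a * ('i%C * b)) = a * b.
Proof. by rewrite mulrCA [X in _ * X]mulrA mulNr -expr2 sqr_i opprK mul1r. Qed.

Section Op.
Context (R : realType) (m n : nat) (v : 'M[int]_(m, n)) (xi : 'I_m -> R).
Implicit Types (A B M : monom m n) (nu : 'rV[int]_m) (w : 'rV[int]_n * bool) (r s : seq (R[i] * monom m n)).
Implicit Types (X Y : hseries R m n).

(* Unlike ad(N), the operator - i ad(N) is real on monomials, with diagonal [diag]. *)
Definition adT X : hseries R m n := fun M => - 'i%C * adN v xi X M.

Lemma lc_off M M0 : lc (off_list v xi M) M0 =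
  \sum_(x <- M.2) \sum_(t <- Qdir v xi x | M0 == monom_mul t.2 (remove_var M x)) t.1.
Proof.
rewrite lcE off_list.unlock big_flatten big_map; apply: eq_bigr => x _.
by rewrite big_map.
Qed.

Lemma if_sum (V : nmodType) (T : Type) (s : seq T) (b : bool) (F : T -> V) :
  (if b then \sum_(x <- s) F x else 0) = \sum_(x <- s) (if b then F x else 0).
Proof. by case: b => //; rewrite big1. Qed.

Lemma if_i_mul (b : bool) (c d : R[i]) :
  (if b then 'i%C * c else 0) + 'i%C * d = 'i%C * ((if b then c else 0) + d).
Proof. by case: b; rewrite mulrDr // mulr0. Qed.

Lemma adN_list_op M M0 : zmonom v M -> lc (adN_list v xi M) M0 = 'i%C * lc (op_list v xi M) M0.
Proof.
move=> zM; rewrite adN_list.unlock /op_list lc_cons [in RHS]lc_cons lc_off lcE.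
rewrite big_flatten big_map.
rewrite (eq_big_seq (fun x => 'i%C * ((if M0 == M then
   (if x is inr w then (sgz w.2)%:~R * Omega xi w.1 else 0)%:C%C else 0) +
   \sum_(t <- Qdir v xi x | M0 == monom_mul t.2 (remove_var M x)) t.1))); last first.
  move=> x xM; have [w e _] := zM _ xM.
  rewrite big_map -mulr_sumr zdir.unlock Qdir.unlock e zfield.unlock; congr (_ * _).
  rewrite !big_map big_cons /=.
  have -> : monom_mul (0, [mset inr w]%mset) (remove_var M (inr w)) = M.
    by rewrite /monom_mul /= add0r msetB1K ?(esym e) //; case: (M).
  by case: ifP => _; rewrite ?add0r // rmorphM /= rmorph_int.
rewrite -mulr_sumr big_split -if_sum if_i_mul addrA; congr (_ * (_ + _)).
rewrite diag.unlock rmorphD !rmorph_sum; case: (M0 == M) => /=; last by rewrite addr0.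
by congr (_ + _); apply: eq_bigr => i _; rewrite rmorphM /= rmorph_int.
Qed.

Lemma adT_sum (s : seq (monom m n)) X : uniq s -> (forall M, M \in s -> zmonom v M) ->
  (forall M, X M != 0 -> M \in s) ->
  forall M0, adT X M0 = \sum_(A <- s) X A * lc (op_list v xi A) M0.
Proof.
move=> us zs Xs M0; rewrite /adT {1}(lc_values us Xs) adN_lc; last first.
  by move=> p /mapP[M Ms ->]; exact: zs.
rewrite big_map mulr_sumr big_seq [RHS]big_seq; apply: eq_bigr => M Ms.
by rewrite adN_list_op ?opp_i_mulA //; exact: zs.
Qed.

(** The sums in [hmul] and [poisson] count as 0 when their support is infinite, so linearity and the
    Leibniz rule are established on finitely supported series. *)
Definition zfin X := exists s : seq (monom m n),
  [/\ uniq s, forall M, M \in s -> zmonom v M & forall M, X M != 0 -> M \in s].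

Lemma zfin2 X Y : zfin X -> zfin Y -> exists s : seq (monom m n),
  [/\ uniq s, forall M, M \in s -> zmonom v M, forall M, X M != 0 -> M \in s
    & forall M, Y M != 0 -> M \in s].
Proof.
move=> [s [us zs Xs]] [s' [us' zs' Ys]]; exists (undup (s ++ s')); split.
- exact: undup_uniq.
- by move=> M; rewrite mem_undup mem_cat => /orP[/zs|/zs'].
- by move=> M /Xs h; rewrite mem_undup mem_cat h.
- by move=> M /Ys h; rewrite mem_undup mem_cat h orbT.
Qed.

Lemma lin_neq0 (c x y : R[i]) : c * x + y != 0 -> x != 0 \/ y != 0.
Proof. by case/addr_neq0; [move/mulr_neq0r; left|right]. Qed.

Lemma zfin_lin c X Y : zfin X -> zfin Y -> zfin (fun M => c * X M + Y M).
Proof.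
move=> zX zY; have [s [us zs Xs Ys]] := zfin2 zX zY.
by exists s; split=> // M /lin_neq0[/Xs|/Ys].
Qed.

Lemma mul_lin_distr (c x y z : R[i]) : (c * x + y) * z = c * (x * z) + y * z.
Proof. by rewrite mulrDl mulrA. Qed.

Lemma adT_lin c X Y : zfin X -> zfin Y ->
  adT (fun M => c * X M + Y M) = fun M => c * adT X M + adT Y M.
Proof.
move=> zX zY; have [s [us zs Xs Ys]] := zfin2 zX zY; apply/funext => M.
rewrite !(adT_sum us) //; last by move=> A /lin_neq0[/Xs|/Ys].
by rewrite mulr_sumr -big_split; apply: eq_bigr => A _; exact: mul_lin_distr.
Qed.

Lemma off_listP M t : zmonom v M -> t \in off_list v xi M ->
  exists w nu w', [/\ inr w \in M.2, qstep v nu w w',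
    t.2 = (nu + M.1, ([mset inr w'] `+` (M.2 `\ inr w))%mset) & exists2 q,
      nu = q.1 /\ q.2 = [mset inr w']%mset & t.1 = (sgz w.2)%:~R * Qfield v xi w q].
Proof.
move=> zM; rewrite off_list.unlock => /flattenP[l /mapP[x xM ->]] /mapP[q].
have [w xw _] := zM _ xM; rewrite xw in xM *.
rewrite Qdir.unlock => /mapP[q' q'Q ->] ->.
have [e q'0 [w' e2 st]] := Qlist_step q'Q.
exists w, q'.2.1, w'; split=> //; first by rewrite /monom_mul /remove_var /= e2.
by exists q'.2; [|rewrite /= e].
Qed.

Lemma off_list_zmonom M t : zmonom v M -> t \in off_list v xi M -> zmonom v t.2.
Proof.
move=> zM /(off_listP zM)[w [nu [w' [wM st -> _]]]] x /=.
rewrite in_msetD in_mset1 => /orP[/eqP->|].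
  by exists w' => //; exact: qstep_Sc st.
by rewrite in_msetB1 => /andP[_ /zM].
Qed.

Lemma op_list_zmonom M t : zmonom v M -> t \in op_list v xi M -> zmonom v t.2.
Proof. by move=> zM; rewrite inE => /orP[/eqP->//|]; exact: off_list_zmonom. Qed.

Definition op_lc (X : hseries R m n) (s : seq (monom m n)) : seq (R[i] * monom m n) :=
  flatten [seq [seq (X A * t.1, t.2) | t <- op_list v xi A] | A <- s].

Lemma adT_lc (s : seq (monom m n)) X : uniq s -> (forall M, M \in s -> zmonom v M) ->
  (forall M, X M != 0 -> M \in s) -> adT X = lc (op_lc X s).
Proof.
move=> us zs Xs; apply/funext => M; rewrite (adT_sum us) // lcE big_flatten big_map.
by apply: eq_bigr => A _; rewrite big_map lcE mulr_sumr.
Qed.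

Lemma zfin_adT X : zfin X -> zfin (adT X).
Proof.
move=> [s [us zs Xs]]; rewrite (adT_lc us) //.
exists (undup [seq p.2 | p <- op_lc X s]); split.
- exact: undup_uniq.
- move=> M; rewrite mem_undup => /mapP[p /flattenP[l /mapP[A As ->]] /mapP[t tA ->] ->] /=.
  exact: op_list_zmonom (zs _ As) tA.
- by move=> M; rewrite mem_undup; exact: lc_supp.
Qed.

Definition shift_list r B : seq (R[i] * monom m n) := [seq (p.1, monom_mul p.2 B) | p <- r].

Lemma remove_varM A B (x : var m n) : x \in A.2 ->
  remove_var (monom_mul A B) x = monom_mul (remove_var A x) B.
Proof.
move=> xA; rewrite /remove_var /monom_mul /=; congr pair.
by rewrite -{1}(msetB1K xA) -msetDA msetD1K.
Qed.

Lemma diagM A B : diag v xi (monom_mul A B) = diag v xi A + diag v xi B.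
Proof.
rewrite diag.unlock /= sum_msetD addrACA; congr (_ + _).
by rewrite -big_split; apply: eq_bigr => i _; rewrite mxE rmorphD mulrDr.
Qed.

Lemma if_addr4 (b : bool) (x y z u : R[i]) :
  (if b then x + y else 0) + (z + u) = ((if b then x else 0) + z) + ((if b then y else 0) + u).
Proof. by case: b; [rewrite addrACA|rewrite !add0r]. Qed.

Lemma off_sumM A B M0 (x : var m n) r : x \in A.2 ->
  \sum_(t <- r | M0 == monom_mul t.2 (remove_var (monom_mul A B) x)) t.1 =
  \sum_(t <- r | M0 == monom_mul (monom_mul t.2 (remove_var A x)) B) t.1.
Proof. by move=> xA; apply: eq_bigl => t; rewrite (remove_varM B xA) monom_mulA. Qed.

(** The variables of a product are those of A together with those of B, and removing one from the
    product removes it from a single factor; [diag] is additive by [diagM]. *)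
Lemma op_listM A B M0 : lc (op_list v xi (monom_mul A B)) M0 =
  lc (shift_list (op_list v xi A) B) M0 + lc (shift_list (op_list v xi B) A) M0.
Proof.
rewrite /op_list /shift_list !map_cons !lc_cons /= diagM rmorphD lc_off sum_msetD.
rewrite (monom_mulC B A) if_addr4; congr ((_ + _) + (_ + _)).
- rewrite lcE big_map off_list.unlock big_flatten big_map; apply: eq_big_seq => x xA.
  by rewrite big_map; exact: off_sumM.
- rewrite lcE big_map off_list.unlock big_flatten big_map; apply: eq_big_seq => x xB.
  by rewrite big_map (monom_mulC A B); exact: off_sumM.
Qed.

Lemma hmulC X Y : zfin X -> zfin Y -> hmul X Y = hmul Y X.
Proof.
move=> [s [us _ /(lc_values us) ->]] [s' [us' _ /(lc_values us') ->]].
rewrite !hmul_lc; apply/funext => M; rewrite sum_lc_mul lc_mulE.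
apply: eq_bigr => p _; rewrite mulr_sumr; apply: eq_big => q; last by rewrite mulrC.
by rewrite monom_mulC.
Qed.

Lemma zmonomM A B : zmonom v A -> zmonom v B -> zmonom v (monom_mul A B).
Proof. by move=> zA zB x; rewrite in_msetD => /orP[/zA|/zB]. Qed.

Lemma hmul_supp X Y M : hmul X Y M != 0 -> exists A B, [/\ X A != 0, Y B != 0 & M = monom_mul A B].
Proof.
apply: contra_neqP => h; rewrite /hmul fsbig1 // => -[A B] /= e.
apply/eqP; rewrite -[_ == 0]negbK mulf_eq0 negb_or; apply/negP => /andP[XA YB].
by apply: h; exists A, B.
Qed.

Lemma zfin_hmul X Y : zfin X -> zfin Y -> zfin (hmul X Y).
Proof.
move=> [s [us zs Xs]] [s' [us' zs' Ys]].
exists (undup [seq monom_mul A B | A <- s, B <- s']); split; first exact: undup_uniq.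
  move=> M; rewrite mem_undup => /allpairsP[[A B] [/= As Bs ->]].
  by apply: zmonomM; [exact: zs|exact: zs'].
move=> M /hmul_supp[A [B [/Xs As /Ys Bs ->]]].
by rewrite mem_undup; exact: allpairs_f.
Qed.

Lemma hmul_adT (s s' : seq (monom m n)) X Y M0 : uniq s -> uniq s' ->
  (forall M, M \in s -> zmonom v M) ->
  (forall M, X M != 0 -> M \in s) -> (forall M, Y M != 0 -> M \in s') ->
  hmul (adT X) Y M0 =
  \sum_(A <- s) \sum_(B <- s') X A * Y B * lc (shift_list (op_list v xi A) B) M0.
Proof.
move=> us us' zs Xs Ys; rewrite (adT_lc us) // {1}(lc_values us' Ys) hmul_lc lc_mulE.
rewrite big_flatten big_map; apply: eq_bigr => A _; rewrite big_map.
rewrite (eq_bigr (fun t => \sum_(B <- s' | M0 == monom_mul t.2 B) X A * Y B * t.1)); last first.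
  by move=> t _; rewrite big_map; apply: eq_bigr => B _; rewrite mulrAC.
rewrite (exchange_big_dep predT) //; apply: eq_bigr => B _.
by rewrite lcE /shift_list big_map mulr_sumr; apply: eq_bigl.
Qed.

Lemma adT_hmul X Y : zfin X -> zfin Y ->
  adT (hmul X Y) = fun M => hmul (adT X) Y M + hmul X (adT Y) M.
Proof.
move=> zX zY; apply/funext => M0.
rewrite (hmulC zX (zfin_adT zY)).
have [s [us zs Xs]] := zX; have [s' [us' zs' Ys]] := zY.
rewrite (hmul_adT M0 us us') // (hmul_adT M0 us' us) // [X in _ + X]exchange_big -big_split.
rewrite {1}/adT {1}(lc_values us Xs) {1}(lc_values us' Ys) hmul_lc adN_lc; last first.
  move=> p /allpairsP[[q q'] [/mapP[A As ->] /mapP[B Bs ->] ->]] /=.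
  by apply: zmonomM; [exact: zs|exact: zs'].
rewrite mulr_sumr /lc_mul big_allpairs_dep big_map; apply: eq_big_seq => A As.
rewrite big_map -big_split; apply: eq_big_seq => B Bs /=.
rewrite adN_list_op; last by apply: zmonomM; [exact: zs|exact: zs'].
by rewrite opp_i_mulA op_listM mulrDr (mulrC (Y B)).
Qed.

End Op.

(** * Blocks *)

Section Vertices.
Context (R : realType) (m n : nat) (v : 'M[int]_(m, n)).
Implicit Types (u : vertex m) (nu d : 'rV[int]_m) (xi : 'I_m -> R).
Local Notation nc := Normc.normc.

Definition zvar u : 'rV[int]_n * bool := (site v u, u.2).

(** A vertex stores its frequency up to the sign given by its second component; [vtx] rebuilds it
    from the true frequency. *)
Definition vtx nu (b : bool) : vertex m := (sgz b *: nu, b).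

Lemma sgzK (k : nat) (b : bool) (x : 'rV[int]_k) : sgz b *: (sgz b *: x) = x.
Proof. by case: b; rewrite /sgz ?scale1r // !scaleN1r opprK. Qed.

Lemma xfreqE u : xfreq u = sgz u.2 *: u.1.
Proof. by rewrite /xfreq /sgz; case: u.2; rewrite ?scale1r ?scaleN1r. Qed.

Lemma xfreq_vtx nu b : xfreq (vtx nu b) = nu.
Proof. by rewrite xfreqE /= sgzK. Qed.

Lemma vtx_xfreq u : vtx (xfreq u) u.2 = u.
Proof. by rewrite /vtx xfreqE sgzK; case: u. Qed.

Lemma eltE u : elt v u = (xfreq u, [mset inr (zvar u)]%mset).
Proof. by rewrite /elt /monom_mul /ex /vz /= addr0 mset0D. Qed.

Lemma mset1_inj (T : choiceType) (a b : T) : [mset a]%mset = [mset b]%mset -> a = b.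
Proof.
move=> /(congr1 (fun Z : {mset T}%mset => a \in Z)) /=.
by rewrite !in_mset1 eqxx => /esym/eqP.
Qed.

Lemma elt_inj : injective (elt v).
Proof.
move=> u u'; rewrite !eltE => -[xx /mset1_inj[_ e2]].
by rewrite -(vtx_xfreq u) -(vtx_xfreq u') xx e2.
Qed.

Lemma zmonom_elt u : basis01 v u -> zmonom v (elt v u).
Proof.
by move=> [Su _] x; rewrite eltE /= in_mset1 => /eqP->; exists (zvar u).
Qed.

Lemma momentumZ (b : bool) nu : momentum v (sgz b *: nu) = sgz b *: momentum v nu.
Proof. by case: b; rewrite /sgz ?scale1r // !scaleN1r momentumN. Qed.

Lemma massZ (b : bool) nu : mass (sgz b *: nu) = sgz b * mass nu.
Proof. by case: b; rewrite /sgz ?scale1r ?mul1r // scaleN1r massN mulN1r. Qed.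

Lemma site_xfreq u : sgz u.2 *: site v u = - momentum v (xfreq u).
Proof. by rewrite /site xfreqE momentumZ scalerN. Qed.

Lemma basis01E u : basis01 v u <-> Sc v (site v u) /\ odd (absz (mass (xfreq u))).
Proof.
rewrite /basis01 /= -/(mass u.1) xfreqE massZ abszM.
by case: u.2; rewrite /sgz /= mul1n.
Qed.

(** Zero momentum leaves no choice for the site at the new frequency, and the momentum relation of
    the step says that it is the site of w'. Conservation of mass keeps the mass odd. *)
Lemma qstep_vtx nu u w' : basis01 v u -> qstep v nu (zvar u) w' ->
  exists u', [/\ basis01 v u', zvar u' = w' & xfreq u' = nu + xfreq u].
Proof.
case: w' => h b /basis01E[Su ou] [/= Sh fr mom mas _ _].
pose u' := vtx (nu + xfreq u) b.
have su' : site v u' = h.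
  have := site_xfreq u'; rewrite xfreq_vtx momentumD /= => e.
  rewrite -[LHS](sgzK b) e opprD -site_xfreq -mom /=.
  by rewrite addKr sgzK.
exists u'; rewrite /zvar su' xfreq_vtx; split=> //; apply/basis01E; rewrite su' xfreq_vtx; split=> //.
move: ou mas; rewrite massD /sgz; case: b {u' su' mom}; case: u.2; lia.
Qed.

Lemma sum_mset1 (V : nmodType) (T : choiceType) (a : T) (F : T -> V) :
  \sum_(x <- [mset a]%mset) F x = F a.
Proof. by rewrite enum_msetn big_seq1. Qed.

Lemma mset1B (T : choiceType) (a : T) : ([mset a] `\ a)%mset = mset0.
Proof. by rewrite -[X in (X `\ a)%mset]msetD0 msetD1K. Qed.

Lemma off_elt xi u t : basis01 v u -> t \in off_list v xi (elt v u) ->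
  exists u', [/\ basis01 v u', t.2 = elt v u',
    qstep v (xfreq u' - xfreq u) (zvar u) (zvar u') &
    t.1 = (sgz u.2)%:~R * Qfield v xi (zvar u) (xfreq u' - xfreq u, [mset inr (zvar u')]%mset)].
Proof.
move=> bu /(off_listP (zmonom_elt bu))[w [nu [w' []]]].
rewrite eltE /= in_mset1 => /eqP[->] st -> [q [nuq q2] ->].
have [u' [bu' zu' fu']] := qstep_vtx bu st.
have q1 : nu = xfreq u' - xfreq u by rewrite fu' addrK.
exists u'; rewrite -q1 zu'; split=> //.
  by rewrite eltE zu' fu' /= mset1B msetD0.
by rewrite nuq -q2 -surjective_pairing.
Qed.

(** The entry sees the frequencies only through their difference, whence the invariance of edges
    under shifts. *)
Lemma lc_off_elt xi u u' : lc (off_list v xi (elt v u)) (elt v u') =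
  (sgz u.2)%:~R * Qfield v xi (zvar u) (xfreq u' - xfreq u, [mset inr (zvar u')]%mset).
Proof.
rewrite lc_off [in X in \sum_(x <- X) _]eltE sum_mset1 Qdir.unlock big_map.
rewrite Qfield_lc lcE mulr_sumr; apply: eq_bigl => t /=.
rewrite eltE /monom_mul /remove_var eltE /= mset1B msetD0.
by case: t => c [a b] /=; rewrite !xpair_eqE subr_eq.
Qed.

Lemma op_list_mono xi M : zmonom v M -> adT v xi (mono R M) = lc (op_list v xi M).
Proof.
move=> zM; apply/funext => M0.
rewrite (@adT_sum _ _ _ _ _ [:: M]) //; last 2 first.
- by move=> A; rewrite inE => /eqP->.
- by move=> A /mono_neq0->; rewrite mem_head.
rewrite big_seq1 /mono eqxx; exact: mul1r.
Qed.

Lemma adN_neq0 xi X M : (adN v xi X M != 0) = (adT v xi X M != 0).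
Proof.
have i0 : ('i%C : R[i]) != 0 by rewrite eq_complex /= oner_eq0 andbF.
by rewrite /adT mulf_eq0 oppr_eq0 (negPf i0).
Qed.

Lemma edge_qstep u u' : edge R v u u' ->
  [/\ basis01 v u, basis01 v u' & qstep v (xfreq u' - xfreq u) (zvar u) (zvar u')].
Proof.
move=> [bu bu' uu' [xi _]]; rewrite adN_neq0 op_list_mono; last exact: zmonom_elt.
move=> /lc_supp; rewrite inE => /orP[/eqP/elt_inj uu|].
  by case: uu'.
move=> /mapP[t /(off_elt bu)[u1 [_ -> st _]] /elt_inj e].
by split=> //; rewrite e.
Qed.

Lemma off_edge xi u u' : positive xi -> basis01 v u -> basis01 v u' -> u <> u' ->
  lc (off_list v xi (elt v u)) (elt v u') != 0 -> edge R v u u'.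
Proof.
move=> pxi bu bu' uu' h; split=> //; exists xi => //.
rewrite adN_neq0 op_list_mono; last exact: zmonom_elt.
rewrite /op_list lc_cons; case: (elt v u' =P elt v u) => [/elt_inj uu|_]; first by case: uu'.
by rewrite add0r.
Qed.

End Vertices.

(** A path can be shortened until it repeats no vertex; its length is then at most the size of any
    list containing the component. *)
Lemma clos_rst_path_bound (R : realType) (T : eqType) (e : T -> T -> Prop) (f : T -> R) (c : R)
    (s : seq T) x : 0 <= c -> (forall a b, e a b -> `|f a - f b| <= c) ->
  (forall y, clos_refl_sym_trans T e x y -> y \in s) ->
  forall y, clos_refl_sym_trans T e x y -> `|f x - f y| <= (size s)%:R * c.
Proof.
move=> c0 fe xs y xy.
pose r := [rel a b | `[< e a b \/ e b a >]].
have [p xp ey] : exists2 p, path r x p & y = last x p.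
  have := clos_rst_rstn1 _ _ _ _ xy; elim=> [|z z' zz' _ [p xp ez]]; first by exists [::].
  exists (rcons p z'); last by rewrite last_rcons.
  by rewrite rcons_path xp -ez; apply/asboolP.
have conn z q : path r z q -> forall a, a \in z :: q -> clos_refl_sym_trans T e z a.
  elim: q z => [|b q IH] z /= => [_ a|/andP[zb bq] a].
    by rewrite inE => /eqP->; exact: rst_refl.
  rewrite inE => /orP[/eqP->|aq]; first exact: rst_refl.
  apply: rst_trans (IH _ bq _ aq); case/asboolP: zb => h; first exact: rst_step.
  by apply: rst_sym; exact: rst_step.
have le z q : path r z q -> `|f z - f (last z q)| <= (size q)%:R * c.
  elim: q z => [|b q IH] z /=; first by rewrite subrr normr0 mul0r.
  move=> /andP[/asboolP zb /IH h]; rewrite -(subrKA (f b)) -natr1 mulrDl mul1r addrC.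
  apply: le_trans (ler_normD _ _) _; rewrite lerD //.
  by case: zb => [/fe|/fe] //; rewrite distrC.
case/shortenP: xp ey => q xq uq _ ->.
apply: le_trans (le _ _ xq) _; rewrite ler_wpM2r // ler_nat.
apply: leq_trans (uniq_leq_size (s2 := s) uq _) => [|a aq]; first exact: leqnSn.
by apply: xs; exact: conn aq.
Qed.

Section Blocks.
Context (R : realType) (m n : nat) (v : 'M[int]_(m, n)).
Implicit Types (u : vertex m) (nu d : 'rV[int]_m) (xi : 'I_m -> R).
Local Notation nc := Normc.normc.

Lemma block_refl u : block R v u u.
Proof. exact: rst_refl. Qed.

Lemma block_sym u u' : block R v u u' -> block R v u' u.
Proof. exact: rst_sym. Qed.

Lemma block_trans u u' u'' : block R v u u' -> block R v u' u'' -> block R v u u''.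
Proof. exact: rst_trans. Qed.

Lemma block_basis01 u u' : block R v u u' -> basis01 v u -> basis01 v u'.
Proof.
suff : block R v u u' -> (basis01 v u <-> basis01 v u') by move=> h /h[].
elim=> {u u'} [u u' /edge_qstep[bu bu' _]|u|u u' _ h|u u' u'' _ h1 _ h2]; tauto.
Qed.

Lemma block_eq u u' : block R v u u' -> block R v u = block R v u'.
Proof.
by move=> uu'; apply/seteqP; split=> x h; [exact: block_trans (block_sym uu') h|exact: block_trans h].
Qed.

Lemma block_site u u' : block R v u u' -> clos_refl_sym_trans _ (site_adj v) (site v u) (site v u').
Proof.
elim=> [x y /edge_qstep[_ _ st]|x|x y _|x y z _ h1 _].
- by apply: rst_step; exact: qstep_site st.
- exact: rst_refl.
- exact: rst_sym.
- exact: rst_trans h1.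
Qed.

(* [fset_set] of an infinite set is empty, so that infinite blocks have size 0 and no eigenvalue. *)
Lemma block_size_gt0 u : (0 < block_size R v u)%N -> finite_set (block R v u).
Proof.
rewrite /block_size /fset_set; by case: pselect => // _; rewrite cardfs0.
Qed.

Lemma mem_block u u' : finite_set (block R v u) -> (u' \in fset_set (block R v u)) = (u' \in block R v u).
Proof. by move=> fu; rewrite in_fset_set. Qed.

Section Translate.
Context (d : 'rV[int]_m) (d0 : momentum v d = 0) (dm : ~~ odd (absz (mass d))).

Definition translate u : vertex m := vtx (xfreq u + d) u.2.

Lemma translate_site u : site v (translate u) = site v u.
Proof.
have e := site_xfreq v (translate u); rewrite xfreq_vtx momentumD d0 addr0 -site_xfreq in e.
exact: (can_inj (sgzK u.2)) e.
Qed.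

Lemma translate_zvar u : zvar v (translate u) = zvar v u.
Proof. by rewrite /zvar translate_site. Qed.

Lemma translate_edge u u' : edge R v u u' -> edge R v (translate u) (translate u').
Proof.
move=> E; have [bu bu' _] := edge_qstep E; case: E => _ _ uu' [xi pxi].
have bT x : basis01 v x -> basis01 v (translate x).
  move=> /basis01E[h1 h2]; apply/basis01E; rewrite translate_site xfreq_vtx massD; split=> //.
  by move: dm h2; lia.
rewrite adN_neq0 op_list_mono; last exact: zmonom_elt.
rewrite /op_list lc_cons; case: (elt v u' =P elt v u) => [/elt_inj uu|_]; first by case: uu'.
rewrite add0r lc_off_elt => h.
apply: (off_edge pxi); [exact: bT|exact: bT| |].
  move=> e; apply: uu'; rewrite -(vtx_xfreq u) -(vtx_xfreq u').
  by have := congr1 snd e; have /(congr1 (@xfreq m)) := e; rewrite !xfreq_vtx /= => /addIr-> ->.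
by rewrite lc_off_elt !translate_zvar !xfreq_vtx opprD addrACA subrr addr0.
Qed.

Lemma translate_block u u' : block R v u u' -> block R v (translate u) (translate u').
Proof.
elim=> [x y /translate_edge|x|x y _|x y z _ h1 _].
- exact: rst_step.
- exact: rst_refl.
- exact: rst_sym.
- exact: rst_trans h1.
Qed.

(* The edges do not see a shift of the frequencies by d, so a block that meets its translate
   contains all its translates. *)
Lemma finite_block_translate u : finite_set (block R v u) -> block R v u (translate u) -> d = 0.
Proof.
move=> fu uT; apply: contrapT => /eqP dn0.
have bk k : block R v u (iter k translate u).
  elim: k => [|k IH]; first exact: block_refl.
  apply: block_trans uT _.
  by rewrite iterS; exact: translate_block.
have fk k : xfreq (iter k translate u) = xfreq u + d *+ k.
  elim: k => [|k IH]; first by rewrite mulr0n addr0.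
  by rewrite iterS xfreq_vtx IH mulrSr addrA.
have [i di] : exists i, d 0 i != 0.
  apply: contrapT => h; move/eqP: dn0; apply; apply/rowP => i; rewrite mxE.
  by apply: contrapT => /eqP hi; apply: h; exists i.
have inj : injective (fun k => iter k translate u).
  move=> k l /(congr1 (@xfreq m)); rewrite !fk => /addrI /(congr1 (fun M : 'rV_m => M 0 i)).
  rewrite /= !mulmxnE -(mulr_natr _ k) -(mulr_natr _ l) => /(mulfI di) /eqP.
  by rewrite eqr_nat => /eqP.
have := @infinite_nat; apply.
apply: (@sub_finite_set _ _ ((fun k => iter k translate u) @^-1` block R v u)); first by move=> k _ /=.
by apply: finite_preimage => // k l _ _; exact: inj.
Qed.

End Translate.

Lemma finite_block_zvar_inj u u1 u2 : finite_set (block R v u) -> basis01 v u ->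
  block R v u u1 -> block R v u u2 -> zvar v u1 = zvar v u2 -> u1 = u2.
Proof.
move=> fu bu b1 b2 [es e2].
have /basis01E[_ o1] := block_basis01 b1 bu; have /basis01E[_ o2] := block_basis01 b2 bu.
pose d := xfreq u2 - xfreq u1.
have d0 : momentum v d = 0.
  have s1 := site_xfreq v u1; have s2 := site_xfreq v u2.
  by rewrite momentumD momentumN -s1 es e2 s2 addrN.
have dm : ~~ odd (absz (mass d)) by move: o1 o2; rewrite massD massN; lia.
have tu : translate d u1 = u2 by rewrite /translate addrC subrK e2 vtx_xfreq.
have : d = 0.
  apply: (finite_block_translate d0 dm (u := u1)); first by rewrite -(block_eq b1).
  by rewrite tu; exact: block_trans (block_sym b1) b2.
move/eqP; rewrite subr_eq0 => /eqP x12.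
by rewrite -(vtx_xfreq u1) -(vtx_xfreq u2) x12 e2.
Qed.

Lemma block_size_bounded : exists B : nat, forall u, basis01 v u -> (block_size R v u <= B)%N.
Proof.
have [B0 hB0] := site_component_bounded v.
have /finite_seqP[Z hZ] := finite_nrm_ball n B0.
pose L := [seq (z, b) | z <- Z, b <- [:: true; false]].
exists (size L) => u bu.
case: (posnP (block_size R v u)) => [->//|/block_size_gt0 fu].
(* Sites are recentred at the site of u, so that one finite ball serves all blocks; sign and
   recentred site determine the vertex. *)
pose g u' := (site v u - site v u', u'.2).
rewrite /block_size -(size_map g); apply: uniq_leq_size.
  rewrite map_inj_in_uniq ?fset_uniq // => u1 u2.
  rewrite !mem_block // !inE => b1 b2 [/addrI/oppr_inj e1 e2].
  by apply: (finite_block_zvar_inj fu bu b1 b2); rewrite /zvar e1 e2.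
move=> z /mapP[u']; rewrite mem_block // inE => /block_site/hB0 hz ->.
apply: allpairs_f; last by case: (u'.2).
by have : [set` Z] (site v u - site v u') by rewrite -hZ.
Qed.

End Blocks.

(** * Eigenvalues of a block *)

Section BlockSpectrum.
Context (R : realType) (m n : nat) (v : 'M[int]_(m, n)) (xi : 'I_m -> R) (rho : R).
Hypotheses (xipos : positive xi) (xile : forall i, xi i <= rho) (rho0 : 0 <= rho).
Implicit Types (u : vertex m) (nu d : 'rV[int]_m).
Local Notation nc := Normc.normc.

Lemma xi_bounds i : 0 <= xi i <= rho.
Proof. by rewrite ltW //= xile. Qed.

(** This form isolates the conserved energy and mass; along a block only the term - 2 xi.nu
    varies. *)
Lemma diag_elt u : diag v xi (elt v u) =
  (energy v (xfreq u) + sgz u.2 * normsq (site v u))%:~R - 2 * \sum_i xi i * (xfreq u 0 i)%:~R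
  + 4 * (\sum_j xi j) * (mass (xfreq u) + sgz u.2)%:~R.
Proof.
rewrite diag.unlock eltE sum_mset1 /= /Omega /energy /mass !rmorphD !rmorphM !rmorph_sum /=.
have -> : \sum_i omega v xi i * (xfreq u 0 i)%:~R =
    \sum_i (xfreq u 0 i * normsq (row i v))%:~R - 2 * (\sum_i xi i * (xfreq u 0 i)%:~R)
    + (4 * \sum_j xi j) * \sum_i (xfreq u 0 i)%:~R.
  rewrite /omega; move: (\sum_j xi j) => S.
  rewrite !mulr_sumr -sumrB -big_split /=; apply: eq_bigr => i _; rewrite rmorphM /=; ring.
ring.
Qed.

(** The frequency changes by a vector of l^1 norm at most 2, so 2 xi.nu changes by at most 2 * 2 *
    rho. *)
Lemma diag_qstep u u' : qstep v (xfreq u' - xfreq u) (zvar v u) (zvar v u') ->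
  `|diag v xi (elt v u) - diag v xi (elt v u')| <= 4 * rho.
Proof.
move=> [_ fr _ /= mas en _].
have e1 : energy v (xfreq u') + sgz u'.2 * normsq (site v u') =
    energy v (xfreq u) + sgz u.2 * normsq (site v u).
  by move: en; rewrite energyD energyN /=; lia.
have e2 : mass (xfreq u') + sgz u'.2 = mass (xfreq u) + sgz u.2.
  by move: mas; rewrite massD massN; lia.
have sub (E E' M M' : int) (S b c : R) : E' = E -> M' = M ->
    E%:~R - 2 * b + S * M%:~R - (E'%:~R - 2 * c + S * M'%:~R) = 2 * (c - b).
  by move=> -> ->; ring.
rewrite (etrans (congr2 (fun a b => a - b) (diag_elt u) (diag_elt u')) (sub _ _ _ _ _ _ _ e1 e2)).
rewrite -sumrB normrM ger0_norm //.
have -> : 4 * rho = 2 * (rho * 2) by ring.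
rewrite ler_pM2l //.
have le2 : \sum_i rho * (absz ((xfreq u' - xfreq u)%R 0%R i))%:R <= rho * 2 :> R.
  rewrite -mulr_sumr -natr_sum ler_wpM2l // ler_nat.
  exact: nrm_freqs fr.
apply: le_trans (ler_norm_sum _ _ _) (le_trans _ le2).
apply: ler_sum => i _; rewrite -mulrBr normrM.
have /andP[x0 x1] := xi_bounds i; rewrite ger0_norm //; apply: ler_pM => //.
by rewrite -rmorphB /= !mxE -intr_norm natr_absz.
Qed.

Lemma diag_block u u' : finite_set (block R v u) -> block R v u u' ->
  `|diag v xi (elt v u) - diag v xi (elt v u')| <= (block_size R v u)%:R * (4 * rho).
Proof.
move=> fu; apply: (clos_rst_path_bound (f := fun u => diag v xi (elt v u))).
- by rewrite mulr_ge0.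
- by move=> x y /edge_qstep[_ _]; exact: diag_qstep.
- by move=> y xy; rewrite mem_block // inE.
Qed.

Definition block_elts u : seq (monom m n) := [seq elt v u' | u' <- fset_set (block R v u)].

Lemma block_elts_uniq u : uniq (block_elts u).
Proof. by rewrite map_inj_uniq; [exact: fset_uniq|exact: elt_inj]. Qed.

Lemma block_eltsP u M : finite_set (block R v u) ->
  reflect (exists2 u', block R v u u' & M = elt v u') (M \in block_elts u).
Proof.
move=> fu; apply: (iffP mapP) => -[u' h ->]; exists u' => //; move: h; rewrite mem_block //.
  by rewrite inE.
by move=> h; rewrite inE.
Qed.

Lemma block_elts_zmonom u M : finite_set (block R v u) -> basis01 v u -> M \in block_elts u ->
  zmonom v M.
Proof.
by move=> fu bu /(block_eltsP _ fu)[u' uu' ->]; apply: zmonom_elt; exact: block_basis01 uu' bu.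
Qed.

Lemma block_supported_mem u (X : hseries R m n) M : finite_set (block R v u) ->
  block_supported v u X -> X M != 0 -> M \in block_elts u.
Proof. by move=> fu bX /bX h; apply/block_eltsP. Qed.

Lemma block_supported_zfin u (X : hseries R m n) : finite_set (block R v u) -> basis01 v u ->
  block_supported v u X -> zfin v X.
Proof.
move=> fu bu bX; exists (block_elts u); split.
- exact: block_elts_uniq.
- by move=> M; exact: block_elts_zmonom.
- by move=> M; exact: block_supported_mem.
Qed.

Lemma op_elt_supp u M : basis01 v u -> lc (op_list v xi (elt v u)) M != 0 ->
  exists2 u', block R v u u' & M = elt v u'.
Proof.
move=> bu; rewrite /op_list lc_cons => /addr_neq0[|h].
  case: (M =P elt v u) => [-> _|_]; first by exists u => //; exact: block_refl.
  by rewrite eqxx.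
have /mapP[t /(off_elt bu)[u' [bu' e _ _]] M2] := lc_supp h.
exists u'; last by rewrite M2.
have [<-|/eqP uu'] := eqVneq u u'; first exact: block_refl.
by apply: rst_step; apply: (off_edge xipos) => //; rewrite -e -M2.
Qed.

Lemma sum_neq0 (T : eqType) (s : seq T) (F : T -> R[i]) : \sum_(x <- s) F x != 0 ->
  exists2 x, x \in s & F x != 0.
Proof.
apply: contra_neqP => h; rewrite big_seq big1 // => x xs.
by apply/eqP; apply: contrapT => /negP F0; apply: h; exists x.
Qed.

Lemma mul_neq0 (a b : R[i]) : a * b != 0 -> a != 0 /\ b != 0.
Proof. by rewrite mulf_eq0 negb_or => /andP. Qed.

Lemma block_supported_adT u (X : hseries R m n) : finite_set (block R v u) -> basis01 v u ->
  block_supported v u X -> block_supported v u (adT v xi X).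
Proof.
move=> fu bu bX M; rewrite (adT_sum _ (block_elts_uniq u)); last 2 first.
- by move=> A; exact: block_elts_zmonom.
- by move=> A; exact: block_supported_mem.
move=> /sum_neq0[A Au /mul_neq0[_]].
have /(block_eltsP _ fu)[u1 uu1 ->] := Au.
move=> /(op_elt_supp (block_basis01 uu1 bu))[u2 u12 ->].
by exists u2 => //; exact: block_trans u12.
Qed.

Lemma seq_max (T : eqType) (s : seq T) (f : T -> R) : s != [::] ->
  exists2 x, x \in s & forall y, y \in s -> f y <= f x.
Proof.
elim: s => [//|a s IH] _; have [->|/IH[x xs hx]] := eqVneq s [::].
  by exists a; rewrite ?mem_head // => y; rewrite inE => /eqP->.
have [ax|xa] := leP (f a) (f x).
  by exists x; rewrite ?inE ?xs ?orbT // => y; rewrite inE => /orP[/eqP->|/hx].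
exists a; rewrite ?mem_head // => y; rewrite inE => /orP[/eqP->//|/hx h].
exact: le_trans h (ltW xa).
Qed.

Definition off_bound : R := 2 * (hamQ_bound R m * rho).

Lemma off_bound_ge0 : 0 <= off_bound.
Proof. by rewrite !mulr_ge0 // ler0n. Qed.

Lemma off_elt_le u u' : nc (lc (off_list v xi (elt v u)) (elt v u')) <= off_bound.
Proof.
rewrite lc_off_elt -[leRHS]mul1r; apply: normcM_le; last exact: Qfield_le xi_bounds rho0.
by case: u.2; rewrite /sgz ?mulr1z ?mulrN1z ?normcN Normc.normc1.
Qed.

Lemma mulr_if_add (b : bool) (x y z : R[i]) :
  x * ((if b then y else 0) + z) = (if b then x * y else 0) + x * z.
Proof. by rewrite mulrDr; case: b; rewrite ?mulr0. Qed.

Lemma diag_eq (x y z s : R[i]) : x * y + s = z * x -> (y - z) * x = - s.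
Proof. by move=> e; rewrite mulrBl -e mulrC opprD addrA subrr add0r. Qed.

Lemma diag_gershgorin u (X : hseries R m n) (lam : R[i]) : finite_set (block R v u) ->
  basis01 v u -> block_supported v u X -> (exists M, X M != 0) ->
  (forall M, adT v xi X M = lam * X M) ->
  exists2 u', block R v u u' &
    nc ((diag v xi (elt v u'))%:C%C - lam) <= (block_size R v u)%:R * off_bound.
Proof.
move=> fu bu bX [M0 X0] eig.
have s0 : block_elts u != [::].
  by apply/eqP => e; have := block_supported_mem fu bX X0; rewrite e.
(* Gershgorin's argument: the eigenvalue equation is read at a monomial where the coefficient of X
   is largest. *)
have [M1 M1s hM] := seq_max (fun M => nc (X M)) s0.
have /(block_eltsP _ fu)[u1 uu1 e1] := M1s.
exists u1 => //.
have X1 : 0 < nc (X M1).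
  rewrite lt_neqAle normc_ge0 andbT eq_sym; apply: (contra_neq _ X0) => X10.
  apply: Normc.eq0_normc; apply/eqP; rewrite eq_le normc_ge0 andbT -X10.
  by apply: hM; exact: block_supported_mem X0.
have := eig M1; rewrite (adT_sum _ (block_elts_uniq u)); last 2 first.
- by move=> A; exact: block_elts_zmonom.
- by move=> A; exact: block_supported_mem.
have split1 A : X A * lc (op_list v xi A) M1 =
    (if M1 == A then X A * (diag v xi A)%:C%C else 0) + X A * lc (off_list v xi A) M1.
  by rewrite /op_list lc_cons; exact: mulr_if_add.
have sumD : \sum_(A <- block_elts u) (if M1 == A then X A * (diag v xi A)%:C%C else 0)
    = X M1 * (diag v xi M1)%:C%C.
  rewrite (bigD1_seq M1) ?block_elts_uniq //= eqxx big1 ?addr0 // => A.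
  by rewrite eq_sym => /negPf->.
rewrite (eq_bigr _ (fun A _ => split1 A)) big_split sumD => /diag_eq e.
rewrite -e1 -(ler_pM2r X1) -Normc.normcM e normcN.
apply: le_trans (normc_le_sum _ _ _) _.
apply: (@le_trans _ _ (\sum_(A <- block_elts u) nc (X M1) * off_bound)).
  rewrite big_seq [leRHS]big_seq; apply: ler_sum => A Au; rewrite e1.
  have /(block_eltsP _ fu)[u2 _ eA] := Au.
  by apply: normcM_le; [rewrite -e1; exact: hM|rewrite eA; exact: off_elt_le].
rewrite big_const_seq count_predT iter_addr addr0 /block_elts size_map -/(block_size R v u).
by rewrite -[X in X <= _]mulr_natl mulrA mulrAC.
Qed.

(** [eigenvalue] concerns row vectors, whereas the columns of [ad_block_mx] are the images of the
    basis elements. *)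
Lemma char_poly_tr (K : comNzRingType) (k : nat) (A : 'M[K]_k) : char_poly A^T = char_poly A.
Proof.
by rewrite /char_poly -[RHS]det_tr /char_poly_mx linearB /= tr_scalar_mx map_trmx.
Qed.

Lemma sum_pick (V : nmodType) (I : finType) (T : eqType) (e : I -> T) (a : I -> V) c :
  injective e -> \sum_c' (if e c == e c' then a c' else 0) = a c.
Proof.
move=> ie; rewrite (bigD1 c) //= eqxx big1 ?addr0 // => c' cc'.
by rewrite (inj_eq ie) eq_sym (negPf cc').
Qed.

Lemma block_eigenvector u (lam : R[i]) : finite_set (block R v u) -> basis01 v u ->
  root (char_poly (ad_block_mx v xi u)) lam ->
  exists X : hseries R m n, [/\ block_supported v u X, exists M, X M != 0 &
    forall M, adT v xi X M = lam * X M].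
Proof.
move=> fu bu; rewrite -char_poly_tr -eigenvalue_root_char => /eigenvalueP[a ea a0].
pose B : seq (vertex m) := fset_set (block R v u).
pose el (c : 'I_(block_size R v u)) := elt v (nth u B c).
have Bu (c : 'I_(block_size R v u)) : block R v u (nth u B c).
  by have := mem_nth u (ltn_ord c : (c < size B)%N); rewrite mem_block // inE.
have el_inj : injective el.
  move=> c c' /elt_inj/eqP.
  by rewrite (@nth_uniq _ u B c c' (ltn_ord c) (ltn_ord c') (fset_uniq _)) => /eqP/val_inj.
pose X : hseries R m n := fun M => \sum_c (if M == el c then a 0 c else 0).
have Xel c : X (el c) = a 0 c.
  exact: (sum_pick (fun c => a 0 c) c el_inj).
have bX : block_supported v u X.
  move=> M /sum_neq0[c _]; case: (M =P el c) => [-> _|_]; last by rewrite eqxx.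
  by exists (nth u B c).
exists X; split=> // [|M].
  apply: contrapT => h; move/eqP: a0; apply; apply/rowP => c; rewrite mxE -Xel.
  by apply/eqP; apply: contrapT => /negP Xc; apply: h; exists (el c).
have aT : adT v xi X M = \sum_c a 0 c * lc (op_list v xi (el c)) M.
  rewrite (adT_sum _ (block_elts_uniq u)); last 2 first.
  - by move=> A; exact: block_elts_zmonom.
  - by move=> A; exact: block_supported_mem.
  rewrite big_map (big_nth u) big_mkord; apply: eq_bigr => c _.
  by rewrite -(Xel c).
have [Mu|Mu] := boolP (M \in block_elts u); last first.
  have -> : X M = 0 by apply/eqP; apply: contraNT Mu; exact: block_supported_mem.
  rewrite mulr0; apply/eqP; apply: contraNT Mu; apply: block_supported_mem => //.
  exact: block_supported_adT.
have [b Mb] : exists b, M = el b.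
  have /mapP[u1 u1B ->] := Mu.
  have hb : (index u1 B < block_size R v u)%N by rewrite /block_size index_mem.
  by exists (Ordinal hb); rewrite /el nth_index.
rewrite aT Mb Xel.
have := congr1 (fun r : 'rV_(block_size R v u) => r 0 b) ea; rewrite !mxE => <-.
apply: eq_bigr => c _; rewrite !mxE; congr (_ * _).
rewrite -op_list_mono //; apply: zmonom_elt; exact: block_basis01 (Bu c) bu.
Qed.

End BlockSpectrum.

(** * Nilpotent part *)

(** Elements that are pairwise unrelated are chosen greedily. The choice stops after at most k of
    them, and when it stops every element is related to a chosen one. *)
Lemma inequivalent_cover (T : eqType) (E : T -> T -> Prop) (P : T -> Prop) (k : nat) (x0 : T) :
  (forall x y, E x y -> E y x) ->
  (forall w : 'I_k.+1 -> T, (forall i, P (w i)) -> exists i j, i != j /\ E (w i) (w j)) ->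
  exists s : seq T, [/\ (size s <= k)%N, forall y, y \in s -> P y &
    forall x, P x -> exists2 y, y \in s & E y x].
Proof.
move=> Es noind; pose r := [rel x y | ~~ `[< E x y >]].
have rs x y : r x y -> r y x by apply: contraNN => /asboolP/Es/asboolP.
suff [h|[s [ss Ps ps]]] : (exists s : seq T, [/\ (size s <= k)%N, forall y, y \in s -> P y &
    forall x, P x -> exists2 y, y \in s & E y x]) \/
    exists s : seq T, [/\ size s = k.+1, forall y, y \in s -> P y & pairwise r s].
- exact: h.
- exfalso; have [|i [j [ij Eij]]] := noind (fun i => nth x0 s i).
    by move=> i; apply: Ps; rewrite mem_nth // ss.
  have := @pairwiseP _ r x0 s; rewrite ps => /elimT/(_ isT) pw.
  have lts (l : 'I_k.+1) : nat_of_ord l \in gtn (size s) by rewrite inE ss.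
  have [lt|lt|/val_inj e] := ltngtP i j; last by rewrite e eqxx in ij.
    by have /negP := pw _ _ (lts i) (lts j) lt; apply; apply/asboolP.
  by have /negP := pw _ _ (lts j) (lts i) lt; apply; apply/asboolP; exact: Es.
have : (k.+1 <= k.+1)%N by [].
elim: {1 3}k.+1 => [|l IH] lk; first by right; exists [::].
have [h|[s [ss Ps ps]]] := IH (ltnW lk); first by left.
have [[x Px nx]|cov] := pselect (exists2 x, P x & forall y, y \in s -> ~ E y x).
  right; exists (x :: s); split=> //=; first by rewrite ss.
    by move=> y; rewrite inE => /orP[/eqP->|/Ps].
  rewrite ps andbT; apply/allP => y ys; apply: rs.
  by apply/negP => /asboolP; exact: nx.
left; exists s; split=> //; first by rewrite ss.
move=> x Px; apply: contrapT => h; apply: cov; exists x => // y ys Eyx.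
by apply: h; exists y.
Qed.

Section Operators.
Context (R : realType) (m n : nat) (v : 'M[int]_(m, n)) (xi : 'I_m -> R).
Implicit Types (lam : R[i]) (X Y : hseries R m n) (V : set (hseries R m n)).

(** The operator n of the decomposition - i ad(N) = lam + n. *)
Definition adT_sub lam X : hseries R m n := fun M => - lam * X M + adT v xi X M.

Lemma zfin0 : zfin v ((fun=> 0) : hseries R m n).
Proof. by exists [::]; split=> // M; rewrite eqxx. Qed.

Lemma zfin_adT_sub lam X : zfin v X -> zfin v (adT_sub lam X).
Proof. by move=> zX; apply: zfin_lin => //; exact: zfin_adT. Qed.

Lemma zfin_iter lam k X : zfin v X -> zfin v (iter k (adT_sub lam) X).
Proof. by move=> zX; elim: k => //= k; exact: zfin_adT_sub. Qed.

Lemma swap_lin (lam c x y a b : R[i]) :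
  - lam * (c * x + y) + (c * a + b) = c * (- lam * x + a) + (- lam * y + b).
Proof. by rewrite !mulrDr addrACA !mulNr !mulrN (mulrCA c). Qed.

Lemma adT_sub_lin lam c X Y : zfin v X -> zfin v Y ->
  adT_sub lam (fun M => c * X M + Y M) = fun M => c * adT_sub lam X M + adT_sub lam Y M.
Proof.
by move=> zX zY; apply/funext => M; rewrite /adT_sub adT_lin //; exact: swap_lin.
Qed.

Lemma adT0 : adT v xi (fun=> 0) = fun=> 0.
Proof.
apply/funext => M; rewrite (@adT_sum _ _ _ _ _ [::]) ?big_nil //.
by move=> A; rewrite eqxx.
Qed.

Lemma adT_sub0 lam : adT_sub lam (fun=> 0) = fun=> 0.
Proof. by apply/funext => M; rewrite /adT_sub adT0 mulr0 addr0. Qed.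

Lemma iter_adT_sub0 lam k : iter k (adT_sub lam) (fun=> 0) = fun=> 0.
Proof. by elim: k => //= k ->; exact: adT_sub0. Qed.

Lemma iter_adT_sub_lin lam k c X Y : zfin v X -> zfin v Y ->
  iter k (adT_sub lam) (fun M => c * X M + Y M) =
  fun M => c * iter k (adT_sub lam) X M + iter k (adT_sub lam) Y M.
Proof.
by move=> zX zY; elim: k => //= k ->; rewrite adT_sub_lin //; exact: zfin_iter.
Qed.

Lemma iter_adT_sub_vanish lam k l X : (k <= l)%N -> iter k (adT_sub lam) X = (fun=> 0) ->
  iter l (adT_sub lam) X = fun=> 0.
Proof. by move=> /subnK <- h; rewrite iterD h iter_adT_sub0. Qed.

Lemma lin_span_ind (A : set (hseries R m n)) (P : hseries R m n -> Prop) :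
  P (fun=> 0) -> (forall c X Y, A X -> lin_span A Y -> P Y -> P (fun M => c * X M + Y M)) ->
  forall X, lin_span A X -> P X.
Proof.
move=> P0 PS X [d [c [Y [AY eX]]]].
elim: d => [|d IH] in c Y AY X eX *.
  suff -> : X = fun=> 0 by [].
  by apply/funext => M; rewrite eX big_ord0.
pose X' : hseries R m n := fun M => \sum_i c (lift ord0 i) * Y (lift ord0 i) M.
have -> : X = fun M => c ord0 * Y ord0 M + X' M.
  by apply/funext => M; rewrite eX big_ord_recl.
apply: PS => //; first by exists d, (fun i => c (lift ord0 i)), (fun i => Y (lift ord0 i)).
exact: (IH (fun i => c (lift ord0 i)) (fun i => Y (lift ord0 i))).
Qed.

Lemma lin_span0 (A : set (hseries R m n)) : lin_span A (fun=> 0).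
Proof.
exists 0%N, (fun=> 0), (fun=> fun=> 0); split; first by case.
by move=> M; rewrite big_ord0.
Qed.

Lemma lin_span_cons (A : set (hseries R m n)) c X Y : A X -> lin_span A Y ->
  lin_span A (fun M => c * X M + Y M).
Proof.
move=> AX [d [c' [Y' [AY' eY]]]].
exists d.+1, (fun i => if unlift ord0 i is Some j then c' j else c),
  (fun i => if unlift ord0 i is Some j then Y' j else X).
split=> [i|M]; first by case: unlift.
rewrite big_ord_recl unlift_none eY; congr (_ + _); apply: eq_bigr => i _.
by rewrite liftK.
Qed.

Lemma lin_span_lin (A : set (hseries R m n)) c X Y : lin_span A X -> lin_span A Y ->
  lin_span A (fun M => c * X M + Y M).
Proof.
move=> AX AY; elim/lin_span_ind: AX => [|c' Z W AZ _ IH].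
  suff -> : (fun M => c * 0 + Y M) = Y by [].
  by apply/funext => M; rewrite mulr0 add0r.
have -> : (fun M => c * (c' * Z M + W M) + Y M) = fun M => (c * c') * Z M + (c * W M + Y M).
  by apply/funext => M; rewrite mulrDr mulrA addrA.
exact: lin_span_cons.
Qed.

Lemma lin_span_gen (A : set (hseries R m n)) X : A X -> lin_span A X.
Proof.
move=> AX; have := lin_span_cons 1 AX (lin_span0 A).
suff -> : (fun M => 1 * X M + 0) = X by [].
by apply/funext => M; rewrite mul1r addr0.
Qed.

Lemma sum_lin_iter lam k (I : eqType) (s : seq I) (c : I -> R[i]) (Y : I -> hseries R m n) :
  (forall i, zfin v (Y i)) ->
  zfin v (fun M => \sum_(i <- s) c i * Y i M) /\
  iter k (adT_sub lam) (fun M => \sum_(i <- s) c i * Y i M) =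
  fun M => \sum_(i <- s) c i * iter k (adT_sub lam) (Y i) M.
Proof.
move=> zY; elim: s => [|i s [IH1 IH2]].
  have e : (fun M => \sum_(i <- [::]) c i * Y i M) = fun=> 0.
    by apply/funext => M; rewrite big_nil.
  rewrite e; split; first exact: zfin0.
  by rewrite iter_adT_sub0; apply/funext => M; rewrite big_nil.
have e : (fun M => \sum_(j <- i :: s) c j * Y j M) =
    fun M => c i * Y i M + \sum_(j <- s) c j * Y j M.
  by apply/funext => M; rewrite big_cons.
rewrite e; split; first exact: zfin_lin.
by rewrite iter_adT_sub_lin // IH2; apply/funext => M; rewrite big_cons.
Qed.

(** Let d be minimal with n^d X = 0 and suppose d > kappa. The vectors X, n X, ..., n^kappa X are
    dependent; if i is the least index with a nonzero coefficient, applying n^(d-1-i) to the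
    relation kills all other terms and leaves n^(d-1) X = 0, against minimality. *)
Lemma nilpotent_dim lam kappa V X : dim_le kappa V -> (forall Y, V Y -> zfin v Y) ->
  (forall Y, V Y -> V (adT_sub lam Y)) -> V X -> (exists d, iter d (adT_sub lam) X = fun=> 0) ->
  iter kappa (adT_sub lam) X = fun=> 0.
Proof.
move=> dV zV nV VX [d0 hd0].
have ex : exists d, `[< iter d (adT_sub lam) X = fun=> 0 >] by exists d0; apply/asboolP.
have [d /asboolP hd dmin] := ex_minnP ex.
have [dk|kd] := leqP d kappa; first exact: iter_adT_sub_vanish dk hd.
have Vit j : V (iter j (adT_sub lam) X) by elim: j => //= j; exact: nV.
have [c [[i0 ci0] hc]] := dV (fun j : 'I_kappa.+1 => iter j (adT_sub lam) X) (fun j => Vit j).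
pose P := fun j : 'I_kappa.+1 => c j != 0.
have [i ci imin] := @arg_minnP _ i0 P (fun j => nat_of_ord j) ci0.
have [_] := @sum_lin_iter lam (d.-1 - i) _ (index_enum 'I_kappa.+1) c
  (fun j : 'I_kappa.+1 => iter j (adT_sub lam) X) (fun j => zV _ (Vit j)).
have -> : (fun M => \sum_(j <- index_enum 'I_kappa.+1) c j * iter j (adT_sub lam) X M) = fun=> 0.
  by apply/funext.
rewrite iter_adT_sub0 => e.
have id : (i <= d.-1)%N by have := ltn_ord i; lia.
have : iter d.-1 (adT_sub lam) X = fun=> 0.
  apply/funext => M; have := congr1 (fun Z => Z M) e.
  rewrite /= (bigD1 i) //= big1 ?addr0 => [|j ji].
    by rewrite -iterD subnK // => /esym/eqP; rewrite mulf_eq0 (negPf ci) => /eqP.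
  have [cj|cj] := eqVneq (c j) 0; first by rewrite cj mul0r.
  rewrite -iterD (@iter_adT_sub_vanish lam d) ?mulr0 //.
  have := imin j cj; have : (nat_of_ord j != i) by [].
  lia.
move=> h; have : (d <= d.-1)%N by apply: dmin; apply/asboolP.
lia.
Qed.

Lemma hmul_lin c X X' Y : zfin v X -> zfin v X' -> zfin v Y ->
  hmul (fun M => c * X M + X' M) Y = fun M => c * hmul X Y M + hmul X' Y M.
Proof.
move=> zX zX' [s' [us' _ Ys]]; have [s [us _ Xs Xs']] := zfin2 zX zX'.
have exp Z : (forall M, Z M != 0 -> M \in s) -> forall M, hmul Z Y M =
    \sum_(A <- s) Z A * \sum_(B <- s' | M == monom_mul A B) Y B.
  move=> Zs M; rewrite {1}(lc_values us Zs) {1}(lc_values us' Ys) hmul_lc lc_mulE big_map.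
  by apply: eq_bigr => A _; rewrite big_map mulr_sumr.
apply/funext => M; rewrite !exp //; last by move=> A /lin_neq0[/Xs|/Xs'].
by rewrite mulr_sumr -big_split; apply: eq_bigr => A _; exact: mul_lin_distr.
Qed.

Lemma hmul0l_fun Y : hmul (fun=> 0) Y = (fun=> 0) :> hseries R m n.
Proof. by apply/funext => M; exact: hmul0l. Qed.

Lemma adT_sub_hmul_eq (lam lam' h x y : R[i]) :
  - (lam + lam') * h + (x + y) = (- lam * h + x) + (- lam' * h + y).
Proof. by rewrite addrACA -mulrDl opprD. Qed.

Lemma adT_sub_hmul lam lam' X Y : zfin v X -> zfin v Y ->
  adT_sub (lam + lam') (hmul X Y) = fun M => 1 * hmul (adT_sub lam X) Y M + hmul X (adT_sub lam' Y) M.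
Proof.
move=> zX zY; have zTX := zfin_adT xi zX; have zTY := zfin_adT xi zY.
have e1 : hmul (adT_sub lam X) Y = fun M => - lam * hmul X Y M + hmul (adT v xi X) Y M.
  exact: hmul_lin.
have e2 : hmul X (adT_sub lam' Y) = fun M => - lam' * hmul X Y M + hmul X (adT v xi Y) M.
  rewrite (hmulC zX (zfin_adT_sub lam' zY)) (hmulC zX zY) (hmulC zX zTY); exact: hmul_lin.
apply/funext => M; rewrite e1 e2 mul1r /adT_sub adT_hmul //; exact: adT_sub_hmul_eq.
Qed.

(** By the Leibniz rule the N applications of n are shared between X and Y, and if N >= a + b - 1
    then X receives at least a of them or Y at least b. *)
Lemma nilpotent_hmul lam lam' N a b X Y : zfin v X -> zfin v Y ->
  iter a (adT_sub lam) X = (fun=> 0) -> iter b (adT_sub lam') Y = (fun=> 0) -> (a + b <= N.+1)%N ->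
  iter N (adT_sub (lam + lam')) (hmul X Y) = fun=> 0.
Proof.
elim: N a b X Y => [|N IH] [|a] [|b] X Y zX zY.
- by move=> /= -> _ _; exact: hmul0l_fun.
- by move=> /= -> _ _; exact: hmul0l_fun.
- by move=> _ /= -> _; rewrite (hmulC zX zfin0); exact: hmul0l_fun.
- by move=> _ _; rewrite addSn addnS.
- by move=> X0 _ _; rewrite (X0 : X = fun=> 0) hmul0l_fun iter_adT_sub0.
- by move=> X0 _ _; rewrite (X0 : X = fun=> 0) hmul0l_fun iter_adT_sub0.
- move=> _ Y0 _; rewrite (Y0 : Y = fun=> 0) (hmulC zX zfin0) hmul0l_fun.
  exact: iter_adT_sub0.
move=> ha hb ab; have zX' := zfin_adT_sub lam zX; have zY' := zfin_adT_sub lam' zY.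
rewrite iterSr adT_sub_hmul // iter_adT_sub_lin; [|exact: zfin_hmul|exact: zfin_hmul].
have ha' : iter a (adT_sub lam) (adT_sub lam X) = fun=> 0 by rewrite -iterSr.
have hb' : iter b (adT_sub lam') (adT_sub lam' Y) = fun=> 0 by rewrite -iterSr.
rewrite (IH a b.+1 _ _ zX' zY ha' hb); last by move: ab; lia.
rewrite (IH a.+1 b _ _ zX zY' ha hb'); last by move: ab; lia.
by apply/funext => M; rewrite mulr0 addr0.
Qed.

End Operators.

(** * Inverting a scalar plus a nilpotent operator *)

Section Inverse.
Context (R : realType) (m n : nat) (v : 'M[int]_(m, n)) (xi : 'I_m -> R).
Context (lam : R[i]) (V : set (hseries R m n)) (N : nat).
Hypotheses (lam0 : lam != 0) (V0 : V (fun=> 0))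
  (Vlin : forall c X Y, V X -> V Y -> V (fun M => c * X M + Y M))
  (zV : forall X, V X -> zfin v X) (nV : forall X, V X -> V (adT_sub v xi lam X))
  (nil : forall X, V X -> iter N (adT_sub v xi lam) X = fun=> 0).
Implicit Types (X Y g : hseries R m n).

Lemma adT_decomp X : adT v xi X = fun M => lam * X M + adT_sub v xi lam X M.
Proof. by apply/funext => M; rewrite /adT_sub mulNr addrA addrN add0r. Qed.

Lemma adT_V X : V X -> V (adT v xi X).
Proof. by move=> VX; rewrite adT_decomp; apply: Vlin => //; exact: nV. Qed.

(** On the kernel n acts as - lam, so nilpotency gives (- lam)^N X = 0. *)
Lemma adT_ker X : V X -> adT v xi X = (fun=> 0) -> X = fun=> 0.
Proof.
move=> VX TX.
have it k : iter k (adT_sub v xi lam) X = fun M => (- lam) ^+ k * X M.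
  elim: k => [|k IH]; first by apply/funext => M; rewrite mul1r.
  rewrite iterS IH; have -> : (fun M => (- lam) ^+ k * X M) = fun M => (- lam) ^+ k * X M + 0.
    by apply/funext => M; rewrite addr0.
  rewrite adT_sub_lin; [|exact: zV|exact: zfin0].
  apply/funext => M; rewrite adT_sub0 addr0 /adT_sub TX addr0 mulrA exprSr; exact: erefl.
apply/funext => M; have := congr1 (fun Z => Z M) (nil VX); rewrite it => /eqP.
by rewrite mulf_eq0 expf_eq0 oppr_eq0 (negPf lam0) andbF => /eqP.
Qed.

Lemma mulr_subK (a x y : R[i]) : a != 0 -> a * (a^-1 * x + (- a^-1 * y + 0)) = x - y.
Proof. by move=> a0; rewrite addr0 mulNr mulrDr mulrN !mulrA divff // !mul1r. Qed.

Lemma adT_surj Y : V Y -> exists2 X, V X & adT v xi X = Y.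
Proof.
move: (leqnn N) (nil); move: {1 3}N => k _ nilk.
have : forall Z, V Z -> iter k (adT_sub v xi lam) Z = (fun=> 0) -> exists2 X, V X & adT v xi X = Z.
  elim: k {nilk} => [|k IH] Z VZ hZ.
    by exists (fun=> 0) => //; rewrite adT0 (hZ : Z = fun=> 0).
  have [|g Vg Tg] := IH _ (nV VZ); first by rewrite -iterSr.
  have V1 : V (fun M => - lam^-1 * g M + 0) by exact: Vlin.
  (* If T g = n Z for T = lam + n, then T (lam^-1 (Z - g)) = lam^-1 (T Z - n Z) = Z. The element n Z
     has a smaller order of nilpotency, so g comes from the induction hypothesis. *)
  exists (fun M => lam^-1 * Z M + (- lam^-1 * g M + 0)); first exact: Vlin.
  rewrite adT_lin; [|exact: zV|exact: zV].
  rewrite adT_lin; [|exact: zV|exact: zfin0].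
  rewrite adT0 Tg adT_decomp; apply/funext => M.
  apply: (mulfI lam0); rewrite mulr_subK // addrK; exact: erefl.
by move=> h VY; apply: h => //; exact: nilk.
Qed.

Context (weighted_norm : hseries R m n -> R) (t Lam : R).
Hypotheses (weighted_norm0 : weighted_norm (fun=> 0) = 0) (weighted_norm_ge0 : forall X, 0 <= weighted_norm X)
  (weighted_norm_lin : forall c X Y, V X -> V Y ->
     weighted_norm (fun M => c * X M + Y M) <= Normc.normc c * weighted_norm X + weighted_norm Y)
  (t0 : 0 <= t) (weighted_norm_adT_sub : forall X, V X -> weighted_norm (adT_sub v xi lam X) <= t * weighted_norm X)
  (lamLam : (Normc.normc lam)^-1 <= Lam).

Lemma lam_inv_decomp (x : R[i]) (y : R[i]) : - lam^-1 * y + (lam^-1 * (lam * x + y) + 0) = x.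
Proof. by rewrite addr0 mulrDr mulrA mulVf // mul1r mulNr addrCA addNr addr0. Qed.

(** The Neumann sum is unrolled by induction on the order of nilpotency: g = lam^-1 (T g - n g) for
    T = lam + n, and the induction hypothesis applies to n g because T (n g) = n (T g). *)
Lemma weighted_norm_inverse g : V g -> weighted_norm g <= Lam * (\sum_(j < N) (t * Lam) ^+ j) * weighted_norm (adT v xi g).
Proof.
have Lam0 : 0 <= Lam by apply: le_trans lamLam; rewrite invr_ge0 normc_ge0.
move=> Vg; have gen : forall k g, V g -> iter k (adT_sub v xi lam) g = (fun=> 0) ->
  weighted_norm g <= Lam * (\sum_(j < k) (t * Lam) ^+ j) * weighted_norm (adT v xi g); last exact: gen (nil Vg).
move=> {g Vg} k; elim: k => [|k IH] g Vg hg.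
  by rewrite (hg : g = fun=> 0) weighted_norm0 big_ord0 mulr0 mul0r.
have Vn := nV Vg; have VT := adT_V Vg.
have {}IH := IH _ Vn; rewrite -iterSr in IH; move/(_ hg) in IH.
have com : adT v xi (adT_sub v xi lam g) = adT_sub v xi lam (adT v xi g).
  rewrite {1}/adT_sub adT_lin; [by []|exact: zV|exact: zV].
rewrite com in IH.
have V1 : V (fun M => lam^-1 * adT v xi g M + 0) by exact: Vlin.
have gE : g = fun M => - lam^-1 * adT_sub v xi lam g M + (lam^-1 * adT v xi g M + 0).
  by apply/funext => M; rewrite adT_decomp lam_inv_decomp.
have b1 : weighted_norm g <= Lam * weighted_norm (adT_sub v xi lam g) + Lam * weighted_norm (adT v xi g).
  rewrite {1}gE; apply: le_trans (weighted_norm_lin _ Vn V1) _; apply: lerD.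
    by rewrite normcN Normc.normcV ler_wpM2r.
  apply: le_trans (weighted_norm_lin _ VT V0) _.
  by rewrite weighted_norm0 addr0 Normc.normcV ler_wpM2r.
have S0 : 0 <= \sum_(j < k) (t * Lam) ^+ j.
  by apply: sumr_ge0 => j _; rewrite exprn_ge0 // mulr_ge0.
apply: le_trans b1 _.
have b2 : weighted_norm (adT_sub v xi lam g) <= Lam * (\sum_(j < k) (t * Lam) ^+ j) * (t * weighted_norm (adT v xi g)).
  by apply: le_trans IH _; rewrite ler_wpM2l ?mulr_ge0 // weighted_norm_adT_sub.
apply: le_trans (lerD (ler_wpM2l Lam0 b2) (lexx _)) _.
rewrite big_ord_recl expr0 /bump /=.
have -> : \sum_(i < k) (t * Lam) ^+ (1 + i) = (t * Lam) * \sum_(i < k) (t * Lam) ^+ i.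
  by rewrite mulr_sumr; apply: eq_bigr => i _; rewrite exprS.
by move: (\sum_(i < k) _) (weighted_norm _) => S a; rewrite le_eqVlt; apply/orP; left; apply/eqP; ring.
Qed.

End Inverse.

Lemma size_flatten_le (S : eqType) (T : Type) (s : seq S) (f : S -> seq T) (B : nat) :
  (forall y, y \in s -> (size (f y) <= B)%N) -> (size (flatten [seq f y | y <- s]) <= size s * B)%N.
Proof.
elim: s => [//|y s IH] h; rewrite /= size_cat mulSn leq_add ?h ?mem_head //.
by apply: IH => z zs; apply: h; rewrite inE zs orbT.
Qed.

(** This is (k - 1)^2 >= 0. The Leibniz rule gives the order 2 kappa - 1 on products, and the
    statement allows kappa^2. *)
Lemma double_le_sqr (k : nat) : (k + k <= (k ^ 2).+1)%N.
Proof. nia. Qed.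

(** * The spaces F01 and F02 *)

Section Spaces.
Context (R : realType) (m n : nat) (v : 'M[int]_(m, n)) (H : set ('I_m -> R))
  (mu : vertex m -> nat -> ('I_m -> R) -> R[i]).
Hypothesis (branches : eigenvalue_branches v H mu).
Implicit Types (xi : 'I_m -> R) (lam : ('I_m -> R) -> R[i]) (u : vertex m) (X Y : hseries R m n).

Definition in_spectrum lam u := basis01 v u /\
  exists2 i, (i < block_size R v u)%N & identically_eq H (mu u i) lam.

Lemma in_spectrum_finite lam u : in_spectrum lam u -> finite_set (block R v u).
Proof. by move=> [_ [i iu _]]; apply: block_size_gt0; exact: leq_ltn_trans iu. Qed.

Lemma in_spectrum_block lam u u' : block R v u u' -> in_spectrum lam u -> in_spectrum lam u'.
Proof.
move=> uu' [bu [i iu ei]]; split; first exact: block_basis01 uu' bu.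
have [hmu _ _] := branches bu.
by exists i; rewrite ?(hmu _ uu') // /block_size -(block_eq uu').
Qed.

Lemma in_spectrum_root lam u xi : positive xi -> ~ H xi -> in_spectrum lam u ->
  root (char_poly (ad_block_mx v xi u)) (lam xi).
Proof.
move=> pxi nH [bu [i iu ei]]; have [_ hcp _] := branches bu.
rewrite hcp => [|j]; last by rewrite ltW.
rewrite rootE horner_prod (bigD1 (Ordinal iu)) //= hornerXsubC ei // subrr.
by rewrite mul0r.
Qed.

Context (xi : 'I_m -> R) (pxi : positive xi) (nH : ~ H xi).

Lemma gen_adT_sub (c : R[i]) : (fun Y M => - 'i%C * adN v xi Y M - c * Y M) = adT_sub v xi c.
Proof.
apply/funext => Y; apply/funext => M; rewrite /adT_sub [in RHS]mulNr addrC; exact: erefl.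
Qed.

Lemma F01_ind lam (P : hseries R m n -> Prop) : P (fun=> 0) ->
  (forall c u X Y, in_spectrum lam u -> block_supported v u X ->
     (exists d, iter d (adT_sub v xi (lam xi)) X = fun=> 0) -> F01 v H mu xi lam Y -> P Y ->
     P (fun M => c * X M + Y M)) ->
  forall X, F01 v H mu xi lam X -> P X.
Proof.
move=> P0 PS X; apply: lin_span_ind => // c Z Y [u [i [bu iu ei [bZ dZ]]]] FY PY.
by apply: (PS c u) => //; [split=> //; exists i|rewrite -gen_adT_sub].
Qed.

Lemma F01_gen lam u X : in_spectrum lam u -> block_supported v u X ->
  (exists d, iter d (adT_sub v xi (lam xi)) X = fun=> 0) -> F01 v H mu xi lam X.
Proof.
move=> [bu [i iu ei]] bX dX; apply: lin_span_gen; exists u, i; split=> //.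
by split=> //; rewrite gen_adT_sub.
Qed.

Lemma F01_zfin lam X : F01 v H mu xi lam X -> zfin v X.
Proof.
move: X; apply: F01_ind => [|c u X Y su bX _ _ zY]; first exact: zfin0.
apply: zfin_lin => //; apply: block_supported_zfin bX; first exact: in_spectrum_finite su.
by case: su.
Qed.

Lemma F01_supp lam X : F01 v H mu xi lam X ->
  forall M, X M != 0 -> exists2 u, in_spectrum lam u & M = elt v u.
Proof.
move: X; apply: F01_ind => [M|c u X Y su bX _ _ sY M]; first by rewrite eqxx.
move=> /lin_neq0[/bX[u' uu' ->]|/sY//].
by exists u' => //; exact: in_spectrum_block uu' su.
Qed.

Lemma F01_adT_sub lam X : F01 v H mu xi lam X -> F01 v H mu xi lam (adT_sub v xi (lam xi) X).
Proof.
move: X; apply: F01_ind => [|c u X Y su bX [d hd] FY FnY].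
  by rewrite adT_sub0; exact: lin_span0.
have [bu _] := su; have fu := in_spectrum_finite su.
have zX := block_supported_zfin fu bu bX.
rewrite adT_sub_lin //; last exact: F01_zfin FY.
apply: lin_span_lin => //; apply: (F01_gen su); last first.
  by exists d; rewrite -iterSr iterS hd adT_sub0.
by move=> M /lin_neq0[/bX//|]; exact: (block_supported_adT pxi fu bu bX).
Qed.

Lemma F01_nil lam X : F01 v H mu xi lam X -> exists d, iter d (adT_sub v xi (lam xi)) X = fun=> 0.
Proof.
move: X; apply: F01_ind => [|c u X Y su bX [d hd] FY [d' hd']].
  by exists 0%N.
have [bu _] := su; have fu := in_spectrum_finite su.
have zX := block_supported_zfin fu bu bX.
exists (d + d')%N; rewrite iter_adT_sub_lin //; last exact: F01_zfin FY.
rewrite (iter_adT_sub_vanish _ hd) ?leq_addr // (iter_adT_sub_vanish _ hd') ?leq_addl //.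
by apply/funext => M; rewrite mulr0 addr0.
Qed.

Lemma F01_nilpotent lam kappa X : dim_le kappa (F01 v H mu xi lam) ->
  F01 v H mu xi lam X -> iter kappa (adT_sub v xi (lam xi)) X = fun=> 0.
Proof.
move=> dk FX; apply: (nilpotent_dim dk) => //.
- by move=> Y; exact: F01_zfin.
- by move=> Y; exact: F01_adT_sub.
- exact: F01_nil.
Qed.

(** Each block with eigenvalue lam contributes an eigenvector to F01. Eigenvectors of different
    blocks have disjoint supports and are independent, so there are at most kappa such blocks. *)
Lemma in_spectrum_cover lam kappa B : dim_le kappa (F01 v H mu xi lam) ->
  (forall u, basis01 v u -> (block_size R v u <= B)%N) ->
  exists s : seq (vertex m), [/\ (size s <= kappa * B)%N,
    forall u, u \in s -> in_spectrum lam u & forall u, in_spectrum lam u -> u \in s].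
Proof.
move=> dk hB.
have [||s [ss Ps cov]] := @inequivalent_cover _ (block R v) (in_spectrum lam) kappa (0, true).
- by move=> x y; exact: block_sym.
- move=> w hw; apply: contrapT => hn.
  have eig j : exists X, [/\ block_supported v (w j) X, exists M, X M != 0 &
      forall M, adT v xi X M = lam xi * X M].
    apply: (block_eigenvector pxi); first exact: in_spectrum_finite (hw j).
      by case: (hw j).
    exact: in_spectrum_root (hw j).
  pose Y j := sval (cid (eig j)).
  have Yp j : [/\ block_supported v (w j) (Y j), exists M, Y j M != 0 &
      forall M, adT v xi (Y j) M = lam xi * Y j M] := svalP (cid (eig j)).
  have FY j : F01 v H mu xi lam (Y j).
    have [bY _ eY] := Yp j; apply: (F01_gen (hw j)) => //; exists 1%N.
    by apply/funext => M; rewrite /= /adT_sub eY mulNr addNr.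
  have [c [[j cj] hc]] := dk Y FY.
  have [bY [M YM] _] := Yp j.
  have := hc M; rewrite (bigD1 j) //= big1 => [|i ij].
    by move/eqP; rewrite addr0 mulf_eq0 (negPf cj) (negPf YM).
  have [->|YiM] := eqVneq (Y i M) 0; first by rewrite mulr0.
  have [bYi _ _] := Yp i.
  have [u1 h1 e1] := bY _ YM; have [u2 h2 e2] := bYi _ YiM.
  exfalso; apply: hn; exists i, j; split=> //.
  have e : u1 = u2 by apply: (@elt_inj _ _ v); rewrite -e1 -e2.
  by apply: block_trans h2 _; rewrite -e; exact: block_sym.
exists (flatten [seq (fset_set (block R v y) : seq (vertex m)) | y <- s]); split.
- apply: leq_trans (_ : size s * B <= _)%N; last by rewrite leq_mul2r ss orbT.
  apply: size_flatten_le => y ys; apply: hB.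
  by have [] := Ps y ys.
- move=> u /flattenP[l /mapP[y ys ->]]; have sy := Ps _ ys.
  by rewrite mem_block ?inE; [move=> yu; exact: in_spectrum_block yu sy|exact: in_spectrum_finite sy].
- move=> u su; have [y ys yu] := cov u su; apply/flattenP.
  exists (fset_set (block R v y) : seq (vertex m)); first by apply/mapP; exists y.
  by rewrite mem_block ?inE //; exact: in_spectrum_finite (Ps _ ys).
Qed.

Implicit Types (la lb : ('I_m -> R) -> R[i]).

Lemma F02_ind la lb (P : hseries R m n -> Prop) : P (fun=> 0) ->
  (forall c X Y Z, F01 v H mu xi la X -> F01 v H mu xi lb Y -> F02 v H mu xi la lb Z -> P Z ->
     P (fun M => c * hmul X Y M + Z M)) ->
  forall Z, F02 v H mu xi la lb Z -> P Z.
Proof.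
move=> P0 PS Z; apply: lin_span_ind => // c W Z' [X FX [Y FY <-]] FZ PZ.
exact: PS.
Qed.

Lemma F02_hmul la lb X Y : F01 v H mu xi la X -> F01 v H mu xi lb Y ->
  F02 v H mu xi la lb (hmul X Y).
Proof. by move=> FX FY; apply: lin_span_gen; exists X => //; exists Y. Qed.

Lemma F02_zfin la lb Z : F02 v H mu xi la lb Z -> zfin v Z.
Proof.
move: Z; apply: F02_ind => [|c X Y Z FX FY _ zZ]; first exact: zfin0.
apply: zfin_lin => //; apply: zfin_hmul; [exact: F01_zfin FX|exact: F01_zfin FY].
Qed.

Lemma F02_supp la lb Z : F02 v H mu xi la lb Z -> forall M, Z M != 0 ->
  exists u u', [/\ in_spectrum la u, in_spectrum lb u' & M = monom_mul (elt v u) (elt v u')].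
Proof.
move: Z; apply: F02_ind => [M|c X Y Z FX FY _ sZ M]; first by rewrite eqxx.
move=> /lin_neq0[/hmul_supp[A [B [XA YB ->]]]|/sZ//].
have [u su ->] := F01_supp FX XA; have [u' su' ->] := F01_supp FY YB.
by exists u, u'.
Qed.

Lemma F02_adT_sub la lb Z : F02 v H mu xi la lb Z ->
  F02 v H mu xi la lb (adT_sub v xi (la xi + lb xi) Z).
Proof.
move: Z; apply: F02_ind => [|c X Y Z FX FY FZ FnZ].
  by rewrite adT_sub0; exact: lin_span0.
have zX := F01_zfin FX; have zY := F01_zfin FY.
rewrite adT_sub_lin; [|exact: zfin_hmul|exact: F02_zfin FZ].
apply: lin_span_lin => //; rewrite adT_sub_hmul //.
by apply: lin_span_lin; apply: F02_hmul => //; exact: F01_adT_sub.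
Qed.

Lemma F02_nilpotent la lb kappa Z :
  dim_le kappa (F01 v H mu xi la) -> dim_le kappa (F01 v H mu xi lb) ->
  F02 v H mu xi la lb Z -> iter (kappa ^ 2) (adT_sub v xi (la xi + lb xi)) Z = fun=> 0.
Proof.
move=> da db; move: Z; apply: F02_ind => [|c X Y Z FX FY FZ nZ]; first exact: iter_adT_sub0.
have zX := F01_zfin FX; have zY := F01_zfin FY.
rewrite iter_adT_sub_lin; [|exact: zfin_hmul|exact: F02_zfin FZ].
rewrite nZ (nilpotent_hmul zX zY (F01_nilpotent da FX) (F01_nilpotent db FY)).
  by apply/funext => M; rewrite mulr0 addr0.
exact: double_le_sqr.
Qed.

Lemma adN_F02_bij la lb kappa :
  dim_le kappa (F01 v H mu xi la) -> dim_le kappa (F01 v H mu xi lb) -> la xi + lb xi != 0 ->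
  set_bij (F02 v H mu xi la lb) (F02 v H mu xi la lb) (adN v xi).
Proof.
move=> da db l0; set V := F02 v H mu xi la lb.
have V0 : V (fun=> 0) by exact: lin_span0.
have Vlin c X Y : V X -> V Y -> V (fun M => c * X M + Y M) by exact: lin_span_lin.
have zV X : V X -> zfin v X by exact: F02_zfin.
have nV X : V X -> V (adT_sub v xi (la xi + lb xi) X) by exact: F02_adT_sub.
have nil X : V X -> iter (kappa ^ 2) (adT_sub v xi (la xi + lb xi)) X = fun=> 0.
  by exact: F02_nilpotent.
have i2 (z : R[i]) : 'i%C * (- 'i%C * z) = z by rewrite mulrA mulrN -expr2 sqr_i opprK mul1r.
have scaleV c X : V X -> V (fun M => c * X M).
  move=> VX; have := Vlin c _ _ VX V0.
  suff -> : (fun M => c * X M + 0) = (fun M => c * X M) by [].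
  by apply/funext => M; rewrite addr0.
have adNE X : adN v xi X = fun M => 'i%C * adT v xi X M.
  by apply/funext => M; rewrite /adT i2.
split.
- by move=> X VX; rewrite /= adNE; apply: scaleV; exact: (adT_V Vlin nV).
- move=> X Y; rewrite !inE => VX VY e.
  have VD : V (fun M => (-1) * Y M + X M) by exact: Vlin.
  have := adT_ker l0 zV nil VD; rewrite adT_lin; [|exact: zV|exact: zV].
  have -> : adT v xi X = adT v xi Y by apply/funext => M; rewrite /adT e.
  move=> h; have {}h : (fun M => -1 * Y M + X M) = fun=> 0.
    by apply: h; apply/funext => M; rewrite mulN1r addNr.
  apply/funext => M; have := congr1 (fun Z => Z M) h.
  by rewrite mulN1r addrC => /subr0_eq.
(* As ad(N) is i times [adT], the equation for [adT] has right-hand side - i Y. *)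
- move=> Y VY; have [X VX TX] := adT_surj l0 V0 Vlin zV nV nil (scaleV (- 'i%C) Y VY).
  exists X => //; rewrite adNE TX; apply/funext => M; exact: i2.
Qed.

End Spaces.

(** * The supremum norm *)

Lemma mulr_swap4 (K : comPzRingType) (a b c d : K) : a * b * (c * d) = b * c * (a * d).
Proof. by rewrite (mulrC a) -!mulrA; congr (_ * _); rewrite mulrCA. Qed.

Section SupNormBounds.
Context (R : realType) (m n : nat) (v : 'M[int]_(m, n)) (a p s r : R).
Implicit Types (P : phase_point R m n) (M A : monom m n) (X : hseries R m n).
Local Notation nc := Normc.normc.

Definition cis (t : R) : R[i] := (cos t +i* sin t)%C.

Lemma cisD t t' : cis (t + t') = cis t * cis t'.
Proof. by rewrite /cis cosD sinD; apply/eqP; rewrite eq_complex /= eqxx addrC (mulrC (sin t)) eqxx. Qed.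

Lemma normc_cis t : nc (cis t) = 1.
Proof. by rewrite /cis /Normc.normc cos2Dsin2 sqrtr1. Qed.

Lemma cis0 : cis 0 = 1.
Proof. by rewrite /cis cos0 sin0. Qed.

Lemma cispi : cis pi = -1.
Proof. by rewrite /cis cospi sinpi; apply/eqP; rewrite eq_complex /= oppr0 !eqxx. Qed.

Lemma cexp_cis (z : R[i]) : cexp z = (expR (complex.Re z))%:C%C * cis (complex.Im z).
Proof. by []. Qed.

Lemma normc_cexp (z : R[i]) : nc (cexp z) = expR (complex.Re z).
Proof. by rewrite cexp_cis Normc.normcM normc_cis mulr1 normc_real ger0_norm // expR_ge0. Qed.

Lemma cexpDi (z : R[i]) t : cexp (z + 'i%C * t%:C%C) = cexp z * cis t.
Proof.
rewrite !cexp_cis -mulrA -cisD; case: z => x y /=.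
by rewrite !mul0r !mul1r !subr0 !addr0 ?mulr0 ?addr0 add0r.
Qed.

(** In the complexified phase space z_k and zbar_k are independent coordinates, so their phases
    rotate independently. All these rotations preserve D(s, r) and multiply a monomial by a
    phase. *)
Definition rot (th : 'I_m -> R) (ph : var m n -> R) P : phase_point R m n :=
  PhasePoint (fun i => px P i + (th i)%:C%C) (fun i => cis (ph (inl i)) * py P i)
    (fun k sg => cis (ph (inr (k, sg))) * pw P k sg).

Definition angle (th : 'I_m -> R) (ph : var m n -> R) M : R :=
  \sum_i (M.1 0 i)%:~R * th i + \sum_(x <- M.2) ph x.

Lemma var_value_rot th ph P x : var_value (rot th ph P) x = cis (ph x) * var_value P x.
Proof. by case: x => [i|[k sg]]. Qed.

Lemma prod_cis (T : Type) (l : seq T) (f : T -> R) :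
  \prod_(x <- l) cis (f x) = cis (\sum_(x <- l) f x).
Proof. by elim: l => [|x l IH]; rewrite ?big_nil ?cis0 // !big_cons IH cisD. Qed.

Lemma monom_value_rot th ph P M :
  monom_value (rot th ph P) M = cis (angle th ph M) * monom_value P M.
Proof.
rewrite /monom_value (eq_bigr _ (fun x _ => var_value_rot th ph P x)) big_split /= prod_cis.
have -> : 'i%C * \sum_i (M.1 0 i)%:~R * (px P i + (th i)%:C%C) =
    'i%C * (\sum_i (M.1 0 i)%:~R * px P i) + 'i%C * (\sum_i (M.1 0 i)%:~R * th i)%:C%C.
  rewrite -mulrDr rmorph_sum -big_split; congr (_ * _); apply: eq_bigr => i _ /=.
  by rewrite mulrDr rmorphM /= rmorph_int.
rewrite cexpDi /angle cisD; exact: mulr_swap4.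
Qed.

Lemma rot_D th ph P : D_ v a p s r P -> D_ v a p s r (rot th ph P).
Proof.
move=> [hx hy hw]; split.
- by move=> i; move: (hx i); rewrite /=; case: (px P i) => x y /=; rewrite addr0.
- by move=> i; rewrite /= Normc.normcM normc_cis mul1r.
- move: hw; congr (_ <= _)%E; apply: eq_esum => k _; congr ((_ * _)%:E).
  by apply: eq_bigr => b _; rewrite /= Normc.normcM normc_cis mul1r.
Qed.

Lemma sum_count (T : choiceType) (W : {mset T}%mset) (y : T) (c : R) :
  \sum_(x <- W) (if x == y then c else 0) = c *+ W y.
Proof.
by rewrite -big_mkcond big_const_seq iter_addr addr0 -count_mem_mset.
Qed.

(** Two monomials differ in a frequency or in a multiplicity; rotating that single variable by pi
    divided by the difference is enough. *)
Lemma separating_angle A M : A != M -> exists th ph, angle th ph A - angle th ph M = pi.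
Proof.
case: A M => [x W] [x' W'] ne.
have [xx|xx] := eqVneq x x'; last first.
  have [i hi] : exists i, x 0 i != x' 0 i.
    apply: contrapT => h; move/eqP: xx; apply; apply/rowP => i.
    by apply/eqP; apply: contrapT => /negP hi; apply: h; exists i.
  exists (fun j => if j == i then pi / ((x 0 i)%:~R - (x' 0 i)%:~R) else 0), (fun=> 0).
  have sumE (y : 'rV[int]_m) c : \sum_j (y 0 j)%:~R * (if j == i then c else 0) = (y 0 i)%:~R * c :> R.
    rewrite (bigD1 i) //= eqxx big1 ?addr0 // => j /negPf->.
    exact: mulr0.
  rewrite /angle /= !sumE !big1 // !addr0 -mulrBl mulrC divfK // -rmorphB intr_eq0 subr_eq0.
  exact: hi.
have WW : W != W' by move: ne; rewrite xx xpair_eqE eqxx.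
have [y hy] : exists y, W y != W' y.
  apply: contrapT => h; move/eqP: WW; apply; apply/msetP => y.
  by apply/eqP; apply: contrapT => /negP hi; apply: h; exists y.
exists (fun=> 0), (fun z => if z == y then pi / ((W y)%:R - (W' y)%:R) else 0).
rewrite /angle xx /= !sum_count opprD addrACA subrr add0r -!(mulr_natl (pi / _)) -mulrBl mulrC.
rewrite divfK //.
by rewrite subr_eq0 eqr_nat.
Qed.

Lemma average_rot (c : R[i]) (x y z : R) (w : R[i]) : z = x - y ->
  2^-1 * (c * w) + 2^-1 * (cis (- y) * (c * (cis x * w))) = c * (2^-1 * (1 + cis z)) * w.
Proof. by move=> ->; rewrite addrC cisD; move: (cis x) (cis (- y)) => k l; ring. Qed.

Lemma normc_half_le (z w : R[i]) (b : R) : nc z <= b -> nc w <= b -> nc (2^-1 * z + 2^-1 * w) <= b.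
Proof.
move=> zb wb; apply: le_trans (le_normcD _ _) _.
rewrite !Normc.normcM Normc.normcV normc_nat -mulrDr ler_pdivrMl //.
by rewrite mulr_natl mulr2n lerD.
Qed.

(* Averaging with a rotation that changes the sign of one monomial relative to M kills that
   monomial and keeps the coefficient of M. *)
Lemma coef_le (L : seq (monom m n)) (c : monom m n -> R[i]) M (b : R) : M \notin L ->
  (forall P, D_ v a p s r P -> nc (\sum_(B <- M :: L) c B * monom_value P B) <= b) ->
  forall P, D_ v a p s r P -> nc (c M * monom_value P M) <= b.
Proof.
elim: L c => [|A L IH] c ML hb P DP; first by have := hb P DP; rewrite big_seq1.
rewrite inE negb_or eq_sym in ML; case/andP: ML => AM ML.
have [th [ph hpi]] := separating_angle AM.
(* The coefficients of the average of the function and its rotation, the latter normalized so that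
   the coefficient at M is unchanged; the one at A vanishes. *)
pose c' B := c B * (2^-1 * (1 + cis (angle th ph B - angle th ph M))).
have c'M : c' M = c M.
  by rewrite /c' subrr cis0 -(natrD _ 1 1) mulVf ?mulr1 // pnatr_eq0.
have c'A : c' A = 0 by rewrite /c' hpi cispi subrr !mulr0.
rewrite -c'M; apply: IH => // P' DP'.
have -> : \sum_(B <- M :: L) c' B * monom_value P' B =
    \sum_(B <- M :: A :: L) c' B * monom_value P' B.
  by rewrite !big_cons c'A mul0r add0r.
have -> : \sum_(B <- M :: A :: L) c' B * monom_value P' B =
    2^-1 * \sum_(B <- M :: A :: L) c B * monom_value P' B +
    2^-1 * (cis (- angle th ph M) * \sum_(B <- M :: A :: L) c B * monom_value (rot th ph P') B).
  rewrite !mulr_sumr -big_split; apply: eq_bigr => B _ /=.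
  by rewrite monom_value_rot (average_rot _ _ (erefl _)).
apply: normc_half_le; first exact: hb.
by rewrite Normc.normcM normc_cis mul1r; apply: hb; exact: rot_D.
Qed.

Lemma valueE (l : seq (monom m n)) X P : uniq l -> (forall M, X M != 0 -> M \in l) ->
  value X P = \sum_(M <- l) X M * monom_value P M.
Proof.
move=> ul Xl; rewrite /value (@fsbig_list _ _ _ _ l) //.
  by apply: eq_bigl => M; rewrite in_setT.
by move=> M _ /mul_neq0[/Xl].
Qed.

Lemma coef_value_le X M (b : R) P : zfin v X ->
  (forall P, D_ v a p s r P -> nc (value X P) <= b) -> D_ v a p s r P ->
  nc (X M * monom_value P M) <= b.
Proof.
move=> [l [ul _ Xl]] hb DP.
have [X0|XM] := eqVneq (X M) 0.
  by rewrite X0 mul0r Normc.normc0; apply: le_trans (hb P DP); exact: normc_ge0.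
apply: (@coef_le (rem M l) X) => // [|P' DP'].
  by rewrite mem_rem_uniq // !inE eqxx.
rewrite -(perm_big _ (perm_to_rem (Xl _ XM))) -valueE //; exact: hb.
Qed.

End SupNormBounds.

(** * Majorants of monomials on D(s, r) *)

Section Weights.
Context (R : realType) (m n : nat) (v : 'M[int]_(m, n)) (a p s r : R).
Hypotheses (a0 : 0 < a) (p0 : 0 < p) (s0 : 0 < s) (r0 : 0 < r).
Implicit Types (P : phase_point R m n) (M : monom m n) (X : hseries R m n) (k h : 'rV[int]_n).
Local Notation nc := Normc.normc.

Definition site_base k : R := if k == 0 then 1 else Num.sqrt ((normsq k)%:~R : R).

Lemma site_base_ge1 k : 1 <= site_base k.
Proof.
rewrite /site_base; case: eqVneq => // /normsq_ge1 h.
by rewrite -[leLHS]sqrtr1 ler_sqrt ?ler0z ?normsq_ge0 // ler1z.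
Qed.

Lemma weightE k : weight a p k =
  expR (2 * a * Num.sqrt ((normsq k)%:~R : R)) * site_base k `^ (2 * p).
Proof. by []. Qed.

Lemma weight_gt0 k : 0 < weight a p k.
Proof.
rewrite weightE mulr_gt0 ?expR_gt0 // powR_gt0 //.
exact: lt_le_trans (site_base_ge1 k).
Qed.

Definition adj_radius : R := Num.sqrt ((sphere_radius v + sphere_radius v)%:R).

Lemma site_adj_sqrt k h : site_adj v k h ->
  Num.sqrt ((normsq k)%:~R : R) <= Num.sqrt ((normsq h)%:~R : R) + adj_radius.
Proof.
move=> /site_adj_normsq kh.
have h0 : 0 <= (normsq h)%:~R :> R by rewrite ler0z normsq_ge0.
have c0 : 0 <= (sphere_radius v + sphere_radius v)%:R :> R by exact: ler0n.
rewrite -[leRHS]ger0_norm ?addr_ge0 ?sqrtr_ge0 // -sqrtr_sqr ler_sqrt ?sqr_ge0 //.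
rewrite sqrrD !sqr_sqrtr //; apply: (@le_trans _ _ ((normsq h)%:~R + (sphere_radius v + sphere_radius v)%:R)).
  by rewrite -[leRHS]/((normsq h)%:~R + (sphere_radius v + sphere_radius v)%:Z%:~R) -intrD ler_int.
by rewrite addrAC lerDl mulrn_wge0 // mulr_ge0 ?sqrtr_ge0.
Qed.

(** Along an edge |k| grows by at most [adj_radius], and max(1, |k|) is multiplied by at most 1 +
    [adj_radius]. *)
Definition weight_ratio : R := expR (2 * a * adj_radius) * (1 + adj_radius) `^ (2 * p).

Lemma weight_ratio_ge0 : 0 <= weight_ratio.
Proof. by rewrite mulr_ge0 ?expR_ge0 ?powR_ge0. Qed.

Lemma adj_radius_ge0 : 0 <= adj_radius. Proof. exact: sqrtr_ge0. Qed.

Lemma site_adj_weight k h : site_adj v k h -> weight a p k <= weight_ratio * weight a p h.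
Proof.
move=> kh; have sk := site_adj_sqrt kh; rewrite !weightE /weight_ratio mulrACA -expRD.
have q0 := adj_radius_ge0; have b1 := site_base_ge1 h.
apply: ler_pM; rewrite ?expR_ge0 ?powR_ge0 //.
  have a2 : 0 <= 2 * a by rewrite mulr_ge0 ?(ltW a0).
  by rewrite ler_expR -mulrDr addrC ler_wpM2l.
have b0 := le_trans ler01 b1.
rewrite -powRM ?addr_ge0 //.
apply: ge0_ler_powR; rewrite ?nnegrE ?mulr_ge0 ?addr_ge0 ?(ltW p0) //.
  exact: le_trans ler01 (site_base_ge1 k).
rewrite {1}/site_base; case: eqVneq => [_|k0].
  by rewrite -[leLHS]mul1r ler_pM // lerDl.
apply: le_trans sk _; rewrite mulrDl mul1r; apply: lerD.
  rewrite /site_base; case: eqVneq => // ->.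
  have -> : normsq (0 : 'rV[int]_n) = 0 by rewrite /normsq big1 // => i _; rewrite mxE expr0n.
  by rewrite sqrtr0.
by rewrite -[leLHS]mulr1 ler_wpM2l.
Qed.

(** The largest value of |z_k^sg| on the unit ball of |w|_{a,p}. *)
Definition var_weight (w : 'rV[int]_n * bool) : R := (Num.sqrt (weight a p w.1))^-1.

Lemma var_weight_gt0 w : 0 < var_weight w.
Proof. by rewrite invr_gt0 sqrtr_gt0 weight_gt0. Qed.

Lemma var_weight_sqr w : weight a p w.1 * var_weight w ^+ 2 = 1.
Proof. by rewrite exprVn sqr_sqrtr ?mulfV ?gt_eqF ?ltW // weight_gt0. Qed.

Lemma var_weight_adj (w w' : 'rV[int]_n * bool) : site_adj v w.1 w'.1 -> var_weight w' <= Num.sqrt weight_ratio * var_weight w.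
Proof.
move=> /site_adj_weight h; rewrite /var_weight ler_pdivlMr ?sqrtr_gt0 ?weight_gt0 // mulrC.
rewrite ler_pdivrMr ?sqrtr_gt0 ?weight_gt0 // -sqrtrM ?weight_ratio_ge0 //.
by rewrite ler_sqrt // mulr_ge0 ?weight_ratio_ge0 // ltW // weight_gt0.
Qed.

Definition var_bound (x : var m n) : R := if x is inr w then r * var_weight w else 1.

Lemma var_bound_ge0 x : 0 <= var_bound x.
Proof. by case: x => //= w; rewrite mulr_ge0 ?ltW // var_weight_gt0. Qed.

Definition freq_bound P (nu : 'rV[int]_m) : R := expR (- \sum_i (nu 0 i)%:~R * complex.Im (px P i)).

(** Exact in the angles of P, and a majorant over the whole ball in the variables z. *)
Definition monom_bound P M : R := freq_bound P M.1 * \prod_(x <- M.2) var_bound x.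

Lemma monom_bound_ge0 P M : 0 <= monom_bound P M.
Proof. by rewrite mulr_ge0 ?expR_ge0 // prodr_ge0 // => x _; exact: var_bound_ge0. Qed.

Lemma normc_prod (T : Type) (l : seq T) (f : T -> R[i]) :
  nc (\prod_(x <- l) f x) = \prod_(x <- l) nc (f x).
Proof. by elim: l => [|x l IH]; rewrite ?big_nil ?Normc.normc1 // !big_cons Normc.normcM IH. Qed.

Lemma normc_monom_value P M :
  nc (monom_value P M) = freq_bound P M.1 * \prod_(x <- M.2) nc (var_value P x).
Proof.
rewrite /monom_value Normc.normcM normc_cexp normc_prod; congr (expR _ * _).
have -> : forall z : R[i], complex.Re ('i%C * z) = - complex.Im z.
  by case=> x y /=; rewrite mul0r mul1r sub0r.
congr (- _); rewrite (raddf_sum (@complex.Im R)); apply: eq_bigr => i _.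
by rewrite -(rmorph_int (real_complex R)); case: (px P i) => x y /=; rewrite mul0r addr0.
Qed.

Lemma var_value_le P w : D_ v a p s r P -> Sc v w.1 -> nc (var_value P (inr w)) <= r * var_weight w.
Proof.
move=> [_ _ hw] Sw; have w0 := weight_gt0 w.1.
have le1 : weight a p w.1 * nc (pw P w.1 w.2) ^+ 2 <= r ^+ 2.
  rewrite -lee_fin; apply: le_trans hw; apply: esum_ge; exists [set w.1].
    by split; [exact: finite_set1|move=> k ->].
  rewrite fsbig_set1 lee_fin ler_wpM2l ?(ltW w0) //.
  by rewrite (bigD1 w.2) //= lerDl sumr_ge0 // => b _; exact: sqr_ge0.
case: w Sw w0 le1 => k b /= Sw w0 le1.
rewrite /var_weight ler_pdivlMr ?sqrtr_gt0 //.
rewrite -(ler_pXn2r (n := 2)) ?nnegrE ?mulr_ge0 ?sqrtr_ge0 ?normc_ge0 ?(ltW r0) //.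
by rewrite exprMn sqr_sqrtr ?(ltW w0) // mulrC.
Qed.

Lemma monom_value_le P M : D_ v a p s r P -> zmonom v M -> nc (monom_value P M) <= monom_bound P M.
Proof.
move=> DP zM; rewrite normc_monom_value /monom_bound ler_wpM2l ?expR_ge0 //.
rewrite big_seq [leRHS]big_seq; apply: ler_prod => x /zM[w -> Sw].
by rewrite normc_ge0 /=; exact: var_value_le.
Qed.

Lemma prod_mset_cons (T : choiceType) (x : T) (W : {mset T}%mset) (f : T -> R) :
  \prod_(z <- ([mset x] `+` W)%mset) f z = f x * \prod_(z <- W) f z.
Proof. by rewrite (perm_big _ (perm_msetD _ _)) /= enum_msetn big_cat big_seq1. Qed.

Lemma prod_mset_pair (T : choiceType) (x y : T) (f : T -> R) :
  \prod_(z <- ([mset x] `+` [mset y])%mset) f z = f x * f y.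
Proof. by rewrite prod_mset_cons enum_msetn big_seq1. Qed.

(* The coordinates w and w' share the norm |w|_{a,p} = r, whence the factor 1 / sqrt 2. *)
Definition probe P (w w' : 'rV[int]_n * bool) : phase_point R m n :=
  PhasePoint (px P) (fun=> 0)
    (fun k b => if (k, b) \in [:: w; w'] then (r * (Num.sqrt 2)^-1 * var_weight (k, b))%:C%C else 0).

Lemma normc_probe P w w' x : x \in [:: w; w'] ->
  nc (var_value (probe P w w') (inr x)) = (Num.sqrt 2)^-1 * var_bound (inr x).
Proof.
case: x => k b h; rewrite /= h normc_real ger0_norm; first by rewrite mulrAC mulrC mulrA.
by rewrite !mulr_ge0 ?invr_ge0 ?sqrtr_ge0 // ltW // var_weight_gt0.
Qed.

Lemma sum_indicator_le1 (T : eqType) (l : seq T) (x : T) : uniq l ->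
  \sum_(k <- l) (k == x)%:R <= 1 :> R.
Proof.
move=> ul; have [xl|xl] := boolP (x \in l).
  rewrite (bigD1_seq x) //= eqxx big1 ?addr0 // => y /negPf->.
  by [].
rewrite big_seq big1 ?ler01 // => y yl.
by case: eqP => // yx; rewrite yx in yl; rewrite yl in xl.
Qed.

Lemma probe_D P w w' : D_ v a p s r P -> D_ v a p s r (probe P w w').
Proof.
move=> [hx _ _]; split=> //.
  by move=> i; rewrite Normc.normc0 sqr_ge0.
(* Each of the two coordinates uses half of r^2; if they coincide, the point stays strictly inside
   the ball. *)
pose g k : R := 2^-1 * r ^+ 2 * ((k == w.1)%:R + (k == w'.1)%:R).
have le_g k : weight a p k * \sum_(b : bool) nc (pw (probe P w w') k b) ^+ 2 <= g k.
  have term b : weight a p k * nc (pw (probe P w w') k b) ^+ 2 <=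
      2^-1 * r ^+ 2 * (((k, b) == w)%:R + ((k, b) == w')%:R).
    have [kb|kb] := boolP ((k, b) \in [:: w; w']).
      have := normc_probe P kb; rewrite /= => ->.
      have -> : weight a p k * ((Num.sqrt 2)^-1 * (r * var_weight (k, b))) ^+ 2 = 2^-1 * r ^+ 2 * 1.
        have lem (x y z q : R) : x * y = 1 -> x * (q * (z * y)) = q * z * 1.
          by move=> e; rewrite -e; ring.
        by rewrite !exprMn exprVn sqr_sqrtr //; exact: lem (var_weight_sqr (k, b)).
      apply: ler_wpM2l; first by rewrite mulr_ge0 ?invr_ge0 ?sqr_ge0.
      by move: kb; rewrite !inE => /orP[] /eqP <-; rewrite eqxx ?lerDl ?lerDr ler0n.
    rewrite /= (negPf kb) Normc.normc0 expr0n mulr0 mulr_ge0 ?addr_ge0 ?ler0n //.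
    by rewrite mulr_ge0 ?invr_ge0 ?sqr_ge0.
  rewrite mulr_sumr; apply: le_trans (ler_sum _ (fun b _ => term b)) _.
  rewrite -mulr_sumr /g; apply: ler_wpM2l; first by rewrite mulr_ge0 ?invr_ge0 ?sqr_ge0.
  have ind (x : 'rV[int]_n * bool) : \sum_(b : bool) ((k, b) == x)%:R = (k == x.1)%:R :> R.
    case: x => k1 b1 /=; rewrite big_bool !xpair_eqE.
    by case: (k == k1); case: b1; rewrite /= ?addr0 ?add0r.
  by rewrite big_split /= !ind.
apply: ge_ereal_sup => _ [F [fF _] <-].
rewrite fsbig_finite // sumEFin lee_fin.
apply: le_trans (ler_sum _ (fun k _ => le_g k)) _.
rewrite /g -mulr_sumr big_split /=.
have u1 := sum_indicator_le1 w.1 (fset_uniq (fset_set F)).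
have u2 := sum_indicator_le1 w'.1 (fset_uniq (fset_set F)).
apply: (@le_trans _ _ (2^-1 * r ^+ 2 * (1 + 1))); last by rewrite le_eqVlt; apply/orP; left; apply/eqP; field.
apply: ler_wpM2l; first by rewrite mulr_ge0 ?invr_ge0 ?sqr_ge0.
exact: lerD u1 u2.
Qed.

(** Both coordinates are 1 / sqrt 2 times their maximum, so the product is half of the majorant. *)
Lemma monom_bound_probe P nu w w' : monom_bound P (nu, ([mset inr w] `+` [mset inr w'])%mset) =
  2 * nc (monom_value (probe P w w') (nu, ([mset inr w] `+` [mset inr w'])%mset)).
Proof.
have hw : w \in [:: w; w'] by rewrite mem_head.
have hw' : w' \in [:: w; w'] by rewrite !inE eqxx orbT.
have e := normc_monom_value (probe P w w') (nu, ([mset inr w] `+` [mset inr w'])%mset).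
rewrite prod_mset_pair (normc_probe P hw) (normc_probe P hw') in e.
rewrite e /monom_bound prod_mset_pair.
have s2 : (Num.sqrt 2)^-1 * (Num.sqrt 2)^-1 = 2^-1 :> R.
  by rewrite -[LHS]invfM -[_ * _]expr2 sqr_sqrtr.
have lem (x y z q : R) : q * q = 2^-1 -> x * (y * z) = 2 * (x * (q * y * (q * z))).
  move=> h; have -> : 2 * (x * (q * y * (q * z))) = 2 * (q * q) * (x * (y * z)) by ring.
  by rewrite h mulfV ?mul1r.
exact: lem s2.
Qed.

Lemma step_ineq (x y z z' q c d k : R) : x <= c -> z' <= d * z -> 0 <= x -> 0 <= z' -> 0 <= q ->
  0 <= y -> 0 <= k -> x * y * (k * z' * q) <= c * d * (y * (k * z * q)).
Proof.
move=> xc zd x0 z0 q0 y0 k0.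
have -> : x * y * (k * z' * q) = x * z' * (y * k * q) by ring.
have -> : c * d * (y * (k * z * q)) = c * (d * z) * (y * k * q) by ring.
by apply: ler_wpM2r; [rewrite !mulr_ge0|apply: ler_pM].
Qed.

(** The factor e^(2s) is due to frequencies of l^1 norm at most 2 in the strip of width s; the
    square root appears because [var_weight] is an inverse square root of the weight. *)
Definition monom_bound_ratio : R := expR (2 * s) * Num.sqrt weight_ratio.

Lemma monom_bound_ratio_ge0 : 0 <= monom_bound_ratio.
Proof. by rewrite mulr_ge0 ?expR_ge0 ?sqrtr_ge0. Qed.

Lemma monom_bound_step P nu nu' w w' (W : {mset var m n}%mset) : D_ v a p s r P -> qstep v nu w w' ->
  monom_bound P (nu + nu', ([mset inr w'] `+` W)%mset) <= monom_bound_ratio * monom_bound P (nu', (inr w +` W)%mset).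
Proof.
move=> [hx _ _] [_ fr _ _ _ adj].
rewrite /monom_bound [X in _ * X <= _](prod_mset_cons (inr w') W) [X in _ <= _ * (_ * X)](prod_mset_cons (inr w) W).
have eD : freq_bound P (nu + nu') = freq_bound P nu * freq_bound P nu'.
  rewrite /freq_bound -expRD -opprD -big_split /=; congr (expR (- _)).
  by apply: eq_bigr => i _; rewrite mxE rmorphD mulrDl.
have e1 : freq_bound P nu <= expR (2 * s).
  rewrite ler_expR; apply: le_trans (ler_norm _) _; rewrite normrN.
  apply: le_trans (ler_norm_sum _ _ _) _.
  apply: (@le_trans _ _ (\sum_i (absz (nu 0 i))%:R * s)).
    apply: ler_sum => i _; rewrite normrM -intr_norm natr_absz ler_wpM2l ?ler0z //.
    exact: ltW.
  rewrite -mulr_suml -natr_sum ler_wpM2r ?(ltW s0) // ler_nat.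
  exact: nrm_freqs fr.
have e2 : var_weight w' <= Num.sqrt weight_ratio * var_weight w by exact: var_weight_adj.
have W0 : 0 <= \prod_(x <- W) var_bound x by apply: prodr_ge0 => x _; exact: var_bound_ge0.
have := step_ineq e1 e2 (expR_ge0 _) (ltW (var_weight_gt0 w')) W0 (expR_ge0 _ : 0 <= freq_bound P nu') (ltW r0).
rewrite -eD; exact: id.
Qed.

End Weights.

(** * Bounds for the nilpotent part and the inverse *)

Section NormBound.
Context (R : realType) (m n : nat) (v : 'M[int]_(m, n)) (H : set ('I_m -> R))
  (mu : vertex m -> nat -> ('I_m -> R) -> R[i]).
Hypothesis (branches : eigenvalue_branches v H mu).
Context (B : nat).
Hypothesis hB : forall u, basis01 v u -> (block_size R v u <= B)%N.
Context (xi : 'I_m -> R) (rho : R).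
Hypotheses (pxi : positive xi) (nH : ~ H xi) (xile : forall i, xi i <= rho) (rho0 : 0 <= rho).
Context (a p s r : R).
Hypotheses (a0 : 0 < a) (p0 : 0 < p) (s0 : 0 < s) (r0 : 0 < r).
Implicit Types (P : phase_point R m n) (M A : monom m n) (X : hseries R m n)
  (la lb : ('I_m -> R) -> R[i]) (u : vertex m).
Local Notation nc := Normc.normc.

(** Gershgorin's theorem places one diagonal entry of the block near the eigenvalue; [diag_block]
    carries this to all the others. *)
Lemma diag_spectrum la u : in_spectrum v H mu la u ->
  nc ((diag v xi (elt v u))%:C%C - la xi) <= B%:R * (off_bound m rho + 4 * rho).
Proof.
move=> su; have fu := in_spectrum_finite su; have [bu _] := su.
have [X [bX nX eX]] := block_eigenvector pxi fu bu (in_spectrum_root branches pxi nH su).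
have [u1 uu1 h1] := diag_gershgorin pxi xile rho0 fu bu bX nX eX.
have h2 := diag_block pxi xile rho0 fu uu1.
have e : (diag v xi (elt v u))%:C%C - la xi = (diag v xi (elt v u) - diag v xi (elt v u1))%:C%C
    + ((diag v xi (elt v u1))%:C%C - la xi) by rewrite rmorphB /= addrA subrK.
rewrite e; apply: le_trans (le_normcD _ _) _; rewrite normc_real.
have sB : (block_size R v u)%:R <= B%:R :> R by rewrite ler_nat hB.
rewrite mulrDr addrC; apply: lerD.
  by apply: le_trans h1 _; rewrite ler_wpM2r // off_bound_ge0.
by apply: le_trans h2 _; rewrite ler_wpM2r // mulr_ge0.
Qed.

Lemma size_off_list u u' :
  (size (off_list v xi (monom_mul (elt v u) (elt v u'))) <= 2 * (6 * (m * m)))%N.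
Proof.
rewrite off_list.unlock; set M := monom_mul _ _.
have sM : size M.2 = 2%N.
  by rewrite /M /monom_mul !eltE (perm_size (perm_msetD _ _)) size_cat /= !enum_msetn.
apply: leq_trans (size_flatten_le (B := 6 * (m * m)) _) _; last by rewrite sM.
move=> x _; rewrite size_map Qdir.unlock.
by case: x => // w; rewrite size_map; exact: size_Qlist.
Qed.

(** A quadratic monomial has two variables, and each is replaced in at most 6 m^2 ways. *)
Definition off_ratio : R := (2 * (6 * (m * m)))%:R * (off_bound m rho * monom_bound_ratio v a p s).

Lemma off_list_norm P u u' : D_ v a p s r P -> basis01 v u -> basis01 v u' ->
  \sum_(t <- off_list v xi (monom_mul (elt v u) (elt v u'))) nc t.1 * monom_bound a p r P t.2 <=
  off_ratio * monom_bound a p r P (monom_mul (elt v u) (elt v u')).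
Proof.
move=> DP bu bu'; set M := monom_mul _ _.
have zM : zmonom v M by apply: zmonomM; exact: zmonom_elt.
pose b := off_bound m rho * (monom_bound_ratio v a p s * monom_bound a p r P M).
have b0 : 0 <= b.
  by apply: mulr_ge0; [exact: off_bound_ge0|apply: mulr_ge0; [exact: monom_bound_ratio_ge0|exact: monom_bound_ge0]].
have le_b t : t \in off_list v xi M -> nc t.1 * monom_bound a p r P t.2 <= b.
  move=> /(off_listP zM)[w [nu [w' [wM st -> [q _ ->]]]]].
  apply: ler_pM; [exact: normc_ge0|exact: monom_bound_ge0|idtac|idtac].
    rewrite -[leRHS]mul1r; apply: normcM_le; last exact: Qfield_le (xi_bounds pxi xile) rho0.
    by case: w.2; rewrite /sgz ?mulr1z ?mulrN1z ?normcN Normc.normc1.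
  apply: le_trans (monom_bound_step a0 p0 s0 r0 _ _ DP st) _.
  by rewrite msetB1K // -surjective_pairing.
apply: (@le_trans _ _ (\sum_(t <- off_list v xi M) b)).
  by rewrite big_seq [leRHS]big_seq; apply: ler_sum.
rewrite big_const_seq count_predT iter_addr addr0 -[X in X <= _]mulr_natl.
have -> : off_ratio * monom_bound a p r P M = (2 * (6 * (m * m)))%:R * b.
  by rewrite /off_ratio /b !mulrA.
by apply: ler_wpM2r => //; rewrite ler_nat; exact: size_off_list.
Qed.

Definition weighted_norm P (S : seq (monom m n)) X : R := \sum_(M <- S) nc (X M) * monom_bound a p r P M.

Lemma sum_lc_le (S : seq (monom m n)) (l : seq (R[i] * monom m n)) (V : monom m n -> R) :
  uniq S -> (forall M, 0 <= V M) ->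
  \sum_(M <- S) nc (lc l M) * V M <= \sum_(t <- l) nc t.1 * V t.2.
Proof.
move=> uS V0; apply: (@le_trans _ _ (\sum_(M <- S) \sum_(t <- l | M == t.2) nc t.1 * V M)).
  apply: ler_sum => M _; rewrite -mulr_suml ler_wpM2r // lcE.
  exact: normc_le_sum.
rewrite (exchange_big_dep predT) //=; apply: ler_sum => t _.
have [tS|tS] := boolP (t.2 \in S).
  rewrite big_mkcond (bigD1_seq t.2) //= eqxx big1 ?addr0 // => M.
  by move=> /negPf->.
rewrite big_seq_cond big1 ?mulr_ge0 ?normc_ge0 // => M /andP[MS /eqP e].
by rewrite -e MS in tS.
Qed.

Definition step_norm : R := 2 * (B%:R * (off_bound m rho + 4 * rho)) + off_ratio.

Lemma adT_sub_term (x y z l : R[i]) (b : bool) :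
  (if b then - l * x else 0) + x * ((if b then y else 0) + z) =
  x * ((if b then y - l else 0) + z).
Proof. by case: b; ring. Qed.

Lemma adT_sub_expand (S : seq (monom m n)) lam X M0 : uniq S -> (forall M, M \in S -> zmonom v M) ->
  (forall M, X M != 0 -> M \in S) -> M0 \in S ->
  adT_sub v xi lam X M0 = \sum_(A <- S) X A *
    ((if M0 == A then (diag v xi A)%:C%C - lam else 0) + lc (off_list v xi A) M0).
Proof.
move=> uS zS XS M0S; rewrite /adT_sub (adT_sum _ uS zS XS).
have -> : - lam * X M0 = \sum_(A <- S) (if M0 == A then - lam * X A else 0).
  rewrite (bigD1_seq M0) //= eqxx big1 ?addr0 // => A.
  by rewrite eq_sym => /negPf->.
rewrite -big_split; apply: eq_bigr => A _ /=.
by rewrite /op_list lc_cons; exact: adT_sub_term.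
Qed.

Lemma normc_if_le (x y z l : R[i]) (b : bool) :
  nc (x * ((if b then y - l else 0) + z)) <= nc x * ((if b then nc (y - l) else 0) + nc z).
Proof.
rewrite Normc.normcM ler_wpM2l ?normc_ge0 //; apply: le_trans (le_normcD _ _) _.
by rewrite lerD2r; case: b; rewrite ?Normc.normc0.
Qed.

(** An operator is bounded in an l^1 norm by its columns: after exchanging the sums it suffices to
    estimate the image of one monomial. Its diagonal part splits as a sum over the two factors, each
    close to its own eigenvalue. *)
Lemma weighted_norm_adT_sub_le P (S : seq (monom m n)) la lb X : D_ v a p s r P -> uniq S ->
  (forall M, M \in S -> exists u u', [/\ in_spectrum v H mu la u, in_spectrum v H mu lb u'
     & M = monom_mul (elt v u) (elt v u')]) ->
  (forall M, X M != 0 -> M \in S) ->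
  weighted_norm P S (adT_sub v xi (la xi + lb xi) X) <= step_norm * weighted_norm P S X.
Proof.
move=> DP uS Sspec XS; set lam := la xi + lb xi.
have zS M : M \in S -> zmonom v M.
  by move=> /Sspec[u [u' [[bu _] [bu' _] ->]]]; apply: zmonomM; exact: zmonom_elt.
have V0 M : 0 <= monom_bound a p r P M by exact: monom_bound_ge0.
have diag_le A : A \in S -> nc ((diag v xi A)%:C%C - lam) <= 2 * (B%:R * (off_bound m rho + 4 * rho)).
  move=> /Sspec[u [u' [su su' ->]]].
  have -> : (diag v xi (monom_mul (elt v u) (elt v u')))%:C%C - lam =
      ((diag v xi (elt v u))%:C%C - la xi) + ((diag v xi (elt v u'))%:C%C - lb xi).
    by rewrite diagM rmorphD /= addrACA /lam opprD.
  apply: le_trans (le_normcD _ _) _; rewrite mulr_natl mulr2n.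
  by apply: lerD; exact: diag_spectrum.
apply: (@le_trans _ _ (\sum_(M0 <- S) \sum_(A <- S) nc (X A) *
    (((if M0 == A then nc ((diag v xi A)%:C%C - lam) else 0) + nc (lc (off_list v xi A) M0))
      * monom_bound a p r P M0))).
  rewrite /weighted_norm big_seq [leRHS]big_seq; apply: ler_sum => M0 M0S.
  rewrite (adT_sub_expand lam uS zS XS M0S).
  apply: le_trans (ler_wpM2r (V0 M0) (normc_le_sum _ _ _)) _.
  rewrite mulr_suml; apply: ler_sum => A _.
  apply: le_trans (ler_wpM2r (V0 M0) (normc_if_le _ _ _ _ _)) _.
  by rewrite -mulrA.
rewrite exchange_big /weighted_norm mulr_sumr /= big_seq [leRHS]big_seq; apply: ler_sum => A AS.
rewrite -mulr_sumr mulrCA; apply: ler_wpM2l; first exact: normc_ge0.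
rewrite (eq_bigr (fun M0 => (if M0 == A then nc ((diag v xi A)%:C%C - lam) * monom_bound a p r P A else 0)
    + nc (lc (off_list v xi A) M0) * monom_bound a p r P M0)); last first.
  by move=> M0 _; rewrite mulrDl; case: eqP => [->|_]; rewrite ?mul0r.
rewrite big_split /= /step_norm mulrDl; apply: lerD.
  rewrite (bigD1_seq A) //= eqxx big1 ?addr0; last by move=> M0 /negPf->.
  by rewrite ler_wpM2r // diag_le.
apply: le_trans (@sum_lc_le S _ _ uS V0) _.
have [u [u' [[bu _] [bu' _] ->]]] := Sspec _ AS.
exact: off_list_norm.
Qed.

Lemma value_weighted_norm P (S : seq (monom m n)) X : D_ v a p s r P -> uniq S ->
  (forall M, M \in S -> zmonom v M) -> (forall M, X M != 0 -> M \in S) ->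
  nc (value X P) <= weighted_norm P S X.
Proof.
move=> DP uS zS XS; rewrite (valueE P uS XS); apply: le_trans (normc_le_sum _ _ _) _.
rewrite /weighted_norm big_seq [leRHS]big_seq; apply: ler_sum => M MS.
by rewrite Normc.normcM ler_wpM2l ?normc_ge0 //; exact: (monom_value_le r0 DP (zS _ MS)).
Qed.

Lemma weighted_norm_value P (S : seq (monom m n)) X (b : R) : D_ v a p s r P -> zfin v X ->
  (forall M, M \in S -> exists u u', M = monom_mul (elt v u) (elt v u')) ->
  (forall P, D_ v a p s r P -> nc (value X P) <= b) ->
  weighted_norm P S X <= (size S)%:R * (2 * b).
Proof.
move=> DP zX Sspec hb; apply: (@le_trans _ _ (\sum_(M <- S) 2 * b)); last first.
  by rewrite big_const_seq count_predT iter_addr addr0 -[X in X <= _]mulr_natl.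
rewrite /weighted_norm big_seq [leRHS]big_seq; apply: ler_sum => M /Sspec[u [u' ->]].
rewrite /monom_mul !eltE /= monom_bound_probe // mulrCA -Normc.normcM ler_pM2l //.
by apply: (coef_value_le _ zX hb); exact: probe_D.
Qed.

End NormBound.

(** * The constants and the final estimate *)

Section Constants.
Context (R : realType).

Lemma geometric_bound (N : nat) (x q : R) : 0 <= x -> x <= q -> 1 <= q ->
  q * \sum_(j < N) x ^+ j <= N%:R * q ^+ N.
Proof.
move=> x0 xq q1; have q0 := le_trans ler01 q1.
rewrite mulr_sumr -[N in N%:R]card_ord mulr_natl -sumr_const; apply: ler_sum => j _.
apply: (@le_trans _ _ (q * q ^+ j)).
  by rewrite ler_wpM2l // lerXn2r // nnegrE.
by rewrite -exprS ler_weXn2l.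
Qed.

(** [rho * T0] bounds n, and the fraction bounds 1 / |lam| by the small divisor condition. *)
Lemma gap_constant (N : nat) (T0 gam rho dl nu tau sz Z b : R) :
  0 <= T0 -> 0 < gam -> 0 < rho -> 0 <= dl -> 0 <= nu -> 0 < tau -> 0 <= sz -> sz <= Z -> 0 <= b ->
  (1 + nu `^ tau) / (gam * (dl + rho)) *
    (\sum_(j < N) (rho * T0 * ((1 + nu `^ tau) / (gam * (dl + rho)))) ^+ j) * (sz * (2 * b)) <=
  (2 / gam * N%:R * (1 + 2 * T0 / gam) ^+ N * 2 * Z + 1) *
    (Num.max 1 nu `^ (N%:R * tau + 1) / (dl + rho)) * b.
Proof.
move=> T00 gam0 rho0 dl0 nu0 tau0 sz0 szZ b0.
set W := Num.max 1 nu `^ tau; set T1 := 1 + 2 * T0 / gam; set L := (1 + nu `^ tau) / _.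
have m1 : 1 <= Num.max 1 nu by rewrite le_max lexx.
have W1 : 1 <= W.
  by rewrite -[leLHS](powRr0 (Num.max 1 nu)); apply: ler_powR => //; exact: ltW.
have W0 := le_trans ler01 W1.
have nuW : nu `^ tau <= W.
  apply: ge0_ler_powR; rewrite ?nnegrE ?(ltW tau0) //; last by rewrite le_max lexx orbT.
  exact: le_trans ler01 m1.
have dr : 0 < dl + rho by rewrite ltr_wpDl.
have gi : 0 < gam^-1 by rewrite invr_gt0.
have di : 0 < (dl + rho)^-1 by rewrite invr_gt0.
have T11 : 1 <= T1 by rewrite lerDl !mulr_ge0 // ltW.
have L0 : 0 <= L.
  by rewrite mulr_ge0 ?addr_ge0 ?powR_ge0 // invr_ge0 mulr_ge0 // ltW.
have LW : L <= 2 / gam * W / (dl + rho).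
  rewrite /L invfM mulrA; apply: ler_wpM2r; first exact: ltW.
  rewrite mulrAC; apply: ler_wpM2r; first exact: ltW.
  by rewrite mulr_natl mulr2n; apply: lerD.
(* [q] dominates both W and the ratio of the geometric sum, in which rho is absorbed by the
   denominator; hence W times the sum is at most N q^N, and the power of W is N rather than N +
   1. *)
pose q := T1 * W.
have q1 : 1 <= q by rewrite -[leLHS]mul1r; apply: ler_pM.
have x0 : 0 <= rho * T0 * L by apply: mulr_ge0 => //; apply: mulr_ge0 => //; exact: ltW.
have xq : rho * T0 * L <= q.
  have rd : rho / (dl + rho) <= 1 by rewrite ler_pdivrMr // mul1r lerDr.
  apply: (@le_trans _ _ (rho * T0 * (2 / gam * W / (dl + rho)))).
    by apply: ler_wpM2l => //; rewrite mulr_ge0 // ltW.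
  have -> : rho * T0 * (2 / gam * W / (dl + rho)) = (rho / (dl + rho)) * (2 * T0 / gam * W) by ring.
  have -> : q = W + 2 * T0 / gam * W by rewrite /q /T1; ring.
  apply: (@le_trans _ _ (2 * T0 / gam * W)).
    apply: (ler_piMl _ rd); apply: mulr_ge0 => //; apply: mulr_ge0; last exact: ltW.
    exact: mulr_ge0.
  by rewrite lerDr.
set Sg := \sum_(j < N) _.
have Sg0 : 0 <= Sg by apply: sumr_ge0 => j _; rewrite exprn_ge0.
have Sq : W * Sg <= N%:R * q ^+ N.
  apply: le_trans (geometric_bound N x0 xq q1); rewrite ler_wpM2r //.
  by apply: ler_peMl.
have WN : W ^+ N <= Num.max 1 nu `^ (N%:R * tau + 1).
  rewrite /W -powR_mulrn ?powR_ge0 // -powRrM mulrC; apply: ler_powR => //.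
  by rewrite lerDl.
set mx := Num.max 1 nu `^ (N%:R * tau + 1) in WN *.
have LS : L * Sg <= 2 / gam * N%:R * T1 ^+ N * (mx / (dl + rho)).
  apply: (@le_trans _ _ (2 / gam * (W * Sg) / (dl + rho))).
    have -> : 2 / gam * (W * Sg) / (dl + rho) = (2 / gam * W / (dl + rho)) * Sg by ring.
    by rewrite ler_wpM2r.
  have -> : 2 / gam * N%:R * T1 ^+ N * (mx / (dl + rho)) =
      2 / gam * (N%:R * (T1 ^+ N * mx)) / (dl + rho) by ring.
  apply: ler_wpM2r; first exact: ltW.
  apply: ler_wpM2l; first by rewrite mulr_ge0 // ltW.
  apply: le_trans Sq _; rewrite /q exprMn; apply: ler_wpM2l => //.
  by rewrite ler_wpM2l // exprn_ge0 // (le_trans ler01).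
have mx0 : 0 <= mx by exact: powR_ge0.
have c0 : 0 <= 2 / gam * N%:R * T1 ^+ N * (mx / (dl + rho)).
  have g2 : 0 <= 2 / gam by rewrite mulr_ge0 // ltW.
  have T1N : 0 <= T1 ^+ N by rewrite exprn_ge0 // (le_trans ler01).
  by apply: mulr_ge0; [do 2 apply: mulr_ge0 => //; exact: ler0n|apply: mulr_ge0 => //; exact: ltW].
apply: (@le_trans _ _ (2 / gam * N%:R * T1 ^+ N * (mx / (dl + rho)) * (Z * (2 * b)))).
  have b2 : 0 <= 2 * b by exact: mulr_ge0.
  by apply: ler_pM; [exact: mulr_ge0|exact: mulr_ge0|exact: LS|exact: ler_wpM2r].
have -> : 2 / gam * N%:R * T1 ^+ N * (mx / (dl + rho)) * (Z * (2 * b)) =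
   (2 / gam * N%:R * T1 ^+ N * 2 * Z) * (mx / (dl + rho)) * b by ring.
rewrite ler_wpM2r // ler_wpM2r ?lerDl //.
by rewrite mulr_ge0 // ltW.
Qed.

End Constants.

(** An infinite norm of f makes the inequality trivial, and the norm is not - oo once the domain
    contains a point. *)
Lemma supnorm_le (R : realType) (m n : nat) (v : 'M[int]_(m, n)) (a p s r K : R)
    (f g : hseries R m n) : 0 < K ->
  (forall (b : R) P, 0 <= b -> (forall Q, D_ v a p s r Q -> Normc.normc (value f Q) <= b) ->
     D_ v a p s r P -> Normc.normc (value g P) <= K * b) ->
  (supnorm v a p s r g <= K%:E * supnorm v a p s r f)%E.
Proof.
move=> K0 h; apply: ge_ereal_sup => _ [P DP <-].
have ub Q : D_ v a p s r Q -> ((Normc.normc (value f Q))%:E <= supnorm v a p s r f)%E.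
  by move=> DQ; apply: ereal_sup_ubound; exists Q.
move: ub; case: (supnorm v a p s r f) => [b| |] ub.
- rewrite -EFinM lee_fin; apply: (h _ _ _ _ DP) => [|Q DQ]; last by rewrite -lee_fin; exact: ub.
  by apply: le_trans (normc_ge0 (value f P)) _; rewrite -lee_fin; exact: ub.
- by rewrite gt0_muley ?lte_fin // leey.
- by have := ub P DP.
Qed.

Theorem proposition6p21 (R : realType) (m n : nat) (hn : (3 < n)%N) :
  exists2 P : mpoly (m * n) int, P <> 0 &
  forall v : 'M[int]_(m, n), meval (fun j => mxvec v 0 j) P <> 0 ->
  forall (root : vertex m -> vertex m) (H : set ('I_m -> R))
         (mu : vertex m -> nat -> ('I_m -> R) -> R[i]) (kappa : nat),
  root_choice R v root ->
  semialgebraic_hypersurface H ->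
  eigenvalue_branches v H mu ->
  (forall (xi : 'I_m -> R) (u : vertex m) (i : nat), positive xi -> ~ H xi ->
     basis01 v u -> (i < block_size R v u)%N -> dim_le kappa (F01 v H mu xi (mu u i))) ->
  forall al gam tau0 a p s : R, 0 < al < 2 -> 0 < gam -> 0 < tau0 ->
  0 < a -> n%:R / 2 < p -> 0 < s ->
  exists C r0 : R, [/\ 0 < C, 0 < r0 &
  forall r : R, 0 < r < r0 ->
  forall xi : 'I_m -> R, C_ v al r gam tau0 root H mu xi ->
  forall (u u' : vertex m) (i j : nat), basis01 v u -> basis01 v u' ->
  (i < block_size R v u)%N -> (j < block_size R v u')%N ->
  ~ identically_eq H (fun x => mu u i x + mu u' j x) (fun=> 0) ->
  set_bij (F02 v H mu xi (mu u i) (mu u' j)) (F02 v H mu xi (mu u i) (mu u' j))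
    (adN v xi) /\
  forall f g : hseries R m n,
    F02 v H mu xi (mu u i) (mu u' j) f -> F02 v H mu xi (mu u i) (mu u' j) g ->
    adN v xi g = f ->
    (supnorm v a p s r g <=
      (C * (Num.max 1 (norm1 R (frequency root u + frequency root u'))
              `^ (kappa%:R ^+ 2 * tau0 + 1)
            / (delta_gap (mu u i) (mu u' j) + r `^ al)))%:E
      * supnorm v a p s r f)%E].
Proof.
(* The witness is the constant polynomial 1: [block_size_bounded] holds for every v, an infinite
   block having size 0. *)
exists 1; first by apply/eqP; exact: oner_neq0.
move=> v _ root H mu kappa _ _ br dimF al gam tau0 a p s _ gam0 tau00 a0 np s0.
have p0 : 0 < p by apply: le_lt_trans np; rewrite divr_ge0 // ler0n.
have [B hB] := block_size_bounded R v.
(* [step_norm] divided by rho = r^alpha, which leaves a constant independent of r and xi. *)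
pose T0 : R := 2 * (B%:R * (2 * hamQ_bound R m + 4)) +
  (2 * (6 * (m * m)))%:R * (2 * hamQ_bound R m * monom_bound_ratio v a p s).
pose N := (kappa ^ 2)%N; pose Z : R := (kappa * B * (kappa * B))%:R.
have hQ0 : 0 <= hamQ_bound R m by exact: ler0n.
have T00 : 0 <= T0.
  have vr := monom_bound_ratio_ge0 v a p s.
  apply: addr_ge0; do 2 apply: mulr_ge0 => //.
    by apply: addr_ge0 => //; exact: mulr_ge0.
  exact: mulr_ge0.
(* The final 1 keeps C positive when the first term vanishes. *)
pose C := 2 / gam * N%:R * (1 + 2 * T0 / gam) ^+ N * 2 * Z + 1.
have C0 : 0 < C.
  rewrite ltr_wpDl // !mulr_ge0 ?ler0n ?invr_ge0 ?exprn_ge0 ?(ltW gam0) //.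
  by rewrite addr_ge0 // !mulr_ge0 ?invr_ge0 ?(ltW gam0).
exists C, 1; split=> // r /andP[r0 _] xi [xiA nH gap] u u' i j bu bu' iu ju nid.
set la := mu u i; set lb := mu u' j; set rho := r `^ al.
have rho0 : 0 < rho by exact: powR_gt0.
have pxi : positive xi.
  move=> k; have /andP[h _] := xiA k; apply: lt_le_trans h.
  by rewrite mulr_gt0 // invr_gt0.
have xile k : xi k <= rho by have /andP[] := xiA k.
have da := dimF xi u i pxi nH bu iu; have db := dimF xi u' j pxi nH bu' ju.
set nu := norm1 R _.
have nu0 : 0 <= nu by rewrite ler0z sumr_ge0.
have dl0 : 0 <= delta_gap la lb by rewrite /delta_gap; case: ifP.
have dr : 0 < delta_gap la lb + rho by rewrite ltr_wpDl.
have nup : 0 < 1 + nu `^ tau0 by rewrite ltr_wpDr ?powR_ge0.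
have gap1 := gap u u' i j bu bu' iu ju nid.
have lamn : 0 < Normc.normc (la xi + lb xi).
  by apply: lt_le_trans gap1; rewrite mulr_gt0 ?invr_gt0 // mulr_gt0.
have lam0 : la xi + lb xi != 0.
  by apply: contraTneq lamn => ->; rewrite Normc.normc0 ltxx.
split; first exact: (adN_F02_bij pxi da db lam0).
move=> f g Ff Fg Tg.
have [s1 [ss1 s1s s1c]] := in_spectrum_cover br pxi nH da hB.
have [s2 [ss2 s2s s2c]] := in_spectrum_cover br pxi nH db hB.
pose S := undup [seq monom_mul (elt v x) (elt v y) | x <- s1, y <- s2].
have uS : uniq S by exact: undup_uniq.
have Sspec M : M \in S -> exists x y, [/\ in_spectrum v H mu la x, in_spectrum v H mu lb y
    & M = monom_mul (elt v x) (elt v y)].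
  rewrite mem_undup => /allpairsP[[x y] [/= xs ys ->]].
  by exists x, y; split=> //; [exact: s1s|exact: s2s].
have zS M : M \in S -> zmonom v M.
  by move=> /Sspec[x [y [[bx _] [by_ _] ->]]]; apply: zmonomM; exact: zmonom_elt.
have suppS X : F02 v H mu xi la lb X -> forall M, X M != 0 -> M \in S.
  move=> FX M /(F02_supp br FX)[x [y [sx sy ->]]]; rewrite mem_undup.
  by apply: allpairs_f; [exact: s1c|exact: s2c].
have sZ : (size S)%:R <= Z.
  rewrite ler_nat; apply: leq_trans (size_undup _) _; rewrite size_allpairs.
  exact: leq_mul.
have kN : kappa%:R ^+ 2 = N%:R :> R by rewrite /N natrX.
rewrite kN; apply: supnorm_le => [|b P b0 hb DP].
  by rewrite mulr_gt0 // mulr_gt0 ?invr_gt0 // powR_gt0 // lt_max ltr01.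
pose Lam := (1 + nu `^ tau0) / (gam * (delta_gap la lb + rho)).
have lamLam : (Normc.normc (la xi + lb xi))^-1 <= Lam.
  rewrite /Lam -[leRHS]invrK invf_div lef_pV2 ?posrE //.
  by rewrite mulr_gt0 ?invr_gt0 // mulr_gt0.
have tE : step_norm v B rho a p s = rho * T0.
  by rewrite /step_norm /off_ratio /off_bound /T0; ring.
have t0 : 0 <= step_norm v B rho a p s by rewrite tE mulr_ge0 // ltW.
have weighted_norm0 : weighted_norm a p r P S (fun=> 0) = 0.
  by rewrite /weighted_norm big1 // => M _; rewrite Normc.normc0 mul0r.
have weighted_norm_ge0 X : 0 <= weighted_norm a p r P S X.
  by apply: sumr_ge0 => M _; rewrite mulr_ge0 ?normc_ge0 // monom_bound_ge0.
have weighted_norm_lin c X Y : weighted_norm a p r P S (fun M => c * X M + Y M) <=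
    Normc.normc c * weighted_norm a p r P S X + weighted_norm a p r P S Y.
  rewrite /weighted_norm mulr_sumr -big_split; apply: ler_sum => M _ /=.
  rewrite mulrA -mulrDl ler_wpM2r ?monom_bound_ge0 //.
  by apply: le_trans (le_normcD _ _) _; rewrite Normc.normcM.
have b1 := weighted_norm_inverse lam0 (lin_span0 _)
  (fun c X Y FX FY => lin_span_lin c FX FY)
  (fun X FX => F02_zfin FX) (fun X FX => F02_adT_sub pxi FX)
  (fun X FX => F02_nilpotent pxi da db FX) weighted_norm0 weighted_norm_ge0
  (fun c X Y _ _ => weighted_norm_lin c X Y) t0
  (fun X FX => weighted_norm_adT_sub_le br hB pxi nH xile (ltW rho0) a0 p0 s0 r0 DP uS Sspec (suppS X FX))
  lamLam Fg.
have nmT : weighted_norm a p r P S (adT v xi g) = weighted_norm a p r P S f.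
  by apply: eq_bigr => M _; rewrite /adT Tg Normc.normcM normcN normc_i mul1r.
have b2 : weighted_norm a p r P S f <= (size S)%:R * (2 * b).
  apply: (weighted_norm_value r0 DP (F02_zfin Ff)) => // M /Sspec[x [y [_ _ ->]]].
  by exists x, y.
apply: le_trans (value_weighted_norm r0 DP uS zS (suppS g Fg)) _.
apply: le_trans b1 _; rewrite nmT tE.
have S0 : 0 <= \sum_(k < N) (rho * T0 * Lam) ^+ k.
  apply: sumr_ge0 => k _; rewrite exprn_ge0 // mulr_ge0 //; first by rewrite mulr_ge0 // ltW.
  by apply: le_trans lamLam; rewrite invr_ge0 normc_ge0.
have L0 : 0 <= Lam by apply: le_trans lamLam; rewrite invr_ge0 normc_ge0.
apply: le_trans (ler_wpM2l (mulr_ge0 L0 S0) b2) _.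
exact: gap_constant.
Qed.
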